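(* Let $0<M_1\le M_2$ and $\Theta=\{\Sigma\succeq0:\lambda_{\max}(\Sigma)\le M_2,\ \lambda_{\min}(\Sigma)\ge M_1\}$. Let $P_{\Sigma^*}=\mathcal{N}(0,\Sigma^* )$ with $\Sigma^*\in\Theta$, let $P$ satisfy $W(P,P_{\Sigma^*})\le\epsilon$, and let $X_1,\dots,X_n\stackrel{i.i.d.}{\sim}P$. Let $L\ge2$, $B=1/M_1$, and let $\widehat\Sigma$ be the W-GAN estimator over $\{\mathcal{N}(0,\Sigma):\Sigma\in\Theta\}$ with function class $\mathcal{D}(B,L)$. There are constants $c>0$ (sufficiently small) and $C'>0$, with $C'$ depending on $M_1,M_2$, such that if $2^L\cdot\frac pn+\epsilon^2\le c$, then with probability at least $1-e^{-(p+n\epsilon^2)}$, $$\|\widehat\Sigma-\Sigma^*\|_2\le C'\left(2^L\sqrt{\frac pn}\vee\epsilon\right).$$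
   Context: $\|\cdot\|_2$ on matrices is the spectral norm; $W$ is the Wasserstein-1 distance. $\mathcal{D}(B,L)$: networks $f:\mathbb{R}^p\to\mathbb{R}$ whose first-layer nodes are $x\mapsto\sigma(w^Tx+b)$, $\sigma(u)=1/(1+e^{-u})$, $\|w\|_2\le B$, $b\in\mathbb{R}$; for $1\le l<L-1$, nodes of layer $l+1$ are $\max(\sum_iw_if^{(l)}_i(x),0)$ with $f_i^{(l)}$ nodes of layer $l$ (finite width) and $\sum_i|w_i|\le1$; output $\sum_iw_if_i^{(L-1)}(x)$ with $\sum_i|w_i|\le1$. W-GAN estimator: $\widehat\Sigma\in\arg\min_{\Sigma\in\Theta}\sup_{f\in\mathcal{D}}\{\frac1n\sum_if(X_i)-\mathbb{E}_{\mathcal{N}(0,\Sigma)}f(X)\}$ (assumed attained). *)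

(* Defs.v *)
From HB Require Import structures.
From mathcomp Require Import all_boot all_order all_algebra.
From mathcomp Require Import all_classical all_reals all_analysis.
Set Implicit Arguments. Unset Strict Implicit. Unset Printing Implicit Defensive.
Import Order.TTheory GRing.Theory Num.Theory.
Local Open Scope classical_set_scope.
Local Open Scope ring_scope.

(* Points of R^p are p-tuples, equipped with the product (Borel) sigma-algebra
   of the library (measurable_tuple). *)

Section Defs.
Variable R : realType.

Definition edist (p : nat) (x y : p.-tuple R) : R :=
  Num.sqrt (\sum_(i < p) (tnth x i - tnth y i) ^+ 2).

Definition dotv (p : nat) (w : 'I_p -> R) (x : p.-tuple R) : R :=
  \sum_(i < p) w i * tnth x i.

Definition vnorm (p : nat) (w : 'I_p -> R) : R :=
  Num.sqrt (\sum_(i < p) w i ^+ 2).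

Definition qform (p : nat) (S : 'M[R]_p) (u : 'I_p -> R) : R :=
  \sum_(i < p) \sum_(j < p) u i * S i j * u j.

Definition spec_norm (p : nat) (A : 'M[R]_p) : R :=
  sup [set vnorm (fun i => \sum_(j < p) A i j * v j) |
        v in [set v : 'I_p -> R | vnorm v <= 1]].

Definition inTheta (M1 M2 : R) (p : nat) (S : 'M[R]_p) : Prop :=
  S^T = S /\ (forall u, 0 <= qform S u) /\
  (forall a : R, eigenvalue S a -> M1 <= a /\ a <= M2).

Definition is_gaussian (p : nat) (mu : probability (p.-tuple R) R)
    (S : 'M[R]_p) : Prop :=
  forall (u : 'I_p -> R) (A : set R), measurable A ->
    mu (dotv u @^-1` A) =
      (if qform S u == 0 then \d_(0 : R) A
       else normal_prob 0 (Num.sqrt (qform S u)) A).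

Definition coupling (p : nat) (P Q : probability (p.-tuple R) R) :
    set (probability (p.-tuple R * p.-tuple R)%type R) :=
  [set pi | forall A : set (p.-tuple R), measurable A ->
      pi (fst @^-1` A) = P A /\ pi (snd @^-1` A) = Q A].

Definition W1 (p : nat) (P Q : probability (p.-tuple R) R) : \bar R :=
  ereal_inf [set (\int[pi]_z (edist z.1 z.2)%:E)%E | pi in coupling P Q].

Definition sigmoid (u : R) : R := (1 + expR (- u))^-1.

(* node functions of layer k.+1 of networks in D(B, L) *)
Fixpoint nodes (p : nat) (B : R) (k : nat) : set (p.-tuple R -> R) :=
  match k with
  | 0 => [set f | exists (w : 'I_p -> R) (b : R),
            vnorm w <= B /\ f = (fun x => sigmoid (dotv w x + b))]
  | k'.+1 => [set f | exists (m : nat) (w : 'I_m -> R) (g : 'I_m -> p.-tuple R -> R),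
            (forall i, @nodes p B k' (g i)) /\ \sum_(i < m) `|w i| <= 1 /\
            f = (fun x => Num.max (\sum_(i < m) w i * g i x) 0)]
  end.

(* D(B, L): outputs are weighted sums (l1-norm <= 1) of layer-(L-1) nodes *)
Definition netD (p : nat) (B : R) (L : nat) : set (p.-tuple R -> R) :=
  [set f | exists (m : nat) (w : 'I_m -> R) (g : 'I_m -> p.-tuple R -> R),
     (forall i, @nodes p B (L - 2) (g i)) /\ \sum_(i < m) `|w i| <= 1 /\
     f = (fun x => \sum_(i < m) w i * g i x)].

Definition wgan_obj (p n : nat) (B : R) (L : nat)
    (G : 'M[R]_p -> probability (p.-tuple R) R)
    (Xs : 'I_n -> p.-tuple R) (S : 'M[R]_p) : \bar R :=
  ereal_sup [set (((n%:R)^-1 * \sum_(i < n) f (Xs i))%:E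
                  - \int[G S]_x (f x)%:E)%E | f in @netD p B L].

End Defs.

(* Main.v *)
Require Import Defs.
From HB Require Import structures.
From mathcomp Require Import all_boot all_order all_algebra.
From mathcomp Require Import all_classical all_reals all_analysis.
From mathcomp Require Import measurable_realfun ring lra.
Import Order.TTheory GRing.Theory Num.Theory.
Local Open Scope classical_set_scope.
Local Open Scope ring_scope.

(** Put [B = 1/M1] and let [Psi] be the supremum over the networks [f] of the
difference between the empirical mean of [f] and its mean under [N(0, Sstar)].
Minimality of [Shat] bounds [E f(N(0, Sstar)) - E f(N(0, Shat))] by [2 Psi] for
all networks.  Applied to the networks [sigma(<w, x> + 1)], [|w| = B], this
bounds [spec_norm (Shat - Sstar)]: both Gaussian means can be computed under the
law of larger variance along [w], after rescaling by [r <= 1], and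
[sigma(1 + y) + sigma(1 - y)] is decreasing in [|y|] with a quantitative gap.

Bounding [Psi] uses the bounded difference inequality under [P^n], transport
of [E Psi] from [P^n] to [N(0, Sstar)^n] through couplings ([Psi] is
[B/n]-Lipschitz in each observation, hence a term [B eps] without factor [2^L]),
symmetrization, and the contraction principle, which costs a factor 2 per ReLU
layer.  The sigmoid layer has Rademacher complexity of order [sqrt (n p)] with
no logarithm: for [|b| <= sqrt p] by contraction to linear functions, and on
the dyadic shells [b ~ 2^j sqrt p] by contraction with the local Lipschitz
constants [(16 + 4 B^2 |x|^2) / b^2], which makes the sum over [j] geometric.
It only needs sixth moments of the Gaussian. *)

Set Implicit Arguments. Unset Strict Implicit. Unset Printing Implicit Defensive.

(** * Sign averages and the contraction principle *)

(** The offset 1 in the test networks is essential: [sigmoid y + sigmoid (- y) = 1], so without it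
    the mean is 1/2 under every centred Gaussian law and carries no information on the covariance.
    The main obstacle is the unbounded bias. Comparison with linear functions costs a multiple of
    the largest parameter, so it needs biases in a bounded range, and the sum over infinitely many
    ranges must converge; hence Lipschitz constants that decrease faster than the ranges grow.
    Moments are taken under the Gaussian law because closeness in Wasserstein-1 distance controls
    only first moments of [P]. Under [P] itself only concentration is used, which rests on the
    boundedness of the networks. Suprema over the uncountable class of networks are measurable
    because they are Lipschitz in the observations. The good event is a condition on the sample
    alone; on it the bound follows deterministically from minimality. *)

Definition supo {R : realType} {I : Type} (F : set I) (Z : I -> R) : R :=
  sup [set Z i | i in F].

(** [sup] is 0 by convention on an empty or unbounded set; boundedness keeps [supo] from taking this
    default for lack of an upper bound. *)
Definition bdd {R : realType} {I : Type} (F : set I) (Z : I -> R) : Prop :=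
  exists M, forall i, F i -> `|Z i| <= M.

(** The mean over all sign vectors, one sign at a time, without a probability space of signs. The
    partial sum [A] is an argument so that inductions over [s] can vary it. *)
Fixpoint ravg {R : realType} {I T : Type} (a : T -> I -> R) (s : seq T)
    (A : I -> R) (H : (I -> R) -> R) : R :=
  if s is x :: s' then
    (ravg a s' (fun i => A i + a x i) H + ravg a s' (fun i => A i - a x i) H) / 2
  else H A.

Section Sup.
Context {R : realType} {I : Type}.
Implicit Types (F : set I) (Z : I -> R).

Lemma supo_ub F Z i : bdd F Z -> F i -> Z i <= supo F Z.
Proof.
move=> [M hM] Fi; apply: ub_le_sup; last by exists i.
by exists M => _ [j Fj <-]; exact: le_trans (ler_norm _) (hM _ Fj).
Qed.

Lemma supo_le F Z M : F !=set0 -> (forall i, F i -> Z i <= M) -> supo F Z <= M.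
Proof.
move=> [i Fi] h; apply: ge_sup; first by exists (Z i), i.
by move=> _ [j Fj <-]; exact: h.
Qed.

Lemma bddD F Z1 Z2 : bdd F Z1 -> bdd F Z2 -> bdd F (fun i => Z1 i + Z2 i).
Proof.
move=> [M1 h1] [M2 h2]; exists (M1 + M2) => i Fi.
by rewrite (le_trans (ler_normD _ _))// lerD ?h1 ?h2.
Qed.

Lemma bddN F Z : bdd F Z -> bdd F (fun i => - Z i).
Proof. by move=> [M h]; exists M => i Fi; rewrite normrN h. Qed.

Lemma bddB F Z1 Z2 : bdd F Z1 -> bdd F Z2 -> bdd F (fun i => Z1 i - Z2 i).
Proof. by move=> h1 h2; apply: bddD => //; exact: bddN. Qed.

Lemma bdd_norm F Z : bdd F Z -> bdd F (fun i => `|Z i|).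
Proof. by move=> [M h]; exists M => i Fi; rewrite normr_id h. Qed.

Lemma bdd0 F : bdd F (fun=> 0 : R).
Proof. by exists 0 => i _; rewrite normr0. Qed.

Lemma bddS F F' Z : F `<=` F' -> bdd F' Z -> bdd F Z.
Proof. by move=> FF' [M h]; exists M => i /FF'; exact: h. Qed.

End Sup.

Section SignAverage.
Context {R : realType}.

(** [C] is an invariant of the partial sums, so [H] and [H'] are compared only on processes that can
    occur. It is instantiated with boundedness or with linearity in the index. *)
Lemma ravg_le {I T : Type} (a : T -> I -> R) (C : (I -> R) -> Prop) s A H H' :
  (forall x A, C A -> C (fun i => A i + a x i) /\ C (fun i => A i - a x i)) ->
  C A -> (forall A, C A -> H A <= H' A) -> ravg a s A H <= ravg a s A H'.
Proof.
move=> hC + HH'; elim: s A => [|x s IH] A CA /=; first exact: HH'.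
have [CD CB] := hC x A CA.
by rewrite ler_pM2r ?invr_gt0// lerD ?IH.
Qed.

Lemma ravgD {I T : Type} (a : T -> I -> R) s A H H' :
  ravg a s A (fun Z => H Z + H' Z) = ravg a s A H + ravg a s A H'.
Proof. by elim: s A => [|x s IH] A //=; rewrite !IH; ring. Qed.

Lemma ravgZ {I T : Type} (a : T -> I -> R) s A H k :
  ravg a s A (fun Z => k * H Z) = k * ravg a s A H.
Proof. by elim: s A => [|x s IH] A //=; rewrite !IH; ring. Qed.

(** Reindexing: a linear map of processes passes from the functional to the increments, for instance
    from functions to their parameters. *)
Lemma ravg_lin {I J T : Type} (a : T -> I -> R) (L : (I -> R) -> J -> R) s A H :
  (forall Z Z', L (fun i => Z i + Z' i) = fun j => L Z j + L Z' j) ->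
  (forall Z Z', L (fun i => Z i - Z' i) = fun j => L Z j - L Z' j) ->
  ravg a s A (fun Z => H (L Z)) = ravg (fun x => L (a x)) s (L A) H.
Proof.
by move=> LD LB; elim: s A => [|x s IH] A //=; rewrite !IH LD LB.
Qed.


Section Contraction.
Context {I T : Type} (F : set I) (a c : T -> I -> R).
Hypothesis F0 : F !=set0.
Hypothesis ba : forall x, bdd F (a x).
Hypothesis bc : forall x, bdd F (c x).
Hypothesis ac : forall x i j, F i -> F j -> `|a x i - a x j| <= `|c x i - c x j|.

(** Only increments in the index are compared, so the contracted process need not vanish anywhere.
    The signs in [s] already carry [c]; one more of them merely shifts [A]. *)
Lemma contraction_step x s A : bdd F A ->
  ravg c s (fun i => A i + a x i) (supo F) + ravg c s (fun i => A i - a x i) (supo F)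
  <= ravg c s (fun i => A i + c x i) (supo F)
     + ravg c s (fun i => A i - c x i) (supo F).
Proof.
elim: s A => [|y s IH] A bA /=; last first.
  have := IH _ (bddD bA (bc y)); have := IH _ (bddB bA (bc y)).
  have e (u v w : I -> R) : (fun i => u i + v i - w i) = (fun i => u i - w i + v i).
    by apply/funext => i; rewrite addrAC.
  have e2 (u v w : I -> R) : (fun i => u i + v i + w i) = (fun i => u i + w i + v i).
    by apply/funext => i; rewrite addrAC.
  have e3 (u v w : I -> R) : (fun i => u i - v i - w i) = (fun i => u i - w i - v i).
    by apply/funext => i; rewrite addrAC.
  rewrite (e A (a x)) (e2 A (a x)) (e3 A (a x)) -(e A _ (a x)).
  rewrite (e A (c x)) (e2 A (c x)) (e3 A (c x)) -(e A _ (c x)).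
  lra.
suff h e : 0 < e -> supo F (fun i => A i + a x i) + supo F (fun i => A i - a x i)
    <= supo F (fun i => A i + c x i) + supo F (fun i => A i - c x i) + e + e.
  by apply/ler_addgt0Pr => e e0; have := h (e / 2) (divr_gt0 e0 (ltr0n _ 2)); lra.
move=> e0.
have ne (Z : I -> R) : [set Z i | i in F] !=set0 by case: F0 => i Fi; exists (Z i), i.
have hs (Z : I -> R) (bZ : bdd F Z) : has_sup [set Z i | i in F].
  case: bZ => M hM; split; first exact: ne.
  by exists M => _ [j Fj <-]; exact: le_trans (ler_norm _) (hM _ Fj).
(* The sum at the near-maximisers contains [a x i - a x j], at most the absolute value of
   [c x i - c x j]; on the right that value is reached at [i, j] or at [j, i], according to its
   sign. *)
have [_ [i Fi <-] hi] := sup_adherent e0 (hs _ (bddD bA (ba x))).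
have [_ [j Fj <-] hj] := sup_adherent e0 (hs _ (bddB bA (ba x))).
have bU := bddD bA (bc x); have bV := bddB bA (bc x).
have := supo_ub bU Fi; have := supo_ub bU Fj.
have := supo_ub bV Fi; have := supo_ub bV Fj.
have := ac x Fi Fj; have := ler_norm (a x i - a x j).
case: (ger0P (c x i - c x j)) => hc; rewrite /supo; lra.
Qed.

Lemma ravg_contraction s A : bdd F A -> ravg a s A (supo F) <= ravg c s A (supo F).
Proof.
elim: s A => [|x s IH] A bA //=; rewrite ler_pM2r ?invr_gt0//.
apply: le_trans (contraction_step _ _ bA).
by rewrite lerD ?IH//; [exact: bddD|exact: bddB].
Qed.

End Contraction.

End SignAverage.

(** * Absolutely convex hulls and ReLU layers *)

Section Layers.
Context {R : realType} {T : Type}.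
Implicit Types (N : set (T -> R)) (f g h : T -> R) (Lam : (T -> R) -> R).

Definition pt_eval (x : T) f : R := f x.

Definition hull N : set (T -> R) :=
  [set f | exists (m : nat) (w : 'I_m -> R) (g : 'I_m -> T -> R),
     (forall i, N (g i)) /\ \sum_(i < m) `|w i| <= 1 /\
     f = (fun x => \sum_(i < m) w i * g i x)].

Definition supabs {I : Type} (F : set I) (Z : I -> R) : R :=
  supo F (fun i => `|Z i|).

(** Abstracts signed sums of point evaluations: linear, and bounded on functions with values in
    [-1, 1]. It is the invariant for [ravg_le] when suprema over hulls are evaluated. *)
Definition admissible Lam : Prop :=
  (forall m (w : 'I_m -> R) (g : 'I_m -> T -> R),
     Lam (fun x => \sum_(i < m) w i * g i x) = \sum_(i < m) w i * Lam (g i)) /\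
  exists M, forall f, (forall x, `|f x| <= 1) -> `|Lam f| <= M.

Definition unit_bounded N := forall f, N f -> forall x, `|f x| <= 1.

Lemma supabs_ge0 {I : Type} (F : set I) (Z : I -> R) : bdd F Z -> 0 <= supabs F Z.
Proof.
move=> bZ; have [F0|/set0P[i Fi]] := eqVneq F set0.
  by rewrite /supabs /supo F0 image_set0 sup0.
exact: le_trans (normr_ge0 (Z i)) (supo_ub (bdd_norm bZ) Fi).
Qed.

Lemma admissible0 : admissible (fun=> 0).
Proof.
split; last by exists 0 => f _; rewrite normr0.
by move=> m w g; rewrite big1// => i _; rewrite mulr0.
Qed.

Lemma admissible_step x Lam : admissible Lam ->
  admissible (fun f => Lam f + pt_eval x f) /\ admissible (fun f => Lam f - pt_eval x f).
Proof.
move=> [lin [M hM]]; split; split=> [m w g|].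
- by rewrite lin -big_split/=; apply: eq_bigr => i _; rewrite mulrDr.
- exists (M + 1) => f hf; apply: le_trans (ler_normD _ _) _.
  by rewrite lerD ?hM ?hf.
- by rewrite lin -sumrB; apply: eq_bigr => i _; rewrite mulrBr.
- exists (M + 1) => f hf; apply: le_trans (ler_normB _ _) _.
  by rewrite lerD ?hM ?hf.
Qed.

Lemma admissible_bdd N Lam : unit_bounded N -> admissible Lam -> bdd N Lam.
Proof. by move=> uN [_ [M hM]]; exists M => f /uN; exact: hM. Qed.

Lemma hull_unit_bounded N : unit_bounded N -> unit_bounded (hull N).
Proof.
move=> uN _ [m [w [g [Ng [w1 ->]]]]] x; apply: le_trans w1.
apply: le_trans (ler_norm_sum _ _ _) _; apply: ler_sum => i _.
by rewrite normrM ler_piMr// uN.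
Qed.

Lemma hull0 N : hull N (fun=> 0).
Proof.
exists 0%N, (fun=> 0), (fun _ _ => 0); split; first by case.
by split; [rewrite big_ord0|apply/funext => x; rewrite big_ord0].
Qed.

Lemma admissible_at0 Lam : admissible Lam -> Lam (fun=> 0) = 0.
Proof.
move=> [lin _]; have := lin 0%N (fun=> 0) (fun _ _ => 0); by rewrite !big_ord0.
Qed.

Lemma hull_supabs N Lam h : unit_bounded N -> admissible Lam -> hull N h ->
  `|Lam h| <= supabs N Lam.
Proof.
move=> uN aL [m [w [g [Ng [w1 ->]]]]].
have bL := admissible_bdd uN aL.
rewrite aL.1; apply: le_trans (ler_norm_sum _ _ _) _.
apply: (@le_trans _ _ (\sum_(i < m) `|w i| * supabs N Lam)).
  apply: ler_sum => i _; rewrite normrM ler_wpM2l//.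
  exact: (supo_ub (bdd_norm bL) (Ng i)).
by rewrite -mulr_suml ler_piMl// supabs_ge0.
Qed.

Lemma max0_contract (u v : R) : `|Num.max u 0 - Num.max v 0| <= `|u - v|.
Proof.
by case: (lerP u 0) => hu; case: (lerP v 0) => hv; rewrite ?subr0 ?sub0r ?normr0//;
  rewrite ler_norml; have := ler_norm (u - v);
  have := ler_norm (v - u); rewrite distrC; move=> h1 h2; apply/andP; split; lra.
Qed.

(** The contraction principle concerns suprema without absolute values, so it is applied to the
    process and to its negative; hence the factor 2. *)
Lemma relu_layer N N' s : unit_bounded N ->
  N' = [set f | exists2 h, hull N h & f = fun x => Num.max (h x) 0] ->
  ravg pt_eval s (fun=> 0) (supabs N') <= 2 * ravg pt_eval s (fun=> 0) (supabs N).
Proof.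
move=> uN eN'; pose relu h : T -> R := fun x => Num.max (h x) 0.
have uH := hull_unit_bounded uN.
have relu0 : relu (fun=> 0) = fun=> 0 by apply/funext => x; rewrite /relu maxxx.
have urelu h : hull N h -> forall x, `|relu h x| <= 1.
  move=> /uH hh x; have := max0_contract (h x) 0; rewrite maxxx !subr0.
  by move=> /le_trans; apply.
have hne : hull N !=set0 by exists (fun=> 0); exact: hull0.
have side (e : R) : `|e| <= 1 ->
    ravg pt_eval s (fun=> 0) (fun Z => supo (hull N) (fun h => e * Z (relu h)))
    <= ravg pt_eval s (fun=> 0) (supabs N).
  move=> e1; rewrite (@ravg_lin _ _ _ _ _ (fun Z h => e * Z (relu h)))/=; last 2 first.
  - by move=> Z Z'; apply/funext => h; rewrite mulrDr.
  - by move=> Z Z'; apply/funext => h; rewrite mulrBr.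
  rewrite (_ : (fun _ => _ * 0) = fun=> 0); last by apply/funext => h; rewrite mulr0.
  apply: (@le_trans _ _ (ravg pt_eval s (fun=> 0) (supo (hull N)))).
    apply: ravg_contraction => //; last exact: bdd0.
    - move=> x; exists 1 => h Hh; rewrite normrM.
      by rewrite mulr_ile1// urelu.
    - by move=> x; exists 1 => h Hh; exact: uH.
    - move=> x h h' _ _; rewrite -mulrBr normrM.
      by apply: le_trans (max0_contract _ _); rewrite ler_piMl.
  apply: (ravg_le (C := admissible)) => //; [exact: admissible_step|exact: admissible0|].
  move=> Lam aL; apply: supo_le => // h Hh.
  exact: le_trans (ler_norm _) (hull_supabs uN aL Hh).
rewrite mulr_natl mulr2n.
have s1 := side 1; have sN := side (-1).
rewrite normrN normr1 in s1 sN.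
apply: le_trans (lerD (s1 (lexx _)) (sN (lexx _))); rewrite -ravgD.
apply: (ravg_le (C := admissible)) => //; [exact: admissible_step|exact: admissible0|].
move=> Lam aL.
have bR (e : R) : `|e| <= 1 -> bdd (hull N) (fun h => e * Lam (relu h)).
  move=> e1; have [M hM] := aL.2; exists M => h Hh; rewrite normrM.
  by apply: le_trans (hM _ (urelu _ Hh)); rewrite ler_piMl.
have b1 := bR 1; have bN := bR (-1); rewrite normrN normr1 in b1 bN.
(* The zero function is in the hull and fixed by the ReLU, so both one-sided suprema are nonnegative
   and their sum dominates the supremum of the absolute value. *)
have p1 := supo_ub (b1 (lexx _)) (hull0 N); have pN := supo_ub (bN (lexx _)) (hull0 N).
move: p1 pN; rewrite relu0 admissible_at0// !mulr0 => p1 pN.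
rewrite /supabs eN'; apply: supo_le.
  by exists (relu (fun=> 0)), (fun=> 0) => //; exact: hull0.
move=> _ [h Hh ->]; rewrite -/(relu h).
have := supo_ub (b1 (lexx _)) Hh; have := supo_ub (bN (lexx _)) Hh.
rewrite mul1r mulN1r ler_norml; move: p1 pN.
set u := supo _ _; set v := supo _ _; move=> *; apply/andP; split; lra.
Qed.

End Layers.

(** * Sigmoids *)

Lemma cauchy_schwarz {R : realType} {I : finType} (a b : I -> R) :
  (\sum_i a i * b i) ^+ 2 <= (\sum_i a i ^+ 2) * (\sum_i b i ^+ 2).
Proof.
have : 0 <= \sum_i \sum_j (a i * b j - a j * b i) ^+ 2.
  by apply: sumr_ge0 => i _; apply: sumr_ge0 => j _; exact: sqr_ge0.
have -> : \sum_i \sum_j (a i * b j - a j * b i) ^+ 2 =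
    \sum_i \sum_j (a i ^+ 2 * b j ^+ 2) + \sum_i \sum_j (b i ^+ 2 * a j ^+ 2)
    - 2 * \sum_i \sum_j (a i * b i) * (a j * b j).
  rewrite mulr_sumr -big_split/= -sumrB; apply: eq_bigr => i _.
  rewrite mulr_sumr -big_split/= -sumrB; apply: eq_bigr => j _; ring.
rewrite -!big_distrlr/=; set u := \sum_i _; set v := \sum_i _.
set w := \sum_i _; rewrite expr2; lra.
Qed.

Section Sigmoid.
Context {R : realType}.
Implicit Types u v t : R.

Lemma sigmoid_ge0 u : 0 <= sigmoid u.
Proof. by rewrite invr_ge0 addr_ge0 ?expR_ge0. Qed.

Lemma sigmoid_le1 u : sigmoid u <= 1.
Proof. by rewrite invf_le1 ?lerDl ?expR_ge0// ltr_pwDl ?expR_ge0. Qed.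

Lemma sigmoidN u : sigmoid (- u) = 1 - sigmoid u.
Proof.
rewrite /sigmoid opprK; have u0 := expR_gt0 u.
by rewrite expRN; field; rewrite !gt_eqF//; lra.
Qed.

(** An integrated form of [sigma' = sigma (1 - sigma) <= 1 - sigma], whose right side is decreasing
    and equals [sigmoid (- v)] at [v]. Only [1 + t <= expR t] is used. *)
Lemma sigmoid_diff u v : v <= u ->
  0 <= sigmoid u - sigmoid v <= (u - v) * sigmoid (- v).
Proof.
move=> vu; rewrite sigmoidN /sigmoid.
set a := expR (- u); set b := expR (- v).
have a0 : 0 < a := expR_gt0 _; have b0 : 0 < b := expR_gt0 _.
have ab : a <= b by rewrite ler_expR lerN2.
have bab : b - a <= (u - v) * b.
  have -> : a = b * expR (v - u) by rewrite -expRD; congr expR; ring.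
  have := expR_ge1Dx (v - u) => h.
  have : b * (1 + (v - u)) <= b * expR (v - u) by rewrite ler_pM2l.
  lra.
have -> : (1 + a)^-1 - (1 + b)^-1 = (b - a) / ((1 + a) * (1 + b)).
  by field; rewrite !gt_eqF//; lra.
have -> : 1 - (1 + b)^-1 = b / (1 + b) by field; rewrite gt_eqF//; lra.
apply/andP; split; first by rewrite divr_ge0 ?subr_ge0// mulr_ge0 ?addr_ge0// ltW.
rewrite mulrA ler_pdivrMr; last by rewrite mulr_gt0 ?addr_gt0.
rewrite [leRHS](_ : _ = ((u - v) * b) * (1 + a)); last by field; rewrite gt_eqF//; lra.
by apply: le_trans bab _; rewrite ler_peMr ?lerDl ?(ltW a0)// mulr_ge0 ?subr_ge0// ltW.
Qed.

Lemma sigmoid_lip u v : `|sigmoid u - sigmoid v| <= `|u - v|.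
Proof.
wlog vu : u v / v <= u.
  move=> h; have [vu|/ltW uv] := leP v u; first exact: h.
  by rewrite distrC (distrC u); exact: h.
have /andP[h0 h1] := sigmoid_diff vu.
rewrite !ger0_norm ?subr_ge0//; last by rewrite -subr_ge0.
by apply: le_trans h1 _; rewrite ler_piMr ?subr_ge0// sigmoid_le1.
Qed.

(** Where the sigmoid is small it is also flat: a bound on its values bounds its Lipschitz
    constant. *)
Lemma sigmoid_lip_local u v l : sigmoid (- u) <= l -> sigmoid (- v) <= l ->
  `|sigmoid (- u) - sigmoid (- v)| <= l * `|u - v|.
Proof.
wlog vu : u v / v <= u.
  move=> h hu hv; have [vu|/ltW uv] := leP v u; first exact: h.
  by rewrite distrC (distrC u); exact: h.
move=> hu hv; have /andP[h0 h1] := sigmoid_diff vu.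
have -> : sigmoid (- u) - sigmoid (- v) = - (sigmoid u - sigmoid v).
  by rewrite !sigmoidN; ring.
rewrite normrN ger0_norm// [`|u - v|]ger0_norm ?subr_ge0//.
by apply: le_trans h1 _; rewrite mulrC ler_wpM2r ?subr_ge0.
Qed.

Lemma sigmoid_decay t : 0 < t -> sigmoid (- t) <= 4 / t ^+ 2.
Proof.
move=> t0; have p1 : 0 < 1 + expR t by rewrite ltr_pwDl ?expR_ge0.
have p2 : 0 < t ^+ 2 / 4 by rewrite divr_gt0 ?exprn_gt0.
rewrite /sigmoid opprK -invf_div lef_pV2//.
have -> : expR t = expR (t / 2) ^+ 2 by rewrite expr2 -expRD; congr expR; field.
have h := expR_ge1Dx (t / 2).
have : (1 + t / 2) ^+ 2 <= expR (t / 2) ^+ 2 by rewrite lerXn2r ?nnegrE ?expR_ge0//; lra.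
by rewrite !expr2; nra.
Qed.

End Sigmoid.

(** * Sign averages of suprema of absolute values *)

Section RademacherTools.
Context {R : realType} {I T : Type}.
Implicit Types (a c : T -> I -> R) (S : set I).

Lemma bddT_step a : (forall x, bdd setT (a x)) -> forall x (A : I -> R),
  bdd setT A -> bdd setT (fun i => A i + a x i) /\ bdd setT (fun i => A i - a x i).
Proof. by move=> ba x A bA; split; [exact: bddD|exact: bddB]. Qed.

Lemma ravg_supabs_setU a s S S1 S2 : (forall x, bdd setT (a x)) ->
  S `<=` S1 `|` S2 ->
  ravg a s (fun=> 0) (supabs S)
  <= ravg a s (fun=> 0) (supabs S1) + ravg a s (fun=> 0) (supabs S2).
Proof.
move=> ba SS; rewrite -ravgD; apply: (ravg_le (C := bdd setT)).
- exact: bddT_step.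
- exact: bdd0.
move=> A bA; have b1 := bddS (@subsetT _ S1) bA; have b2 := bddS (@subsetT _ S2) bA.
have p1 := supabs_ge0 b1; have p2 := supabs_ge0 b2.
have [->|/set0P S0] := eqVneq S set0.
  by rewrite [leLHS]/supabs /supo image_set0 sup0 addr_ge0.
apply: supo_le => // i /SS[] Si.
- by apply: le_trans (supo_ub (bdd_norm b1) Si) _; rewrite lerDl.
- by apply: le_trans (supo_ub (bdd_norm b2) Si) _; rewrite lerDr.
Qed.

Lemma ravg_supabs_sub a s S S' : (forall x, bdd setT (a x)) -> S `<=` S' ->
  ravg a s (fun=> 0) (supabs S) <= ravg a s (fun=> 0) (supabs S').
Proof.
move=> ba SS; apply: (ravg_le (C := bdd setT)).
- exact: bddT_step.
- exact: bdd0.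
move=> A bA; have b' := bddS (@subsetT _ S') bA.
have [->|/set0P S0] := eqVneq S set0.
  by rewrite [leLHS]/supabs /supo image_set0 sup0 supabs_ge0.
by apply: supo_le => // i /SS Si; exact: (supo_ub (bdd_norm b') Si).
Qed.

(** Stands for the bound of E|Z| by the root of E Z^2. With a free [al] in place of the root the
    bound is affine in [A i ^+ 2], and the induction is the parallelogram identity. *)
Lemma ravg_abs a s A i al : 0 < al ->
  ravg a s A (fun Z => `|Z i|) <= ((A i ^+ 2 + \sum_(x <- s) a x i ^+ 2) / al + al) / 2.
Proof.
move=> al0; elim: s A => [|x s IH] A /=.
  rewrite big_nil addr0 ler_pdivlMr// -subr_ge0.
  have -> : A i ^+ 2 / al + al - `|A i| * 2 = (`|A i| - al) ^+ 2 / al.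
    by rewrite -(real_normK (num_real (A i))); field; rewrite gt_eqF.
  by rewrite divr_ge0 ?sqr_ge0// ltW.
rewrite ler_pM2r ?invr_gt0//; apply: le_trans (lerD (IH _) (IH _)) _.
rewrite big_cons le_eqVlt; apply/orP; left; apply/eqP; field.
by rewrite gt_eqF.
Qed.

Lemma ravg_supabs_le a s S A M (k : T -> R) :
  S !=set0 -> (forall x i, S i -> `|a x i| <= k x) -> (forall i, S i -> `|A i| <= M) ->
  ravg a s A (supabs S) <= M + \sum_(x <- s) k x.
Proof.
move=> S0 ak; elim: s A M => [|x s IH] A M hA /=.
  by rewrite big_nil addr0; exact: supo_le.
rewrite ler_pdivrMr// big_cons addrA mulr_natr mulr2n; apply: lerD; apply: IH => i Si.
- by apply: le_trans (ler_normD _ _) _; rewrite lerD ?hA ?ak.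
- by apply: le_trans (ler_normB _ _) _; rewrite lerD ?hA ?ak.
Qed.

(** [|Z i|] is at most [sup Z + sup (- Z) + |Z i0|], since each one-sided supremum is at least
    [- |Z i0|]. The anchor [i0] replaces the zero element that sigmoid classes lack. *)
Lemma ravg_supabs_contraction a c s S i0 : (forall x, bdd setT (a x)) ->
  (forall x, bdd S (c x)) -> S i0 ->
  (forall x i j, S i -> S j -> `|a x i - a x j| <= `|c x i - c x j|) ->
  ravg a s (fun=> 0) (supabs S)
  <= 2 * ravg c s (fun=> 0) (supo S) + ravg a s (fun=> 0) (fun Z => `|Z i0|).
Proof.
move=> ba bc Si0 ac; have S0 : S !=set0 by exists i0.
have baS x : bdd S (a x) := bddS (@subsetT _ S) (ba x).
have h1 := ravg_contraction S0 baS bc ac s (bdd0 S).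
have h2 : ravg a s (fun=> 0) (fun Z => supo S (fun i => - Z i))
    <= ravg c s (fun=> 0) (supo S).
  rewrite (@ravg_lin _ _ _ _ _ (fun Z i => - Z i))/=; last 2 first.
  - by move=> Z Z'; apply/funext => h; rewrite opprD.
  - by move=> Z Z'; apply/funext => h; rewrite opprD.
  rewrite (_ : (fun _ => - 0) = fun=> 0); last by apply/funext => h; rewrite oppr0.
  apply: ravg_contraction => //; last exact: bdd0.
  - by move=> x; exact: bddN.
  - by move=> x i j Si Sj; rewrite -opprD normrN; exact: ac.
rewrite mulr_natl mulr2n; apply: le_trans (lerD (lerD h1 h2) (lexx _)).
rewrite -!ravgD; apply: (ravg_le (C := bdd setT)).
- exact: bddT_step.
- exact: bdd0.
move=> A bA; have bS := bddS (@subsetT _ S) bA.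
apply: supo_le => // i Si.
have := supo_ub bS Si; have := supo_ub bS Si0.
have := supo_ub (bddN bS) Si; have := supo_ub (bddN bS) Si0.
have := ler_norm (A i0); have := ler_norm (- A i0); rewrite normrN.
set u := supo _ _; set v := supo _ _ => *.
by rewrite ler_norml; apply/andP; split; lra.
Qed.

End RademacherTools.

(** * Linear processes and the decay of sigmoids with large bias *)

Section SigmoidClass.
Context {R : realType} {p : nat}.
Variable B : R.
Hypothesis B0 : 0 < B.
Implicit Types (x : p.-tuple R) (th : ('I_p -> R) * R) (s : seq (p.-tuple R)).

Definition sqn x : R := \sum_(i < p) tnth x i ^+ 2.

Lemma sqn_ge0 x : 0 <= sqn x.
Proof. by apply: sumr_ge0 => i _; exact: sqr_ge0. Qed.

Definition ball_par (S : set (('I_p -> R) * R)) : Prop :=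
  forall th, S th -> \sum_i th.1 i ^+ 2 <= B ^+ 2.

(** The reversed sign makes the values small for large positive bias. *)
Definition negsig x th : R := sigmoid (- (dotv th.1 x + th.2)).

Lemma negsig_norm x th : `|negsig x th| <= 1.
Proof. by rewrite ger0_norm ?sigmoid_ge0// sigmoid_le1. Qed.

Lemma negsig_bdd x : bdd setT (negsig x).
Proof. by exists 1 => th _; exact: negsig_norm. Qed.

Lemma linear_amgm (w V : 'I_p -> R) al : 0 < al -> \sum_i w i ^+ 2 <= B ^+ 2 ->
  \sum_i w i * V i <= (B ^+ 2 * (\sum_i V i ^+ 2) / al + al) / 2.
Proof.
move=> al0 wB; have B20 : 0 < B ^+ 2 by rewrite exprn_gt0.
apply: (@le_trans _ _ (\sum_i (B ^+ 2 * V i ^+ 2 / al + al / B ^+ 2 * w i ^+ 2) / 2)).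
  apply: ler_sum => i _; rewrite -subr_ge0.
  have -> : (B ^+ 2 * V i ^+ 2 / al + al / B ^+ 2 * w i ^+ 2) / 2 - w i * V i
     = (B ^+ 2 * V i - al * w i) ^+ 2 / (2 * (al * B ^+ 2)).
    by field; rewrite !gt_eqF.
  by rewrite divr_ge0 ?sqr_ge0// mulr_ge0// mulr_ge0// ltW.
rewrite -mulr_suml ler_pM2r ?invr_gt0// big_split/= -!mulr_suml -!mulr_sumr lerD2l.
by rewrite -mulrA mulrC ler_piMl ?(ltW al0)// mulrC ler_pdivrMr// mul1r.
Qed.

(** [V] and [W] collect the signed sums of [l x] times [x] and of [l x]. The supremum is bounded by
    a quadratic expression in them, and averaging over a sign removes the cross terms. *)
Lemma ravg_linear (l : p.-tuple R -> R) s (V : 'I_p -> R) W b1 al S :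
  0 < al -> S !=set0 -> ball_par S -> (forall th, S th -> 0 <= th.2 <= b1) ->
  ravg (fun x th => l x * (dotv th.1 x + th.2)) s
    (fun th => \sum_i th.1 i * V i + th.2 * W) (supo S)
  <= ((B ^+ 2 * (\sum_i V i ^+ 2 + \sum_(x <- s) l x ^+ 2 * sqn x)
       + b1 ^+ 2 * (W ^+ 2 + \sum_(x <- s) l x ^+ 2)) / al + 2 * al) / 2.
Proof.
move=> al0 S0 hS hb; elim: s V W => [|x s IH] V W.
  rewrite /= !big_nil !addr0; apply: supo_le => // th Sth.
  have h1 := linear_amgm V al0 (hS _ Sth).
  have /andP[t0 t1] := hb _ Sth.
  have h2 : th.2 * W <= (b1 ^+ 2 * W ^+ 2 / al + al) / 2.
    apply: (@le_trans _ _ ((th.2 ^+ 2 * W ^+ 2 / al + al) / 2)).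
      rewrite -subr_ge0.
      have -> : (th.2 ^+ 2 * W ^+ 2 / al + al) / 2 - th.2 * W =
        (th.2 * W - al) ^+ 2 / (2 * al) by field; rewrite gt_eqF.
      by rewrite divr_ge0 ?sqr_ge0// mulr_ge0// ltW.
    rewrite ler_pM2r ?invr_gt0// lerD2r ler_pM2r ?invr_gt0//.
    by rewrite ler_wpM2r ?sqr_ge0// lerXn2r ?nnegrE//; exact: le_trans t0 t1.
  rewrite mulrDl; lra.
have eD : (fun th => \sum_i th.1 i * V i + th.2 * W + l x * (dotv th.1 x + th.2))
    = (fun th => \sum_i th.1 i * (V i + l x * tnth x i) + th.2 * (W + l x)).
  apply/funext => th.
  have -> : \sum_i th.1 i * (V i + l x * tnth x i)
      = \sum_i th.1 i * V i + l x * dotv th.1 x.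
    by rewrite /dotv mulr_sumr -big_split/=; apply: eq_bigr => i _; ring.
  ring.
have eB : (fun th => \sum_i th.1 i * V i + th.2 * W - l x * (dotv th.1 x + th.2))
    = (fun th => \sum_i th.1 i * (V i - l x * tnth x i) + th.2 * (W - l x)).
  apply/funext => th.
  have -> : \sum_i th.1 i * (V i - l x * tnth x i)
      = \sum_i th.1 i * V i - l x * dotv th.1 x.
    by rewrite /dotv mulr_sumr -sumrB; apply: eq_bigr => i _; ring.
  ring.
rewrite /= eD eB ler_pM2r ?invr_gt0//; apply: le_trans (lerD (IH _ _) (IH _ _)) _.
rewrite !big_cons.
have e : \sum_i (V i + l x * tnth x i) ^+ 2 + \sum_i (V i - l x * tnth x i) ^+ 2
   = 2 * \sum_i V i ^+ 2 + 2 * (l x ^+ 2 * sqn x).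
  by rewrite /sqn !mulr_sumr -!big_split/=; apply: eq_bigr => i _; ring.
set u := \sum_i _ in e *; set v := \sum_i (_ - _) ^+ 2 in e *.
have -> : v = 2 * (\sum_i V i ^+ 2) + 2 * (l x ^+ 2 * sqn x) - u by rewrite -e; ring.
rewrite le_eqVlt; apply/orP; left; apply/eqP; field; by rewrite gt_eqF.
Qed.

Definition decay_weight x : R := 16 + 4 * B ^+ 2 * sqn x.

(** Either [dotv th.1 x + th.2] is at least [b / 2] and the sigmoid decays, or [- dotv th.1 x] is at
    least [b / 2], so that [b ^+ 2] is at most [4 * B ^+ 2 * sqn x] and the bound 1 suffices. The
    cases give the two terms of [decay_weight]. *)
Lemma negsig_decay x th b : 0 < b -> b <= th.2 -> \sum_i th.1 i ^+ 2 <= B ^+ 2 ->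
  negsig x th <= decay_weight x / b ^+ 2.
Proof.
move=> b0 bth wB; have b20 : 0 < b ^+ 2 by rewrite exprn_gt0.
have s0 := sqn_ge0 x; have B20 : 0 <= B ^+ 2 := sqr_ge0 _.
have Bs0 : 0 <= B ^+ 2 * sqn x by rewrite mulr_ge0.
have [h|h] := leP (b / 2) (dotv th.1 x + th.2).
  have b2 : 0 < b / 2 by rewrite divr_gt0.
  apply: le_trans (sigmoid_decay (lt_le_trans b2 h)) _.
  apply: (@le_trans _ _ (4 / (b / 2) ^+ 2)).
    have t0 := lt_le_trans b2 h.
    by rewrite ler_pM2l// lef_pV2 ?posrE ?exprn_gt0// lerXn2r ?nnegrE// ltW.
  have -> : 4 / (b / 2) ^+ 2 = 16 / b ^+ 2 by field; rewrite gt_eqF.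
  by rewrite ler_pM2r ?invr_gt0// lerDl -mulrA mulr_ge0.
apply: le_trans (sigmoid_le1 _) _; rewrite ler_pdivlMr// mul1r.
have hd : b / 2 <= - dotv th.1 x by lra.
have : (b / 2) ^+ 2 <= (- dotv th.1 x) ^+ 2.
  by rewrite lerXn2r ?nnegrE//; [lra|apply: le_trans hd; lra].
rewrite sqrrN => h2; have := cauchy_schwarz th.1 (tnth x).
rewrite -/(dotv _ _) -/(sqn _) => h3.
have h4 : (\sum_i th.1 i ^+ 2) * sqn x <= B ^+ 2 * sqn x by rewrite ler_wpM2r.
rewrite /decay_weight; have -> : b ^+ 2 = 4 * (b / 2) ^+ 2 by field.
lra.
Qed.

Lemma negsig_local x th th' b : 0 < b -> b <= th.2 -> b <= th'.2 ->
  \sum_i th.1 i ^+ 2 <= B ^+ 2 -> \sum_i th'.1 i ^+ 2 <= B ^+ 2 ->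
  `|negsig x th - negsig x th'| <=
  decay_weight x / b ^+ 2 * `|(dotv th.1 x + th.2) - (dotv th'.1 x + th'.2)|.
Proof.
by move=> b0 h1 h2 h3 h4; apply: sigmoid_lip_local; exact: negsig_decay.
Qed.

End SigmoidClass.

(** * Rademacher complexity of the sigmoid layer *)

Section SigmoidRademacher.
Context {R : realType} {p : nat}.
Variables (B q : R).
Hypothesis B0 : 0 < B.
Hypothesis q1 : 1 <= q.
Implicit Types (x : p.-tuple R) (s : seq (p.-tuple R)).

Let q0 : 0 < q := lt_le_trans ltr01 q1.
Let q20 : 0 < q ^+ 2 := exprn_gt0 2 q0.

(** With [q] the square root of [p], a function of the mean square coordinate, so its Gaussian mean
    is bounded independently of [p]. The cube is forced by [decay_weight ^+ 2 * sqn], which is cubic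
    in [sqn]. *)
Definition moment_weight x : R := (1 + sqn x / q ^+ 2) ^+ 3.

Let H : R := 16 + 4 * B ^+ 2.

Let H0 : 0 < H.
Proof. by rewrite /H; have := sqr_ge0 B; lra. Qed.

Lemma sqn_le_weight x : sqn x <= q ^+ 2 * moment_weight x.
Proof.
rewrite mulrC -ler_pdivrMr// /moment_weight; set r := sqn x / q ^+ 2.
have r0 : 0 <= r by rewrite divr_ge0 ?sqn_ge0 ?ltW.
rewrite -subr_ge0 (_ : _ - r = 1 + 2 * r + 3 * (r * r) + r * (r * r)); last by ring.
have h2 := mulr_ge0 r0 r0; have h3 := mulr_ge0 r0 h2; lra.
Qed.

Lemma moment_weight_ge1 x : 1 <= moment_weight x.
Proof. by rewrite exprn_ege1// lerDl divr_ge0 ?sqn_ge0 ?ltW. Qed.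

Lemma decay_weight_le x :
  0 <= decay_weight B x <= H * q ^+ 2 * (1 + sqn x / q ^+ 2).
Proof.
have s0 := sqn_ge0 x; have B20 := sqr_ge0 B; rewrite /decay_weight.
apply/andP; split; first by rewrite addr_ge0// mulr_ge0// mulr_ge0.
have -> : H * q ^+ 2 * (1 + sqn x / q ^+ 2) = H * (q ^+ 2 + sqn x).
  by field; rewrite gt_eqF.
have q21 : 1 <= q ^+ 2 by rewrite exprn_ege1.
have h3 : 0 <= B ^+ 2 * q ^+ 2 by exact: mulr_ge0 B20 (ltW q20).
rewrite /H; nra.
Qed.

Lemma decay_weight_sqr x :
  decay_weight B x ^+ 2 <= H ^+ 2 * q ^+ 4 * moment_weight x.
Proof.
have /andP[h0 h1] := decay_weight_le x.
have r0 : 0 <= sqn x / q ^+ 2 by rewrite divr_ge0 ?sqn_ge0 ?ltW.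
apply: (@le_trans _ _ ((H * q ^+ 2 * (1 + sqn x / q ^+ 2)) ^+ 2)).
  by rewrite lerXn2r ?nnegrE// (le_trans h0).
rewrite (_ : _ ^+ 2 = H ^+ 2 * q ^+ 4 * (1 + sqn x / q ^+ 2) ^+ 2); last first.
  by set r := sqn x / _; ring.
rewrite ler_wpM2l ?mulr_ge0 ?exprn_ge0 ?(ltW H0) ?(ltW q0)//.
by rewrite /moment_weight [leRHS]exprSr ler_peMr ?sqr_ge0// lerDl.
Qed.

Lemma decay_weight_sqr_sqn x :
  decay_weight B x ^+ 2 * sqn x <= H ^+ 2 * q ^+ 6 * moment_weight x.
Proof.
have /andP[h0 h1] := decay_weight_le x.
have r0 : 0 <= sqn x / q ^+ 2 by rewrite divr_ge0 ?sqn_ge0 ?ltW.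
apply: (@le_trans _ _ ((H * q ^+ 2 * (1 + sqn x / q ^+ 2)) ^+ 2 * sqn x)).
  by rewrite ler_wpM2r ?sqn_ge0// lerXn2r ?nnegrE// (le_trans h0).
rewrite (_ : _ * sqn x = H ^+ 2 * q ^+ 6 * ((1 + sqn x / q ^+ 2) ^+ 2 * (sqn x / q ^+ 2))); last first.
  by field; rewrite gt_eqF.
rewrite ler_wpM2l ?mulr_ge0 ?exprn_ge0 ?(ltW H0) ?(ltW q0)//.
by rewrite /moment_weight [leRHS]exprSr ler_wpM2l ?sqr_ge0// lerDr.
Qed.

Variables (s : seq (p.-tuple R)) (N : R).
Hypothesis N1 : 1 <= N.
Hypothesis Ns : N ^+ 2 = (size s)%:R.

Let N0 : 0 < N := lt_le_trans ltr01 N1.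
Let G := \sum_(x <- s) moment_weight x.

Let G0 : 0 <= G.
Proof. by apply: sumr_ge0 => x _; exact: le_trans ler01 (moment_weight_ge1 x). Qed.

Let radN (S : set (('I_p -> R) * R)) := ravg (@negsig R p) s (fun=> 0) (supabs S).

(** [al] balances the linear part and [al'] the anchor [th0]; both are chosen separately for each
    range of biases. *)
Lemma radN_contraction S (l : p.-tuple R -> R) th0 b1 al al' k :
  0 < al -> 0 < al' -> ball_par B S -> (forall th, S th -> 0 <= th.2 <= b1) -> S th0 ->
  (forall x, 0 <= l x) ->
  (forall x th th', S th -> S th' -> `|negsig x th - negsig x th'| <=
     l x * `|(dotv th.1 x + th.2) - (dotv th'.1 x + th'.2)|) ->
  (forall x, negsig x th0 ^+ 2 <= k) ->
  radN S <= (B ^+ 2 * (\sum_(x <- s) l x ^+ 2 * sqn x)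
       + b1 ^+ 2 * (\sum_(x <- s) l x ^+ 2)) / al + 2 * al
       + (N ^+ 2 * k / al' + al') / 2.
Proof.
move=> al0 al'0 hS hb S0 l0 hl hk.
have Sne : S !=set0 by exists th0.
pose c x (th : ('I_p -> R) * R) := l x * (dotv th.1 x + th.2).
have bc x : bdd S (c x).
  exists (l x * (B ^+ 2 * sqn x + 1 + b1)) => th Sth.
  rewrite /c normrM ger0_norm// ler_wpM2l//; apply: le_trans (ler_normD _ _) _.
  have /andP[t0 t1] := hb _ Sth; rewrite lerD ?(ger0_norm t0)//.
  have := cauchy_schwarz th.1 (tnth x); rewrite -/(dotv _ _) -/(sqn _).
  rewrite -(real_normK (num_real (dotv _ _))).
  have : (\sum_i th.1 i ^+ 2) * sqn x <= B ^+ 2 * sqn x.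
    by rewrite ler_wpM2r ?sqn_ge0// hS.
  set z := `|_|; set u := _ * sqn x; set v := _ * sqn x => uv zu.
  have := sqr_ge0 (z - 1); rewrite !expr2 in zu *; nra.
apply: le_trans (ravg_supabs_contraction s (@negsig_bdd R p) bc S0 _) _.
  move=> x i j Si Sj; rewrite /c -mulrBr normrM (ger0_norm (l0 x)); exact: hl.
apply: lerD.
  have := ravg_linear B0 l s (fun=> 0) 0 al0 Sne hS hb.
  have -> : (fun th : ('I_p -> R) * R => \sum_i th.1 i * 0 + th.2 * 0) = fun=> 0.
    by apply/funext => th; rewrite mulr0 addr0 big1// => i _; rewrite mulr0.
  by rewrite expr0n/= big1 ?add0r// -/c => ?; lra.
apply: le_trans (ravg_abs _ _ _ _ al'0) _.
rewrite ler_pM2r ?invr_gt0// lerD2r ler_pM2r ?invr_gt0// expr0n/= add0r.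
apply: (@le_trans _ _ (\sum_(x <- s) k)); first by apply: ler_sum => x _; exact: hk.
by rewrite big_const_seq count_predT iter_addr_0 Ns mulr_natl.
Qed.

Definition shell (b0 b1 : R) : set (('I_p -> R) * R) :=
  [set th | \sum_i th.1 i ^+ 2 <= B ^+ 2 /\ b0 <= th.2 <= b1].

Lemma radN_head : radN (shell 0 q) <= q * ((B ^+ 2 + 1) * (G / N) + 4 * N).
Proof.
have h : radN (shell 0 q) <= _ := @radN_contraction (shell 0 q) (fun=> 1)
  ((fun=> 0), 0) q (q * N) N 1 (mulr_gt0 q0 N0) N0 _ _ _ _ _ _.
apply: le_trans (h _ _ _ _ _ _) _ => {h}.
- by move=> th [].
- by move=> th [].
- by split=> /=; [rewrite big1 ?sqr_ge0// => i _; rewrite expr0n|rewrite lexx ltW].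
- by [].
- move=> x th th' _ _; rewrite mul1r; apply: le_trans (sigmoid_lip _ _) _.
  by rewrite -opprD normrN.
- by move=> x; rewrite expr_le1 ?sigmoid_ge0// sigmoid_le1.
have e1 : \sum_(x <- s) 1 ^+ 2 * sqn x <= q ^+ 2 * G.
  rewrite /G mulr_sumr; apply: ler_sum => x _.
  by rewrite expr1n mul1r sqn_le_weight.
have e2 : \sum_(x <- s) (1 : R) ^+ 2 <= G.
  by apply: ler_sum => x _; rewrite expr1n moment_weight_ge1.
have B20 := sqr_ge0 B.
apply: (@le_trans _ _ ((B ^+ 2 * (q ^+ 2 * G) + q ^+ 2 * G) / (q * N) + 2 * (q * N) +
  (N ^+ 2 * 1 / N + N) / 2)).
  rewrite !lerD2r ler_pM2r ?invr_gt0 ?mulr_gt0// lerD ?ler_wpM2l// ltW//.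
have -> : (B ^+ 2 * (q ^+ 2 * G) + q ^+ 2 * G) / (q * N) = q * ((B ^+ 2 + 1) * (G / N)).
  by field; rewrite !gt_eqF.
have -> : (N ^+ 2 * 1 / N + N) / 2 = N by field; rewrite gt_eqF.
have : N <= q * N by rewrite ler_peMl// ltW.
have : 0 < q * N by rewrite mulr_gt0.
lra.
Qed.

Let K : R := (B ^+ 2 + 4) * H ^+ 2 + 11.

(** Lipschitz constants of order [q ^+ 2 / b ^+ 2] times parameters of order [b]: larger biases make
    cheaper shells. *)
Lemma radN_shell b : q <= b -> radN (shell b (2 * b)) <= q ^+ 2 / b * (K * (G / N + N)).
Proof.
move=> qb; have b0 : 0 < b := lt_le_trans q0 qb.
have b1 : 1 <= b := le_trans q1 qb.
have b20 : 0 < b ^+ 2 by rewrite exprn_gt0.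
have a0 : 0 < N * q ^+ 2 / b by rewrite divr_gt0 ?mulr_gt0.
have a'0 : 0 < N / b by rewrite divr_gt0.
(* The anchor has zero weights and bias [b], hence a value at most [4 / b ^+ 2]; its square
   [16 / b ^+ 4] is relaxed to [16 / b ^+ 2]. *)
have h := @radN_contraction (shell b (2 * b)) (fun x => decay_weight B x / b ^+ 2)
  ((fun=> 0), b) (2 * b) _ _ (16 / b ^+ 2) a0 a'0.
apply: le_trans (h _ _ _ _ _ _) _ => {h}.
- by move=> th [].
- by move=> th [_ /andP[h1 ->]]; rewrite andbT (le_trans (ltW b0)).
- split=> /=; first by rewrite big1 ?sqr_ge0// => i _; rewrite expr0n.
  by rewrite lexx; lra.
- by move=> x; have /andP[? _] := decay_weight_le x; rewrite divr_ge0// ltW.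
- move=> x th th' [h1 /andP[h2 _]] [h1' /andP[h2' _]].
  exact: negsig_local.
- move=> x; rewrite /negsig /= /dotv big1 ?add0r; last by move=> i _; rewrite mul0r.
  apply: (@le_trans _ _ ((4 / b ^+ 2) ^+ 2)).
    by rewrite lerXn2r ?nnegrE ?sigmoid_ge0 ?divr_ge0 ?(ltW b20)// sigmoid_decay.
  rewrite (_ : (4 / b ^+ 2) ^+ 2 = 16 / b ^+ 4); last by field; rewrite gt_eqF.
  by rewrite ler_pM2l// lef_pV2 ?posrE ?exprn_gt0// ler_weXn2l.
set S2 := \sum_(x <- s) _ * _; set S1 := \sum_(x <- s) _.
have e2 : S2 <= H ^+ 2 * q ^+ 6 * G / b ^+ 4.
  rewrite /S2 /G mulr_sumr mulr_suml; apply: ler_sum => x _.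
  rewrite expr_div_n -mulrAC -exprM ler_pM2r ?invr_gt0 ?exprn_gt0//.
  exact: decay_weight_sqr_sqn.
have e1 : S1 <= H ^+ 2 * q ^+ 4 * G / b ^+ 4.
  rewrite /S1 /G mulr_sumr mulr_suml; apply: ler_sum => x _.
  rewrite expr_div_n -exprM ler_pM2r ?invr_gt0 ?exprn_gt0//.
  exact: decay_weight_sqr.
have B20 := sqr_ge0 B.
apply: (@le_trans _ _ ((B ^+ 2 * (H ^+ 2 * q ^+ 6 * G / b ^+ 4)
    + (2 * b) ^+ 2 * (H ^+ 2 * q ^+ 4 * G / b ^+ 4)) / (N * q ^+ 2 / b)
    + 2 * (N * q ^+ 2 / b) + (N ^+ 2 * (16 / b ^+ 2) / (N / b) + N / b) / 2)).
  by rewrite !lerD2r ler_pM2r ?invr_gt0// lerD ?ler_wpM2l// sqr_ge0.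
have -> : (B ^+ 2 * (H ^+ 2 * q ^+ 6 * G / b ^+ 4)
    + (2 * b) ^+ 2 * (H ^+ 2 * q ^+ 4 * G / b ^+ 4)) / (N * q ^+ 2 / b)
  = q ^+ 2 / b * ((B ^+ 2 * (q ^+ 2 / b ^+ 2) + 4) * H ^+ 2 * (G / N)).
  by field; rewrite !gt_eqF.
have -> : (N ^+ 2 * (16 / b ^+ 2) / (N / b) + N / b) / 2 = N / b * (17 / 2).
  by field; rewrite !gt_eqF.
have q21 : 1 <= q ^+ 2 by rewrite exprn_ege1.
have f1 : N / b <= q ^+ 2 / b * N by rewrite mulrAC ler_pM2r ?invr_gt0// ler_peMl// ltW.
have f2 : q ^+ 2 / b * ((B ^+ 2 * (q ^+ 2 / b ^+ 2) + 4) * H ^+ 2 * (G / N)) <=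
   q ^+ 2 / b * ((B ^+ 2 + 4) * H ^+ 2 * (G / N)).
  rewrite ler_pM2l ?divr_gt0// ler_wpM2r ?divr_ge0 ?(ltW N0)// ler_wpM2r ?sqr_ge0//.
  rewrite lerD2r ler_piMr// ler_pdivrMr// mul1r lerXn2r ?nnegrE// ltW//.
rewrite (_ : N * q ^+ 2 / b = q ^+ 2 / b * N); last by ring.
have qbN : 0 < q ^+ 2 / b * N by rewrite mulr_gt0 ?divr_gt0.
have f3 : 0 <= q ^+ 2 / b * (G / N) by rewrite mulr_ge0 ?divr_ge0 ?(ltW q20) ?(ltW b0) ?(ltW N0).
have f4 : 0 <= (B ^+ 2 + 4) * H ^+ 2 by rewrite mulr_ge0 ?sqr_ge0//; lra.
rewrite /K.
have -> : q ^+ 2 / b * (((B ^+ 2 + 4) * H ^+ 2 + 11) * (G / N + N)) =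
  q ^+ 2 / b * ((B ^+ 2 + 4) * H ^+ 2 * (G / N)) + 11 * (q ^+ 2 / b * N)
  + ((B ^+ 2 + 4) * H ^+ 2) * (q ^+ 2 / b * N) + 11 * (q ^+ 2 / b * (G / N)) by ring.
have f5 := mulr_ge0 f4 (ltW qbN).
lra.
Qed.


Let X : R := G / N + N.

Let X0 : 0 <= X.
Proof. by rewrite addr_ge0 ?divr_ge0 ?(ltW N0). Qed.

Let K0 : 0 <= K.
Proof. by rewrite /K; have := sqr_ge0 B; have := sqr_ge0 H; nra. Qed.

(** Doubling [b] halves the cost of a shell, so 2 is the sum of the geometric series, whatever
    [J]. *)
Lemma radN_doubling J b : q <= b ->
  radN (shell b (2 ^+ J * b)) <= 2 * (q ^+ 2 / b * (K * X)).
Proof.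
have bd := @negsig_bdd R p.
elim: J b => [|J IH] b qb; have b0 : 0 < b := lt_le_trans q0 qb.
  apply: (@le_trans _ _ (radN (shell b (2 * b)))).
    apply: ravg_supabs_sub => // th [h1 /andP[h2 h3]]; split=> //; apply/andP; split=> //.
    by move: h3; rewrite expr0; lra.
  have := radN_shell qb; rewrite -/X.
  have : 0 <= q ^+ 2 / b * (K * X) by rewrite mulr_ge0 ?(mulr_ge0 K0 X0)// divr_ge0 ?ltW.
  lra.
apply: (@le_trans _ _ (radN (shell b (2 * b)) + radN (shell (2 * b) (2 ^+ J * (2 * b))))).
  apply: ravg_supabs_setU => // th [h1 /andP[h2 h3]].
  have [h4|h4] := leP th.2 (2 * b); [left|right]; split=> //; apply/andP; split=> //.
    exact: ltW.
  by rewrite mulrA -exprSr.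
have q2b : q <= 2 * b by lra.
apply: le_trans (lerD (radN_shell qb) (IH _ q2b)) _; rewrite -/X.
rewrite (_ : q ^+ 2 / (2 * b) = q ^+ 2 / b / 2); last by field; rewrite gt_eqF.
set u := q ^+ 2 / b; set v := K * X; lra.
Qed.

Definition half_par (b0 : R) : set (('I_p -> R) * R) :=
  [set th | \sum_i th.1 i ^+ 2 <= B ^+ 2 /\ b0 <= th.2].

(** Subadditivity joins only finitely many shells. Beyond this cutoff the values are so small that
    the triangle inequality, with no cancellation of signs, is enough: [N <= (2 ^+ size s) ^+ 2]. *)
Lemma radN_tail : radN (half_par (2 ^+ size s * q)) <= H * (G / N).
Proof.
set c := 2 ^+ size s * q; have c0 : 0 < c by rewrite mulr_gt0 ?exprn_gt0.
have := @ravg_supabs_le R _ _ (@negsig R p) s (half_par c) (fun=> 0) 0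
  (fun x => decay_weight B x / c ^+ 2).
move=> /(_ _ _ _) h; apply: le_trans (h _ _ _) _ => {h}.
- by exists (fun=> 0, c); split=> //=; rewrite big1 ?sqr_ge0// => i _; rewrite expr0n.
- move=> x th [h1 h2]; rewrite ger0_norm ?sigmoid_ge0//; exact: negsig_decay.
- by move=> th _; rewrite normr0.
rewrite add0r mulrA /G mulr_sumr mulr_suml; apply: ler_sum => x _.
have /andP[h0 h1] := decay_weight_le x.
have r0 : 0 <= sqn x / q ^+ 2 by rewrite divr_ge0 ?sqn_ge0 ?ltW.
rewrite ler_pdivrMr ?exprn_gt0//.
apply: le_trans h1 _.
have h2 : 1 + sqn x / q ^+ 2 <= moment_weight x.
  by rewrite /moment_weight ler_eXnr// lerDl.
apply: (@le_trans _ _ (H * q ^+ 2 * moment_weight x)).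
  by rewrite ler_wpM2l// mulr_ge0 ?ltW.
rewrite /c exprMn [leRHS](_ : _ = H * q ^+ 2 * moment_weight x * ((2 ^+ size s) ^+ 2 / N)); last first.
  by field; rewrite gt_eqF.
have w0 : 0 <= H * q ^+ 2 * moment_weight x.
  have m0 := le_trans ler01 (moment_weight_ge1 x).
  exact: (mulr_ge0 (mulr_ge0 (ltW H0) (ltW q20)) m0).
rewrite -[leLHS]mulr1; apply: ler_wpM2l => //.
rewrite ler_pdivlMr// mul1r.
apply: (@le_trans _ _ (N ^+ 2)); first by rewrite expr2 ler_peMr// ltW.
apply: (@le_trans _ _ (2 ^+ size s)).
  by rewrite Ns -natrX ler_nat ltnW// ltn_expl.
by rewrite expr2 ler_peMr ?exprn_ge0// exprn_ege1// ler1n.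
Qed.

Lemma radN_half : radN (half_par 0) <= q * (B ^+ 2 + 5 + 2 * K + H) * X.
Proof.
have bd := @negsig_bdd R p.
have h1 : radN (half_par 0) <= radN (shell 0 q) + radN (half_par q).
  apply: ravg_supabs_setU => // th [h1 h2].
  have [h3|h3] := leP th.2 q; [left|right]; split=> //; last exact: ltW.
  by rewrite h2.
have h2 : radN (half_par q) <= radN (shell q (2 ^+ size s * q)) +
    radN (half_par (2 ^+ size s * q)).
  apply: ravg_supabs_setU => // th [h2 h3].
  have [h4|h4] := leP th.2 (2 ^+ size s * q); [left|right]; split=> //; last exact: ltW.
  by rewrite h3.
have := radN_tail; have := radN_head; have := radN_doubling (size s) (lexx q).
rewrite (_ : q ^+ 2 / q = q); last by field; rewrite gt_eqF.
move=> h3 h4 h5.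
have g0 : 0 <= G / N by rewrite divr_ge0 // ltW.
have gX : G / N <= X by rewrite lerDl ltW.
have NX : N <= X by rewrite lerDr.
have f1 : q * ((B ^+ 2 + 1) * (G / N) + 4 * N) <= q * ((B ^+ 2 + 1) * X + 4 * X).
  have B20 : 0 <= B ^+ 2 + 1 by have := sqr_ge0 B; lra.
  by rewrite ler_pM2l//; apply: lerD; [exact: ler_wpM2l|lra].
have f2 : H * (G / N) <= H * (q * X).
  by rewrite ler_pM2l//; apply: le_trans gX _; rewrite ler_peMl.
have -> : q * (B ^+ 2 + 5 + 2 * K + H) * X =
  q * ((B ^+ 2 + 1) * X + 4 * X) + 2 * (q * (K * X)) + H * (q * X) by ring.
lra.
Qed.

(** A nonnegative bias is treated as [1 - negsig], whose constant part costs [N]; a negative one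
    becomes [negsig] after negating weights and bias. *)
Lemma ravg_nodes0 : ravg pt_eval s (fun=> 0) (supabs (@nodes R p B 0))
  <= q * (B ^+ 2 + 6 + 2 * K + H) * X.
Proof.
have P0ne : half_par 0 !=set0.
  by exists (fun=> 0, 0); split=> //=; rewrite big1 ?sqr_ge0// => i _; rewrite expr0n.
have hone : ravg pt_eval s (fun=> 0) (fun Z : (p.-tuple R -> R) -> R => `|Z (fun=> 1)|) <= N.
  apply: le_trans (ravg_abs _ _ _ _ N0) _; rewrite /pt_eval expr0n/= add0r.
  rewrite (eq_bigr (fun=> 1)); last by move=> x _; rewrite expr1n.
  rewrite big_const_seq count_predT iter_addr_0 -Ns expr2 mulfK ?gt_eqF//; lra.
have hpar : ravg pt_eval s (fun=> 0) (fun Z : (p.-tuple R -> R) -> R =>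
    supabs (half_par 0) (fun th => Z (fun x => negsig x th))) = radN (half_par 0).
  exact: (@ravg_lin _ _ _ _ _ (fun Z th => Z (fun x => negsig x th))).
have hle : N <= q * X.
  by apply: (@le_trans _ _ X); [rewrite lerDr divr_ge0// ltW|rewrite ler_peMl].
have -> : q * (B ^+ 2 + 6 + 2 * K + H) * X =
  q * X + q * (B ^+ 2 + 5 + 2 * K + H) * X by ring.
apply: le_trans (lerD hle radN_half); rewrite -hpar.
apply: le_trans (lerD hone (lexx _)); rewrite -ravgD.
apply: (ravg_le (C := admissible)); [exact: admissible_step|exact: admissible0|].
move=> Lam aL.
have bP : bdd (half_par 0) (fun th => Lam (fun x => negsig x th)).
  by have [M hM] := aL.2; exists M => th _; apply: hM => x; exact: negsig_norm.
apply: supo_le.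
  exists (fun x => sigmoid (dotv (fun=> 0) x + 0)), (fun=> 0), 0; split=> //.
  by rewrite /vnorm big1 ?sqrtr0 ?ltW// => i _; rewrite expr0n.
move=> _ [w [b [wB ->]]].
have wB2 : \sum_i w i ^+ 2 <= B ^+ 2.
  rewrite -[leLHS]sqr_sqrtr ?sumr_ge0//; last by move=> i _; exact: sqr_ge0.
  by rewrite lerXn2r ?nnegrE ?sqrtr_ge0// ltW.
have [b0|b0] := leP 0 b.
  have -> : Lam (fun x => sigmoid (dotv w x + b)) =
      Lam (fun=> 1) - Lam (fun x => negsig x (w, b)).
    have := aL.1 2%N (fun i => if i == ord0 then 1 else -1)
       (fun i => if i == ord0 then fun=> 1 else fun x => negsig x (w, b)).
    rewrite !big_ord_recl big_ord0/= mul1r mulN1r addr0 => <-; congr Lam.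
    apply/funext => x; rewrite !big_ord_recl big_ord0/= /negsig/= sigmoidN; ring.
  apply: le_trans (ler_normB _ _) _; rewrite lerD2l.
  exact: (supo_ub (bdd_norm bP) (i := (w, b))).
have -> : (fun x => sigmoid (dotv w x + b)) = fun x => negsig x (fun i => - w i, - b).
  apply/funext => x; rewrite /negsig /dotv /=; congr sigmoid.
  by rewrite opprD opprK -sumrN; congr (_ + _); apply: eq_bigr => i _; rewrite mulNr opprK.
apply: (@le_trans _ _ (supabs (half_par 0) (fun th => Lam (fun x => negsig x th)))).
  apply: (supo_ub (bdd_norm bP) (i := (fun i => - w i, - b))); split=> /=.
    by rewrite (eq_bigr (fun i => w i ^+ 2))// => i _; rewrite sqrrN.
  by rewrite oppr_ge0 ltW.
by rewrite lerDr.
Qed.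

Lemma nodes_unit_bounded k : unit_bounded (@nodes R p B k).
Proof.
elim: k => [|k IH] f /=.
  by move=> [w [b [_ ->]]] x; rewrite ger0_norm ?sigmoid_ge0// sigmoid_le1.
move=> [m [w [g [Ng [w1 ->]]]]] x.
have hx := hull_unit_bounded IH (ex_intro _ m (ex_intro _ w (ex_intro _ g
   (conj Ng (conj w1 erefl))))) x.
have := max0_contract (\sum_(i < m) w i * g i x) 0; rewrite maxxx !subr0.
by move=> /le_trans; apply.
Qed.

Lemma ravg_nodes k : ravg pt_eval s (fun=> 0) (supabs (@nodes R p B k))
  <= 2 ^+ k * (q * (B ^+ 2 + 6 + 2 * K + H) * X).
Proof.
elim: k => [|k IH]; first by rewrite mul1r; exact: ravg_nodes0.
have := @relu_layer R _ (@nodes R p B k) (@nodes R p B k.+1) s (@nodes_unit_bounded k).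
move=> /(_ _) h; apply: le_trans (h _) _.
  apply/seteqP; split=> f.
    by move=> [m [w [g [Ng [w1 ->]]]]]; exists (fun x => \sum_(i < m) w i * g i x) => //;
       exists m, w, g.
  by move=> [_ [m [w [g [Ng [w1 ->]]]]] ->]; exists m, w, g.
by rewrite exprS -mulrA ler_pM2l.
Qed.

Definition rad_const : R := B ^+ 2 + 6 + 2 * ((B ^+ 2 + 4) * H ^+ 2 + 11) + H.

(** The nodes feeding the output have passed [L - 2] ReLU layers; the remaining factor 2 is that of
    symmetrization. *)
Lemma ravg_netD L : (2 <= L)%N ->
  ravg (fun x f => 2 * pt_eval x f) s (fun=> 0) (supo (@netD R p B L))
  <= 2 ^+ L.-1 * (q * rad_const * X).
Proof.
move=> L2; have -> : L.-1 = (L - 2).+1 by case: L L2 => [|[|L]]//= _; rewrite subn2.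
rewrite exprS -mulrA.
have -> : ravg (fun x f => 2 * pt_eval x f) s (fun=> 0) (supo (@netD R p B L)) =
  ravg pt_eval s (fun=> 0) (fun Z => supo (@netD R p B L) (fun f => 2 * Z f)).
  rewrite (@ravg_lin _ _ _ _ _ (fun Z f => 2 * Z f))/=; last 2 first.
  - by move=> Z Z'; apply/funext => h; rewrite mulrDr.
  - by move=> Z Z'; apply/funext => h; rewrite mulrBr.
  by congr ravg; apply/funext => f; rewrite mulr0.
apply: (@le_trans _ _ (2 * ravg pt_eval s (fun=> 0) (supabs (@nodes R p B (L - 2))))); last first.
  by rewrite ler_pM2l//; exact: ravg_nodes.
rewrite -ravgZ; apply: (ravg_le (C := admissible)); [exact: admissible_step|exact: admissible0|].
move=> Lam aL; apply: supo_le; first by exists (fun=> 0); exact: hull0.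
move=> f Df; rewrite ler_pM2l//; apply: le_trans (ler_norm _) _.
exact: (hull_supabs (@nodes_unit_bounded (L - 2)) aL Df).
Qed.

End SigmoidRademacher.

(** * Integration of bounded functions and product measures *)

Section BoundedIntegration.
Context {R : realType}.

(** On this class the real-valued [Ex] is linear and monotone under any probability, without
    integrability conditions. *)
Definition bmeas {d} {X : measurableType d} (f : X -> R) : Prop :=
  measurable_fun setT f /\ bdd setT f.

Definition Ex {d} {X : measurableType d} (mu : probability X R) (f : X -> R) : R :=
  Rintegral mu setT f.

Section OneSpace.
Context {d} {X : measurableType d}.
Variable mu : probability X R.
Implicit Types f g : X -> R.

Lemma bmeas_integrable f : bmeas f -> mu.-integrable setT (EFin \o f).
Proof.
move=> [mf [M hM]]; apply: measurable_bounded_integrable => //.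
  by apply: le_lt_trans (probability_le1 mu measurableT) _; rewrite ltry.
exists M; split; first exact: num_real.
by move=> N MN x _; apply: le_trans (ltW MN); exact: hM.
Qed.

Lemma bmeas_cst k : bmeas (fun _ : X => k).
Proof. by split; [exact: measurable_cst|exists `|k|]. Qed.

Lemma bmeasD f g : bmeas f -> bmeas g -> bmeas (fun x => f x + g x).
Proof. by move=> [mf bf] [mg bg]; split; [exact: measurable_realfun.measurable_funD|exact: bddD]. Qed.

Lemma bmeasN f : bmeas f -> bmeas (fun x => - f x).
Proof. by move=> [mf bf]; split; [exact: measurableT_comp|exact: bddN]. Qed.

Lemma bmeasB f g : bmeas f -> bmeas g -> bmeas (fun x => f x - g x).
Proof. by move=> bf bg; apply: bmeasD => //; exact: bmeasN. Qed.

Lemma bmeasZ k f : bmeas f -> bmeas (fun x => k * f x).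
Proof.
move=> [mf [M hM]]; split; first exact: measurable_funM.
by exists (`|k| * M) => x _; rewrite normrM ler_wpM2l// hM.
Qed.

Lemma bmeas_expR f : bmeas f -> bmeas (fun x => expR (f x)).
Proof.
move=> [mf [M hM]]; split; first exact: measurableT_comp.
exists (expR M) => x _; rewrite ger0_norm ?expR_ge0// ler_expR.
exact: le_trans (ler_norm _) (hM _ _).
Qed.

Lemma ExD f g : bmeas f -> bmeas g -> Ex mu (fun x => f x + g x) = Ex mu f + Ex mu g.
Proof. by move=> bf bg; apply: RintegralD => //; exact: bmeas_integrable. Qed.

Lemma ExB f g : bmeas f -> bmeas g -> Ex mu (fun x => f x - g x) = Ex mu f - Ex mu g.
Proof. by move=> bf bg; apply: RintegralB => //; exact: bmeas_integrable. Qed.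

Lemma ExZ k f : bmeas f -> Ex mu (fun x => k * f x) = k * Ex mu f.
Proof. by move=> bf; apply: RintegralZl => //; exact: bmeas_integrable. Qed.

Lemma Ex_cst k : Ex mu (fun=> k) = k.
Proof.
transitivity (k * fine (mu setT)); first exact: Rintegral_cst.
by rewrite probability_setT mulr1.
Qed.

Lemma Ex_le f g : bmeas f -> bmeas g -> (forall x, f x <= g x) -> Ex mu f <= Ex mu g.
Proof. by move=> bf bg fg; apply: le_Rintegral => //; exact: bmeas_integrable. Qed.

Lemma Ex_EFin f : bmeas f -> (Ex mu f)%:E = (\int[mu]_x (f x)%:E)%E.
Proof.
move=> bf; rewrite /Ex /Rintegral fineK//.
by apply: integrable_fin_num => //; exact: bmeas_integrable.
Qed.

Lemma Ex_norm_le f M : bmeas f -> (forall x, `|f x| <= M) -> `|Ex mu f| <= M.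
Proof.
move=> bf fM; rewrite ler_norml -[- M]Ex_cst -{2}[M]Ex_cst.
by apply/andP; split; apply: Ex_le => //; try exact: bmeas_cst;
   move=> x; have := fM x; rewrite ler_norml => /andP[].
Qed.

Lemma bmeas_comp {d'} {Y : measurableType d'} (h : Y -> X) f :
  measurable_fun setT h -> bmeas f -> bmeas (fun y => f (h y)).
Proof.
move=> mh [mf [M hM]]; split; first exact: measurableT_comp.
by exists M => y _; exact: hM.
Qed.

End OneSpace.

Section Image.
Context {d d'} {X : measurableType d} {Y : measurableType d'}.

Definition image_prob (mu : probability X R) (h : X -> Y)
    (mh : measurable_fun setT h) : probability Y R :=
  distribution mu (HB.pack_for {mfun X >-> Y} h (isMeasurableFun.Build _ _ _ _ _ mh)).

Lemma Ex_image mu h (mh : measurable_fun setT h) f : bmeas f ->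
  Ex (image_prob mu mh) f = Ex mu (fun x => f (h x)).
Proof.
move=> bf; rewrite /Ex /Rintegral; congr fine.
rewrite integral_distribution//; first by apply/measurable_EFinP; case: bf.
apply: (bmeas_integrable mu (f := f \o h)); exact: bmeas_comp.
Qed.

Variables (mu : probability X R) (nu : probability Y R).

Lemma bmeas_Ex_r (F : X * Y -> R) : bmeas F -> bmeas (fun x => Ex nu (fun y => F (x, y))).
Proof.
move=> bF; split; last first.
  have [_ [M hM]] := bF; exists M => x _.
  apply: Ex_norm_le => [|y]; last exact: hM.
  by apply: bmeas_comp bF; exact: measurable_pair1.
have iF : (mu \x nu)%E.-integrable setT (EFin \o F) by exact: bmeas_integrable.
have := measurable_fubini_F iF; rewrite /fubini_F /= => mF.
exact: (measurableT_comp (fine_measurable measurableT) mF).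
Qed.

Lemma bmeas_Ex_l (F : X * Y -> R) : bmeas F -> bmeas (fun y => Ex mu (fun x => F (x, y))).
Proof.
move=> bF; split; last first.
  have [_ [M hM]] := bF; exists M => y _.
  apply: Ex_norm_le => [|x]; last exact: hM.
  by apply: bmeas_comp bF; exact: measurable_pair2.
have iF : (mu \x nu)%E.-integrable setT (EFin \o F) by exact: bmeas_integrable.
have := measurable_fubini_G iF; rewrite /fubini_G /= => mF.
exact: (measurableT_comp (fine_measurable measurableT) mF).
Qed.

Lemma Ex_prod (F : X * Y -> R) : bmeas F ->
  Ex (mu \x nu)%E F = Ex mu (fun x => Ex nu (fun y => F (x, y))).
Proof.
move=> bF; have iF : (mu \x nu)%E.-integrable setT (EFin \o F) by exact: bmeas_integrable.
rewrite /Ex /Rintegral; congr fine; rewrite -(integral12_prod_meas1 iF).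
apply: eq_integral => x _; apply/esym.
by apply: (Ex_EFin nu); apply: bmeas_comp bF; exact: measurable_pair1.
Qed.

Lemma Ex_prod_swap (F : X * Y -> R) : bmeas F ->
  Ex mu (fun x => Ex nu (fun y => F (x, y))) = Ex nu (fun y => Ex mu (fun x => F (x, y))).
Proof.
move=> bF; rewrite -Ex_prod//.
have iF : (mu \x nu)%E.-integrable setT (EFin \o F) by exact: bmeas_integrable.
rewrite /Ex /Rintegral; congr fine; rewrite -(integral21_prod_meas1 iF).
apply: eq_integral => x _; apply/esym.
by apply: (Ex_EFin mu); apply: bmeas_comp bF; exact: measurable_pair2.
Qed.

End Image.

End BoundedIntegration.

Section ProductProbability.
Context {R : realType} {d} {T : measurableType d}.

Lemma measurable_cons_pair n :
  measurable_fun setT (fun z : T * n.-tuple T => [tuple of z.1 :: z.2]).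
Proof. by apply: measurable_cons => //. Qed.

(** Prepending one coordinate at a time turns arguments on samples into inductions that condition on
    the first observation. *)
Fixpoint power_prob (P : probability T R) (n : nat) : probability (n.-tuple T) R :=
  match n with
  | 0 => dirac [tuple]
  | n'.+1 => image_prob (P \x power_prob P n')%E (@measurable_cons_pair n')
  end.

Variable P : probability T R.

Lemma bmeas_cons n (F : n.+1.-tuple T -> R) : bmeas F ->
  bmeas (fun z : T * n.-tuple T => F [tuple of z.1 :: z.2]).
Proof. by apply: bmeas_comp; exact: measurable_cons_pair. Qed.

Lemma Ex_power_prob0 (F : 0.-tuple T -> R) : Ex (power_prob P 0) F = F [tuple].
Proof.
have -> : F = fun=> F [tuple] by apply/funext => x; rewrite tuple0.
exact: Ex_cst.
Qed.

Lemma Ex_power_probS n (F : n.+1.-tuple T -> R) : bmeas F ->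
  Ex (power_prob P n.+1) F =
  Ex P (fun x => Ex (power_prob P n) (fun s => F [tuple of x :: s])).
Proof.
by move=> bF; rewrite /= Ex_image// Ex_prod//; exact: bmeas_cons.
Qed.

Lemma Ex_power_probS_swap n (F : n.+1.-tuple T -> R) : bmeas F ->
  Ex (power_prob P n.+1) F =
  Ex (power_prob P n) (fun s => Ex P (fun x => F [tuple of x :: s])).
Proof.
move=> bF; rewrite Ex_power_probS//.
exact: (Ex_prod_swap P (power_prob P n) (bmeas_cons bF)).
Qed.

End ProductProbability.

(** * Concentration *)

Section Concentration.
Context {R : realType} {d} {T : measurableType d}.

(** As [expR (- y)] is at least [(1 - y / 2) ^+ 2], it suffices that this square times the right
    side is at least 1; the term [1 - 3 * y] in the expansion is the origin of 1/3. *)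
Lemma expR_le_quadratic (y : R) : y <= 1 / 3 -> expR y <= 1 + y + y ^+ 2.
Proof.
move=> y3; have h := expR_ge1Dx (- y / 2).
have h1 : 0 < 1 - y / 2 by lra.
have h2 : (1 - y / 2) ^+ 2 <= expR (- y).
  have -> : expR (- y) = expR (- y / 2) ^+ 2 by rewrite expr2 -expRD; congr expR; field.
  by rewrite lerXn2r ?nnegrE ?expR_ge0 ?(ltW h1)//; lra.
have h3 : 0 < 1 + y + y ^+ 2.
  have -> : 1 + y + y ^+ 2 = (y + 1 / 2) ^+ 2 + 3 / 4 by field.
  by have := sqr_ge0 (y + 1 / 2); lra.
rewrite -[y in expR y]opprK expRN invf_ple ?posrE ?expR_gt0//.
apply: le_trans h2; rewrite -div1r ler_pdivrMr//.
have -> : (1 - y / 2) ^+ 2 * (1 + y + y ^+ 2) = 1 + y ^+ 2 / 4 * (1 - 3 * y + y ^+ 2) by field.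
by rewrite lerDl mulr_ge0 ?divr_ge0 ?sqr_ge0//; have := sqr_ge0 y; lra.
Qed.

(** Hoeffding's lemma with a cruder constant: [g] stays within [dl] of its mean, the linear term
    averages to 0, and the quadratic one gives [(lam * dl) ^+ 2]. *)
Lemma mgf_bounded_osc (P : probability T R) (g : T -> R) (dl lam : R) :
  bmeas g -> 0 <= lam -> lam * dl <= 1 / 3 -> (forall x y, g x - g y <= dl) ->
  Ex P (fun x => expR (lam * g x)) <= expR (lam * Ex P g + (lam * dl) ^+ 2).
Proof.
move=> bg lam0 ld gd; set m := Ex P g.
have hub x : g x - m <= dl.
  rewrite -(Ex_cst P dl) -(Ex_cst P (g x)) -ExB//; last exact: bmeas_cst.
  by apply: Ex_le => [||y]; [apply: bmeasB => //; exact: bmeas_cst|exact: bmeas_cst|exact: gd].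
have hlb x : - dl <= g x - m.
  rewrite -opprB lerN2 -(Ex_cst P dl) -(Ex_cst P (g x)) -ExB//; last exact: bmeas_cst.
  by apply: Ex_le => [||y]; [apply: bmeasB => //; exact: bmeas_cst|exact: bmeas_cst|exact: gd].
set Y := fun x => lam * (g x - m).
have bY : bmeas Y by apply: bmeasZ; apply: bmeasB => //; exact: bmeas_cst.
have EY : Ex P Y = 0.
  by rewrite ExZ ?ExB ?Ex_cst ?subrr ?mulr0//; [exact: bmeas_cst|apply: bmeasB => //; exact: bmeas_cst].
have hY x : expR (Y x) <= 1 + (lam * dl) ^+ 2 + Y x.
  have y1 : Y x <= lam * dl by rewrite ler_wpM2l.
  have y2 : - (lam * dl) <= Y x by rewrite -mulrN ler_wpM2l.
  apply: le_trans (expR_le_quadratic (le_trans y1 ld)) _.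
  rewrite addrAC lerD2r lerD2l -(real_normK (num_real (Y x))).
  rewrite lerXn2r ?nnegrE//; first by lra.
  by rewrite ler_norml y1 y2.
have -> : (fun x => expR (lam * g x)) = (fun x => expR (lam * m) * expR (Y x)).
  by apply/funext => x; rewrite -expRD; congr expR; rewrite /Y; ring.
rewrite ExZ; last exact: bmeas_expR.
rewrite expRD ler_pM2l ?expR_gt0//.
apply: (@le_trans _ _ (Ex P (fun x => 1 + (lam * dl) ^+ 2 + Y x))).
  by apply: Ex_le hY; [exact: bmeas_expR|apply: bmeasD => //; exact: bmeas_cst].
rewrite ExD//; last exact: bmeas_cst.
by rewrite Ex_cst EY addr0 expR_ge1Dx.
Qed.

(** The induction hypothesis applies given the first coordinate, and the conditional mean [g] again
    has oscillation at most [dl]. *)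
Lemma mgf_bounded_differences (P : probability T R) n (Phi : n.-tuple T -> R) (dl lam : R) :
  bmeas Phi -> 0 <= lam -> lam * dl <= 1 / 3 ->
  (forall t t' i, (forall j, j != i -> tnth t j = tnth t' j) -> Phi t - Phi t' <= dl) ->
  Ex (power_prob P n) (fun t => expR (lam * Phi t))
  <= expR (lam * Ex (power_prob P n) Phi + n%:R * (lam * dl) ^+ 2).
Proof.
move=> + lam0 ld; elim: n Phi => [|n IH] Phi bPhi hPhi.
  by rewrite !Ex_power_prob0 mul0r addr0.
have bc := bmeas_cons bPhi.
pose g x := Ex (power_prob P n) (fun s => Phi [tuple of x :: s]).
have bs x : bmeas (fun s : n.-tuple T => Phi [tuple of x :: s]).
  by apply: bmeas_comp bPhi; apply: measurable_cons => //; exact: measurable_cst.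
have bg : bmeas g := bmeas_Ex_r P (power_prob P n) bc.
have eE : Ex (power_prob P n.+1) Phi = Ex P g by rewrite Ex_power_probS.
rewrite Ex_power_probS; last by apply: bmeas_expR; exact: bmeasZ.
apply: (@le_trans _ _ (Ex P (fun x => expR (n%:R * (lam * dl) ^+ 2) * expR (lam * g x)))).
  apply: Ex_le.
  - apply: (bmeas_Ex_r P (power_prob P n)
      (F := fun z : T * n.-tuple T => expR (lam * Phi [tuple of z.1 :: z.2]))).
    by apply: bmeas_expR; exact: bmeasZ.
  - by apply: bmeasZ; apply: bmeas_expR; exact: bmeasZ.
  - move=> x; rewrite -expRD addrC; apply: IH => // t t' i tt'.
    apply: (hPhi _ _ (lift ord0 i)) => j.
    case: (unliftP ord0 j) => [k ->|->] ki; last by [].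
    by rewrite !tnthS; apply: tt'; apply: contraNneq ki => ->.
rewrite ExZ; last by apply: bmeas_expR; exact: bmeasZ.
rewrite eE -natr1 mulrDl mul1r addrCA addrA -addrA expRD ler_pM2l ?expR_gt0//.
apply: mgf_bounded_osc => // x y; rewrite /g -ExB//.
rewrite -(Ex_cst (power_prob P n) dl); apply: Ex_le => [||s].
- exact: bmeasB.
- exact: bmeas_cst.
- apply: (hPhi _ _ ord0) => j.
  by case: (unliftP ord0 j) => [k ->|->] // _; rewrite !tnthS.
Qed.

Lemma bounded_differences_tail (P : probability T R) n (Phi : n.-tuple T -> R) (dl lam a : R) :
  bmeas Phi -> 0 <= lam -> lam * dl <= 1 / 3 ->
  (forall t t' i, (forall j, j != i -> tnth t j = tnth t' j) -> Phi t - Phi t' <= dl) ->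
  ((1 - expR (n%:R * (lam * dl) ^+ 2 - lam * a))%:E <=
   power_prob P n [set t | Phi t <= Ex (power_prob P n) Phi + a]%R)%E.
Proof.
move=> bPhi lam0 ld hPhi; set m := Ex _ _; set A := [set t | _].
have mA : measurable A.
  have -> : A = Phi @^-1` `]-oo, m + a].
    by apply/seteqP; split=> t /=; rewrite in_itv.
  by rewrite -[X in measurable X]setTI; apply: bPhi.1 => //; exact: measurable_itv.
have bA : bmeas (\1_A : n.-tuple T -> R).
  split; first exact: measurable_indic.
  by exists 1 => t _; rewrite indicE; case: (_ \in _); rewrite ?normr1 ?normr0.
have EA : (Ex (power_prob P n) \1_A)%:E = power_prob P n A.
  by rewrite Ex_EFin// integral_indic// setIT.
rewrite -EA lee_fin.
have -> : expR (n%:R * (lam * dl) ^+ 2 - lam * a) =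
   expR (- (lam * (m + a))) * expR (lam * m + n%:R * (lam * dl) ^+ 2).
  by rewrite -expRD; congr expR; ring.
rewrite lerBlDr.
(* Markov's inequality in pointwise form: 1 is at most the indicator of [A] plus
   [expR (lam * (Phi t - m - a))]. *)
apply: (@le_trans _ _ (Ex (power_prob P n) \1_A +
  expR (- (lam * (m + a))) * Ex (power_prob P n) (fun t => expR (lam * Phi t)))); last first.
  by rewrite lerD2l ler_pM2l ?expR_gt0//; exact: mgf_bounded_differences.
have be : bmeas (fun t => expR (lam * Phi t)) by apply: bmeas_expR; exact: bmeasZ.
rewrite -ExZ// -ExD//; last exact: bmeasZ.
rewrite -[leLHS](Ex_cst (power_prob P n)); apply: Ex_le => [||t].
- exact: bmeas_cst.
- by apply: bmeasD => //; exact: bmeasZ.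
- rewrite indicE; case: (boolP (t \in A)) => tA.
    by rewrite lerDl mulr_ge0 ?expR_ge0.
  rewrite add0r -expRD -[leLHS]expR0 ler_expR.
  have : m + a < Phi t by rewrite ltNge; apply: contra tA => h; rewrite inE.
  by move=> /ltW /(ler_wpM2l lam0); lra.
Qed.

End Concentration.

(** * Identification of product laws by boxes *)

Section ProductLaw.
Context {R : realType} {d} {T : measurableType d}.

Definition box n (A : 'I_n -> set T) : set (n.-tuple T) :=
  [set t | forall i, A i (tnth t i)].

Lemma measurable_box n (A : 'I_n -> set T) :
  (forall i, measurable (A i)) -> measurable (box A).
Proof.
move=> mA; have -> : box A = \bigcap_(i in [set: 'I_n]) ((fun t => tnth t i) @^-1` A i).
  by apply/seteqP; split=> t /= h i; [move=> _|]; exact: h.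
apply: fin_bigcap_measurable => // i _.
by rewrite -[X in measurable X]setTI; exact: measurable_tnth.
Qed.

Lemma power_prob_box (P : probability T R) n (A : 'I_n -> set T) :
  (forall i, measurable (A i)) ->
  power_prob P n (box A) = (\prod_(i < n) P (A i))%E.
Proof.
elim: n A => [|n IH] A mA.
  rewrite big_ord0 (_ : box A = setT) ?probability_setT//.
  by apply/seteqP; split=> // t _ [].
have -> : power_prob P n.+1 (box A) =
    (P \x power_prob P n)%E (A ord0 `*` box (fun i => A (lift ord0 i))).
  transitivity ((P \x power_prob P n)%E
    ((fun z : T * n.-tuple T => [tuple of z.1 :: z.2]) @^-1` box A)) => //.
  congr (_ _); apply/seteqP; split=> [[x s]|[x s]] /=.
    by move=> h; split=> [|i]; [exact: (h ord0)|have := h (lift ord0 i); rewrite tnthS].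
  by move=> [h0 h] i; case: (unliftP ord0 i) => [k ->|->] //; rewrite tnthS.
rewrite product_measure1E//; last by apply: measurable_box.
by rewrite big_ord_recl; congr (_ * _)%E; apply: IH => i; exact: mA.
Qed.

(** Boxes are stable under intersection and generate the sigma-algebra of tuples; independence
    prescribes exactly their probabilities. *)
Lemma power_prob_unique (P : probability T R) n (m : probability (n.-tuple T) R) :
  (forall A : 'I_n -> set T, (forall i, measurable (A i)) ->
     m (box A) = (\prod_(i < n) P (A i))%E) ->
  forall E, measurable E -> m E = power_prob P n E.
Proof.
move=> hm E mE.
pose G := [set B | exists2 A : 'I_n -> set T, (forall i, measurable (A i)) & B = box A].
apply: (@measure_unique _ _ _ G (fun=> setT)) => //.
- apply/seteqP; split.
    apply: smallest_sub; first exact: smallest_sigma_algebra.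
    move=> B; rewrite -bigcup_seq/= => -[i _ [A mA <-]]; apply: sub_sigma_algebra.
    exists (fun j => if j == i then A else setT).
      by move=> j; case: ifP.
    apply/seteqP; split=> t /=.
      by move=> [_ h] j; case: eqP => // ->.
    by move=> h; split=> //; have := h i; rewrite eqxx.
  apply: smallest_sub; first exact: sigma_algebra_measurable.
  by move=> _ [A mA ->]; exact: measurable_box.
- move=> _ _ [A mA ->] [A' mA' ->]; exists (fun i => A i `&` A' i).
    by move=> i; exact: measurableI.
  apply/seteqP; split=> t /=; first by move=> [h h'] i; split; [exact: h|exact: h'].
  by move=> h; split=> i; have [] := h i.
- by move=> _; exists (fun=> setT) => //; apply/seteqP; split.
- by rewrite bigcup_const.
- by move=> _ [A mA ->]; exact: (etrans (hm _ mA) (esym (power_prob_box P mA))).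
- by move=> _; rewrite (le_lt_trans (probability_le1 m measurableT))// ltry.
Qed.

End ProductLaw.

(** * Lipschitz functions and couplings *)

Local Notation edist := Defs.edist.

Section Lipschitz.
Context {R : realType} {p : nat}.
Local Notation T := (p.-tuple R).

Lemma euclid_ge0 (x y : T) : 0 <= edist x y.
Proof. exact: sqrtr_ge0. Qed.

Lemma euclid_xx (x : T) : edist x x = 0.
Proof. by rewrite /edist big1 ?sqrtr0// => i _; rewrite subrr expr0n. Qed.

Lemma euclid_le_sum (x y : T) : edist x y <= \sum_(i < p) `|tnth x i - tnth y i|.
Proof.
have s0 : 0 <= \sum_(i < p) `|tnth x i - tnth y i| by apply: sumr_ge0.
rewrite -[leRHS]ger0_norm// -sqrtr_sqr ler_sqrt ?sqr_ge0//.
rewrite expr2 mulr_suml; apply: ler_sum => i _.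
rewrite -(real_normK (num_real (_ - _))) expr2 ler_wpM2l//.
by rewrite (bigD1 i)//= lerDl sumr_ge0.
Qed.

Definition tdist n (t t' : n.-tuple T) : R :=
  \sum_(i < n) edist (tnth t i) (tnth t' i).

Definition rat_point n (r : n.-tuple (p.-tuple rat)) : n.-tuple T :=
  map_tuple (map_tuple ratr) r.

Lemma rat_point_dense n (t : n.-tuple T) e : 0 < e -> exists r, tdist t (rat_point r) < e.
Proof.
move=> e0; pose eta : R := e / (n * p).+1%:R.
have eta0 : 0 < eta by rewrite divr_gt0.
have H (ij : 'I_n * 'I_p) : exists r : rat, `|tnth (tnth t ij.1) ij.2 - ratr r| <= eta.
  set x := tnth _ _; have xe : x - eta < x + eta by lra.
  have [r] := rat_in_itvoo xe; rewrite in_itv/= => /andP[r1 r2]; exists r.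
  by rewrite ler_norml; apply/andP; split; lra.
have [f hf] := choice H.
exists [tuple [tuple f (i, j) | j < p] | i < n].
apply: (@le_lt_trans _ _ (\sum_(i < n) \sum_(j < p) eta)).
  apply: ler_sum => i _; apply: le_trans (euclid_le_sum _ _) _.
  by apply: ler_sum => j _; rewrite !tnth_map !tnth_ord_tuple; exact: (hf (i, j)).
rewrite !sumr_const !card_ord -mulrnA mulnC -mulr_natr /eta mulrAC ltr_pdivrMr//.
by rewrite ltr_pM2l// ltr_nat.
Qed.

Lemma measurable_euclid d (X : measurableType d) (f g : X -> T) :
  measurable_fun setT f -> measurable_fun setT g ->
  measurable_fun setT (fun x => edist (f x) (g x)).
Proof.
move=> mf mg; apply: (@measurableT_comp _ _ _ _ _ _ (@Num.sqrt R)).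
  by apply: continuous_measurable_fun; exact: sqrt_continuous.
apply: measurable_sum => i; apply: measurable_funX; apply: measurable_funB.
- exact: (measurableT_comp (measurable_tnth i) mf).
- exact: (measurableT_comp (measurable_tnth i) mg).
Qed.

(* A Lipschitz function is the infimum of countably many cones [Phi q + K d(., q)]. *)
Lemma lipschitz_measurable_tuple n (Phi : n.-tuple T -> R) K : 0 <= K ->
  (forall t t', `|Phi t - Phi t'| <= K * tdist t t') -> measurable_fun setT Phi.
Proof.
move=> K0 hPhi; apply: (measurability (@RGenOInfty.G R)).
  exact/RGenOInfty.measurableE.
move=> _ [_ [a ->] <-]; rewrite setTI.
pose S r := [set t | a < Phi (rat_point r) - K * tdist t (rat_point r)].
have mS r : measurable (S r).
  have mf : measurable_fun setT (fun t => Phi (rat_point r) - K * tdist t (rat_point r)).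
    apply: measurable_funB; first exact: measurable_cst.
    apply: measurable_funM; first exact: measurable_cst.
    apply: measurable_sum => i; apply: measurable_euclid; last exact: measurable_cst.
    exact: measurable_tnth.
  have -> : S r = (fun t => Phi (rat_point r) - K * tdist t (rat_point r)) @^-1` `]a, +oo[.
    by apply/seteqP; split=> t /=; rewrite in_itv/= andbT.
  by rewrite -[X in measurable X]setTI; apply: mf => //; exact: measurable_itv.
have -> : Phi @^-1` `]a, +oo[ =
    \bigcup_k (if unpickle k is Some r then S r else set0).
  apply/seteqP; split=> t /=; rewrite ?in_itv/= ?andbT.
    (* The distance to the rational point is lost twice with factor [K], through [Phi] and through
       the cone; the summand 1 covers [K = 0]. *)
    move=> at'; have e0 : 0 < (Phi t - a) / (2 * K + 1).
      by rewrite divr_gt0 ?subr_gt0//; lra.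
    have [r hr] := rat_point_dense t e0.
    exists (pickle r) => //; rewrite pickleK /S /=.
    have := hPhi t (rat_point r); rewrite ler_norml => /andP[_ h1].
    move: hr; rewrite ltr_pdivlMr; last by lra.
    have : 0 <= tdist t (rat_point r) by apply: sumr_ge0 => i _; exact: euclid_ge0.
    set z := tdist _ _ in h1 *; rewrite mulrDr mulr1 => z0 hz.
    have -> : Phi (rat_point r) - K * z = Phi t - (Phi t - Phi (rat_point r)) - K * z by ring.
    nra.
  move=> [k _]; case: unpickle => // r; rewrite /S /= => h.
  have := hPhi t (rat_point r); rewrite ler_norml => /andP[h1 _].
  lra.
apply: bigcupT_measurable => k; case: unpickle => [r|]; [exact: mS|exact: measurable0].
Qed.

Lemma lipschitz_measurable (f : T -> R) K : 0 <= K ->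
  (forall x y, `|f x - f y| <= K * edist x y) -> measurable_fun setT f.
Proof.
move=> K0 hf.
have m1 : measurable_fun setT (fun t : 1.-tuple T => f (tnth t ord0)).
  apply: (@lipschitz_measurable_tuple 1 _ K) => // t t'.
  by rewrite /tdist big_ord1; exact: hf.
have m2 : measurable_fun setT (fun x : T => [tuple of x :: [tuple]]).
  by apply: measurable_cons => //; exact: measurable_cst.
exact: (measurableT_comp m1 m2).
Qed.

(** The easy half of Kantorovich duality. The infimum need not be attained, and the slack
    [e / (K + 1)] costs at most [e], also when [K = 0]. *)
Lemma W1_lipschitz (P Q : probability T R) (eps K : R) (g : T -> R) :
  (W1 P Q <= eps%:E)%E -> 0 <= K -> bmeas g ->
  (forall x y, `|g x - g y| <= K * edist x y) -> Ex P g <= Ex Q g + K * eps.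
Proof.
move=> hW K0 bg hg; apply/ler_addgt0Pr => e e0.
have e1 : 0 < e / (K + 1) by rewrite divr_gt0//; lra.
have : (W1 P Q < (eps + e / (K + 1))%:E)%E.
  by apply: le_lt_trans hW _; rewrite lte_fin ltrDl.
move=> /ereal_inf_lt[_ [pi cpi <-] hpi].
have EP : Ex P g = Ex pi (fun z => g z.1).
  rewrite -(Ex_image pi measurable_fst bg) /Ex /Rintegral; congr fine.
  apply: eq_measure_integral => A mA _.
  exact: (esym (cpi A mA).1).
have EQ : Ex Q g = Ex pi (fun z => g z.2).
  rewrite -(Ex_image pi measurable_snd bg) /Ex /Rintegral; congr fine.
  apply: eq_measure_integral => A mA _.
  exact: (esym (cpi A mA).2).
have b1 : bmeas (fun z : T * T => g z.1) by apply: bmeas_comp bg; exact: measurable_fst.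
have b2 : bmeas (fun z : T * T => g z.2) by apply: bmeas_comp bg; exact: measurable_snd.
have med : measurable_fun setT (fun z : T * T => (edist z.1 z.2)%:E).
  by apply/measurable_EFinP; apply: measurable_euclid.
have h : ((Ex P g - Ex Q g)%:E <= (K * (eps + e / (K + 1)))%:E)%E.
  rewrite EP EQ -ExB// Ex_EFin; last exact: bmeasB.
  apply: (@le_trans _ _ (\int[pi]_z (K%:E * (edist z.1 z.2)%:E))%E); last first.
    rewrite ge0_integralZl//.
    - by rewrite EFinM lee_wpmul2l ?lee_fin// ltW.
    - by move=> z _; rewrite lee_fin euclid_ge0.
  apply: (@le_trans _ _ (\int[pi]_z (`|g z.1 - g z.2|)%:E)%E).
    have bd := bmeasB b1 b2.
    have bn : bmeas (fun z : T * T => `|g z.1 - g z.2|).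
      by split; [apply: measurableT_comp => //; exact: bd.1|exact: bdd_norm bd.2].
    by rewrite -!Ex_EFin// lee_fin; apply: Ex_le => // z; exact: ler_norm.
  apply: ge0_le_integral => //.
  - by apply/measurable_EFinP; apply: measurableT_comp => //; exact: (bmeasB b1 b2).1.
  - exact: measurable_funeM.
  - by move=> z _; rewrite -EFinM lee_fin.
move: h; rewrite lee_fin => h.
have : K * (e / (K + 1)) <= e.
  by rewrite mulrA ler_pdivrMr; [rewrite mulrDr mulr1 mulrC lerDl ltW|lra].
by rewrite mulrDr in h; lra.
Qed.

Lemma tdist_cons n x y (t t' : n.-tuple T) :
  tdist [tuple of x :: t] [tuple of y :: t'] = edist x y + tdist t t'.
Proof. by rewrite /tdist big_ord_recl; congr (_ + _); apply: eq_bigr => i _; rewrite !tnthS. Qed.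

Lemma tdist_xx n (t : n.-tuple T) : tdist t t = 0.
Proof. by rewrite /tdist big1// => i _; exact: euclid_xx. Qed.

(** Coordinates are exchanged one at a time: averaging over the others preserves the Lipschitz
    constant in the first. This avoids coupling the product laws. *)
Lemma W1_lipschitz_tuple (P Q : probability T R) (eps K : R) n (Phi : n.-tuple T -> R) :
  (W1 P Q <= eps%:E)%E -> 0 <= K -> bdd setT Phi ->
  (forall t t', `|Phi t - Phi t'| <= K * tdist t t') ->
  Ex (power_prob P n) Phi <= Ex (power_prob Q n) Phi + n%:R * (K * eps).
Proof.
move=> hW K0; elim: n Phi => [|n IH] Phi bPhi hPhi.
  by rewrite !Ex_power_prob0 mul0r addr0.
have bm : bmeas Phi by split=> //; exact: lipschitz_measurable_tuple hPhi.
rewrite !Ex_power_probS//.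
pose g x := Ex (power_prob Q n) (fun s => Phi [tuple of x :: s]).
have bs x : bmeas (fun s : n.-tuple T => Phi [tuple of x :: s]).
  by apply: bmeas_comp bm; apply: measurable_cons => //; exact: measurable_cst.
have bg : bmeas g := bmeas_Ex_r Q (power_prob Q n) (bmeas_cons bm).
apply: (@le_trans _ _ (Ex P (fun x => g x + n%:R * (K * eps)))).
  apply: Ex_le.
  - exact: (bmeas_Ex_r P (power_prob P n) (bmeas_cons bm)).
  - by apply: bmeasD => //; exact: bmeas_cst.
  - move=> x; apply: IH.
      by have [M hM] := bPhi; exists M => s _; exact: hM.
    by move=> t t'; have := hPhi [tuple of x :: t] [tuple of x :: t']; rewrite tdist_cons euclid_xx add0r.
rewrite ExD//; last exact: bmeas_cst.
rewrite Ex_cst -natr1 mulrDl mul1r addrA addrAC lerD2r.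
apply: (W1_lipschitz hW) => // x y.
rewrite /g -ExB//; apply: Ex_norm_le; first exact: bmeasB.
by move=> s; have := hPhi [tuple of x :: s] [tuple of y :: s]; rewrite tdist_cons tdist_xx addr0.
Qed.

End Lipschitz.

(** * Symmetrization *)

Section Symmetrization.
Context {R : realType} {p : nat}.
Local Notation T := (p.-tuple R).
Variables (F : set (T -> R)) (B : R).
Hypothesis F0 : F !=set0.
Hypothesis B0 : 0 <= B.
Hypothesis F1 : unit_bounded F.
Hypothesis FL : forall f, F f -> forall x y, `|f x - f y| <= B * edist x y.

Lemma supo_norm_le (Z : (T -> R) -> R) M :
  (forall f, F f -> `|Z f| <= M) -> `|supo F Z| <= M.
Proof.
move=> hZ; have bZ : bdd F Z by exists M.
rewrite ler_norml; apply/andP; split.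
  have [f Ff] := F0; apply: le_trans (supo_ub bZ Ff).
  by have := hZ f Ff; rewrite ler_norml => /andP[].
by apply: supo_le => // f Ff; exact: le_trans (ler_norm _) (hZ f Ff).
Qed.

Lemma supo_dist (Z Z' : (T -> R) -> R) dl : bdd F Z -> bdd F Z' ->
  (forall f, F f -> `|Z f - Z' f| <= dl) -> `|supo F Z - supo F Z'| <= dl.
Proof.
move=> bZ bZ' h; rewrite ler_norml lerBlDr; apply/andP; split.
  rewrite lerBrDr -lerBrDl opprK; apply: supo_le => // f Ff.
  have := supo_ub bZ Ff; have := h f Ff; rewrite ler_norml => /andP[]; lra.
apply: supo_le => // f Ff.
have := supo_ub bZ' Ff; have := h f Ff; rewrite ler_norml => /andP[]; lra.
Qed.

Lemma bmeas_class f : F f -> bmeas f.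
Proof.
by move=> Ff; split; [exact: lipschitz_measurable (FL Ff)|exists 1 => x _; exact: F1].
Qed.

Section SupMeasurable.
Variables (K c : R) (K0 : 0 <= K).

Lemma bmeas_supo1 (A : (T -> R) -> R) (phi : (T -> R) -> T -> R) : bdd F A ->
  (forall f x, F f -> `|phi f x| <= c) ->
  (forall f x y, F f -> `|phi f x - phi f y| <= K * edist x y) ->
  bmeas (fun x => supo F (fun f => A f + phi f x)).
Proof.
move=> [M hM] hc hK.
have hb x f : F f -> `|A f + phi f x| <= M + c.
  by move=> Ff; apply: le_trans (ler_normD _ _) _; rewrite lerD ?hM ?hc.
split; last by exists (M + c) => x _; apply: supo_norm_le; exact: hb.
apply: (lipschitz_measurable K0) => x y.
apply: supo_dist => [||f Ff]; [exists (M + c)|exists (M + c)|]; try exact: hb.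
by rewrite opprD addrACA subrr add0r hK.
Qed.

Lemma bmeas_supo_sum n (A : (T -> R) -> R) (phi : 'I_n -> (T -> R) -> T -> R) :
  bdd F A -> (forall i f x, F f -> `|phi i f x| <= c) ->
  (forall i f x y, F f -> `|phi i f x - phi i f y| <= K * edist x y) ->
  bmeas (fun t : n.-tuple T => supo F (fun f => A f + \sum_(i < n) phi i f (tnth t i))).
Proof.
move=> [M hM] hc hK.
have hb t f : F f -> `|A f + \sum_(i < n) phi i f (tnth t i)| <= M + \sum_(i < n) c.
  move=> Ff; apply: le_trans (ler_normD _ _) _; rewrite lerD ?hM//.
  by apply: le_trans (ler_norm_sum _ _ _) _; apply: ler_sum => i _; exact: hc.
split; last by eexists => t _; apply: supo_norm_le; exact: hb.
apply: (lipschitz_measurable_tuple K0) => t t'.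
apply: supo_dist => [||f Ff]; [eexists; exact: hb|eexists; exact: hb|].
rewrite opprD addrACA subrr add0r -sumrB mulr_sumr.
by apply: le_trans (ler_norm_sum _ _ _) _; apply: ler_sum => i _; exact: hK.
Qed.

End SupMeasurable.

Definition rademacher (A : (T -> R) -> R) (s : seq T) : R :=
  ravg (fun x f => 2 * pt_eval x f) s A (supo F).

(** Serves measurability in the sample; [dl] absorbs the observations already moved into the
    offsets. *)
Lemma rademacher_dist n (t t' : n.-tuple T) A A' dl : bdd F A -> bdd F A' ->
  (forall f, F f -> `|A f - A' f| <= dl) ->
  `|rademacher A t - rademacher A' t'| <= dl + 2 * B * tdist t t'.
Proof.
elim: n t t' A A' dl => [|n IH] t t' A A' dl bA bA' hAA.
  rewrite (tuple0 t) (tuple0 t') /rademacher /= /tdist big_ord0 mulr0 addr0.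
  exact: supo_dist.
case/tupleP: t => x s; case/tupleP: t' => y s'.
have h e : `|e| = 2 -> `|rademacher (fun f => A f + e * pt_eval x f) s
    - rademacher (fun f => A' f + e * pt_eval y f) s'|
    <= (dl + 2 * B * edist x y) + 2 * B * tdist s s'.
  have be z : `|e| = 2 -> bdd F (fun f : T -> R => e * pt_eval z f).
    by move=> e2; exists 2 => f Ff; rewrite normrM e2 ler_piMr// F1.
  move=> e2; apply: IH; [exact: bddD (be _ e2)|exact: bddD (be _ e2)|].
  move=> f Ff; rewrite opprD addrACA -mulrBr.
  apply: le_trans (ler_normD _ _) _; rewrite lerD ?hAA// normrM e2 -mulrA ler_pM2l//.
  exact: FL.
have h1 := h 2 (ger0_norm (ler0n _ 2)).
have h2 := h (-2); rewrite normrN ger0_norm// in h2.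
rewrite tdist_cons /rademacher /=.
rewrite (_ : (fun f => A f - 2 * pt_eval x f) = (fun f => A f + -2 * pt_eval x f)); last first.
  by apply/funext => f; rewrite mulNr.
rewrite (_ : (fun f => A' f - 2 * pt_eval y f) = (fun f => A' f + -2 * pt_eval y f)); last first.
  by apply/funext => f; rewrite mulNr.
rewrite -!/(rademacher _ _); move: h1 (h2 erefl); rewrite !ler_norml.
by move=> /andP[? ?] /andP[? ?]; apply/andP; split; lra.
Qed.

Lemma rademacher_norm_le (s : seq T) A M : (forall f, F f -> `|A f| <= M) ->
  `|rademacher A s| <= M + 2 * (size s)%:R.
Proof.
elim: s A M => [|x s IH] A M hM.
  by rewrite mulr0 addr0; exact: supo_norm_le.
have h1 : `|rademacher (fun f => A f + 2 * pt_eval x f) s| <= M + 2 + 2 * (size s)%:R.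
  apply: IH => f Ff; apply: le_trans (ler_normD _ _) _; rewrite lerD ?hM//.
  by rewrite normrM ger0_norm// ler_piMr// F1.
have h2 : `|rademacher (fun f => A f - 2 * pt_eval x f) s| <= M + 2 + 2 * (size s)%:R.
  apply: IH => f Ff; apply: le_trans (ler_normB _ _) _; rewrite lerD ?hM//.
  by rewrite normrM ger0_norm// ler_piMr// F1.
rewrite /= -natr1 /rademacher /= -!/(rademacher _ _); move: h1 h2; rewrite !ler_norml.
by move=> /andP[? ?] /andP[? ?]; apply/andP; split; lra.
Qed.

Lemma bmeas_rademacher n A : bdd F A -> bmeas (fun t : n.-tuple T => rademacher A t).
Proof.
move=> bA; split.
  apply: (@lipschitz_measurable_tuple _ _ _ _ (2 * B)); first by rewrite mulr_ge0.
  move=> t t'; have := @rademacher_dist n t t' A A 0 bA bA; rewrite add0r; apply.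
  by move=> f _; rewrite subrr normr0.
have [M hM] := bA; exists (M + 2 * n%:R) => t _.
by have := rademacher_norm_le t hM; rewrite size_tuple.
Qed.

Variable Q : probability T R.

Let cent (f : T -> R) x := f x - Ex Q f.

Let cent_le f x : F f -> `|cent f x| <= 2.
Proof.
move=> Ff; apply: le_trans (ler_normB _ _) _.
have -> : (2 : R) = 1 + 1 by ring.
by rewrite lerD ?F1//; apply: Ex_norm_le; [exact: bmeas_class|exact: F1].
Qed.

Let cent_lip f x y : F f -> `|cent f x - cent f y| <= 2 * B * edist x y.
Proof.
move=> Ff; have -> : cent f x - cent f y = f x - f y by rewrite /cent; ring.
apply: le_trans (FL Ff x y) _; apply: ler_wpM2r; first exact: euclid_ge0.
by have := B0; lra.
Qed.

Let scaled_le (e : R) f x : `|e| <= 2 -> F f -> `|e * f x| <= 2.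
Proof.
by move=> e2 Ff; rewrite normrM; apply: le_trans e2; rewrite ler_piMr// F1.
Qed.

Let scaled_lip (e : R) f x y : `|e| <= 2 -> F f ->
  `|e * f x - e * f y| <= 2 * B * edist x y.
Proof.
move=> e2 Ff; rewrite -mulrBr normrM -mulrA ler_pM// FL//.
Qed.

Let n2 : `|2 : R| <= 2. Proof. by rewrite ger0_norm. Qed.
Let nN2 : `|-2 : R| <= 2. Proof. by rewrite normrN ger0_norm. Qed.
Let B20 : 0 <= 2 * B. Proof. by rewrite mulr_ge0. Qed.

(* For an independent copy [x'] of [x], [A f + f x - f x'] is the mean of
   [A f + 2 f x] and [A f - 2 f x']. *)
Lemma symmetrization_step (A : (T -> R) -> R) : bdd F A ->
  Ex Q (fun x => supo F (fun f => A f + cent f x))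
  <= Ex Q (fun x => (supo F (fun f => A f + 2 * f x) + supo F (fun f => A f + -2 * f x)) / 2).
Proof.
move=> bA.
pose u x := supo F (fun f => A f + 2 * f x).
pose v x := supo F (fun f => A f + -2 * f x).
have bu : bmeas u.
  apply: (bmeas_supo1 B20 (phi := fun f x => 2 * f x) bA (c := 2)) => *;
    [exact: scaled_le|exact: scaled_lip].
have bv : bmeas v.
  apply: (bmeas_supo1 B20 (phi := fun f x => -2 * f x) bA (c := 2)) => *;
    [exact: scaled_le|exact: scaled_lip].
have bb e x : `|e| <= 2 -> bdd F (fun f : T -> R => A f + e * f x).
  by move=> e2; apply: bddD => //; exists 2 => f Ff; exact: scaled_le.
apply: (@le_trans _ _ (Ex Q (fun x => 2^-1 * u x + 2^-1 * Ex Q v))).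
  apply: Ex_le => [||x].
  - by apply: (bmeas_supo1 B20 bA (c := 2)) => *; [exact: cent_le|exact: cent_lip].
  - by apply: bmeasD; [exact: bmeasZ|exact: bmeas_cst].
  - apply: supo_le => // f Ff.
    have bf := bmeas_class Ff.
    have -> : A f + cent f x = 2^-1 * (A f + 2 * f x) + 2^-1 * (A f + -2 * Ex Q f).
      by rewrite /cent; field.
    apply: lerD; first by rewrite ler_pM2l ?invr_gt0//; exact: (supo_ub (bb _ x n2) Ff).
    rewrite ler_pM2l ?invr_gt0// -(Ex_cst Q (A f)) -ExZ// -ExD//; last 2 first.
    + exact: bmeas_cst.
    + exact: bmeasZ.
    apply: Ex_le => // [|y].
      by apply: bmeasD; [exact: bmeas_cst|exact: bmeasZ].
    exact: (supo_ub (bb _ y nN2) Ff).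
rewrite ExD; [|exact: bmeasZ|exact: bmeas_cst].
rewrite Ex_cst ExZ// -mulrDr.
rewrite (_ : (fun x => _) = (fun x => 2^-1 * (u x + v x))); last first.
  by apply/funext => x; rewrite mulrC.
by rewrite ExZ ?ExD//; exact: bmeasD.
Qed.

(** One observation is symmetrized with the others frozen in the offset; its doubled signed value
    then joins [A] for the induction hypothesis. *)
Lemma symmetrization n (A : (T -> R) -> R) : bdd F A ->
  Ex (power_prob Q n) (fun t : n.-tuple T =>
    supo F (fun f => A f + \sum_(i < n) (f (tnth t i) - Ex Q f)))
  <= Ex (power_prob Q n) (fun t => rademacher A t).
Proof.
elim: n A => [|n IH] A bA.
  rewrite !Ex_power_prob0 /rademacher /=; set u := supo _ _; rewrite le_eqVlt.
  by rewrite /u (_ : (fun f => _) = A) ?eqxx//; apply/funext => f; rewrite big_ord0 addr0.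
(* Hybrid sums: the first observation enters with factor [e], the others are still centred. *)
pose phi (e : R) (i : 'I_n.+1) (f : T -> R) x := if i == ord0 then e * f x else cent f x.
pose M e (t : n.+1.-tuple T) := supo F (fun f => A f + \sum_i phi e i f (tnth t i)).
have bM e : `|e| <= 2 -> bmeas (M e).
  move=> e2; apply: (bmeas_supo_sum B20 bA (c := 2)) => i f x; rewrite /phi.
    by case: ifP => _ Ff; [exact: scaled_le|exact: cent_le].
  by move=> y; case: ifP => _ Ff; [exact: scaled_lip|exact: cent_lip].
have bS : bmeas (fun t : n.+1.-tuple T =>
    supo F (fun f => A f + \sum_(i < n.+1) cent f (tnth t i))).
  by apply: (bmeas_supo_sum B20 (phi := fun _ => cent) bA (c := 2)) => *;
     [exact: cent_le|exact: cent_lip].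
have ME e x (s : n.-tuple T) : M e [tuple of x :: s] =
    supo F (fun f => A f + e * f x + \sum_(i < n) cent f (tnth s i)).
  rewrite /M; congr supo; apply/funext => f; rewrite big_ord_recl /phi eqxx addrA.
  by congr (_ + _); apply: eq_bigr => i _; rewrite tnthS.
have bMM : bmeas (fun t => 2^-1 * (M 2 t + M (-2) t)).
  by apply: bmeasZ; apply: bmeasD; exact: bM.
rewrite Ex_power_probS_swap//.
apply: (@le_trans _ _ (Ex (power_prob Q n) (fun s => Ex Q (fun x =>
   2^-1 * (M 2 [tuple of x :: s] + M (-2) [tuple of x :: s]))))).
  apply: Ex_le => [||s].
  - exact: (bmeas_Ex_l Q (power_prob Q n) (bmeas_cons bS)).
  - exact: (bmeas_Ex_l Q (power_prob Q n) (bmeas_cons bMM)).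
  have bAs : bdd F (fun f => A f + \sum_(i < n) cent f (tnth s i)).
    apply: bddD => //; exists (\sum_(i < n) 2) => f Ff.
    by apply: le_trans (ler_norm_sum _ _ _) _; apply: ler_sum => i _; exact: cent_le.
  have := symmetrization_step bAs; congr (Ex Q _ <= Ex Q _).
    apply/funext => x; congr supo; apply/funext => f.
    rewrite [in RHS]big_ord_recl [in RHS](eq_bigr (fun i => cent f (tnth s i))).
      by rewrite tnth0 -/(cent f x); ring.
    by move=> i _; rewrite tnthS.
  apply/funext => x; rewrite !ME mulrC; congr (_ * (_ + _)); congr supo;
    by apply/funext => f; rewrite addrAC.
(* The integrals are exchanged back: now the first observation is frozen and the others are left to
   the induction. *)
rewrite [leLHS](_ : _ = Ex Q (fun x => Ex (power_prob Q n) (fun s =>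
   2^-1 * (M 2 [tuple of x :: s] + M (-2) [tuple of x :: s])))); last first.
  exact: (etrans (esym (Ex_power_probS_swap Q bMM)) (Ex_power_probS Q bMM)).
rewrite Ex_power_probS; last exact: bmeas_rademacher.
apply: Ex_le => [||x].
- exact: (bmeas_Ex_r Q (power_prob Q n) (bmeas_cons bMM)).
- exact: (bmeas_Ex_r Q (power_prob Q n) (bmeas_cons (bmeas_rademacher n.+1 bA))).
have bsl e : `|e| <= 2 -> bmeas (fun s : n.-tuple T => M e [tuple of x :: s]).
  move=> e2; apply: bmeas_comp (bM _ e2).
  by apply: measurable_cons => //; exact: measurable_cst.
have bAe e : `|e| <= 2 -> bdd F (fun f : T -> R => A f + e * f x).
  by move=> e2; apply: bddD => //; exists 2 => f Ff; exact: scaled_le.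
have -> : (fun s : n.-tuple T => rademacher A [tuple of x :: s]) =
    (fun s => 2^-1 * (rademacher (fun f => A f + 2 * f x) s + rademacher (fun f => A f + -2 * f x) s)).
  apply/funext => s; rewrite /rademacher /= mulrC; congr (_ * (_ + _)); congr ravg.
  by apply/funext => f; rewrite mulNr.
rewrite ExZ; last by apply: bmeasD; exact: bsl.
rewrite ExZ; last by apply: bmeasD; apply: bmeas_rademacher; exact: bAe.
rewrite ler_pM2l ?invr_gt0//.
rewrite ExD; [|exact: bsl|exact: bsl].
rewrite ExD; [|by apply: bmeas_rademacher; exact: bAe|by apply: bmeas_rademacher; exact: bAe].
have IHe e : `|e| <= 2 -> Ex (power_prob Q n) (fun s => M e [tuple of x :: s]) <=
    Ex (power_prob Q n) (fun s => rademacher (fun f => A f + e * f x) s).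
  move=> e2; have := IH _ (bAe _ e2); congr (_ <= _).
  by congr Ex; apply/funext => s; rewrite ME.
by rewrite lerD ?IHe.
Qed.

End Symmetrization.

(** * Quadratic forms *)

Section QuadraticForms.
Context {R : realType} {p : nat}.
Implicit Types (u v w : 'I_p -> R) (S N : 'M[R]_p).

Definition bform S u v : R := \sum_(i < p) \sum_(j < p) u i * S i j * v j.

Definition mulv S u : 'I_p -> R := fun i => \sum_(j < p) S i j * u j.

Definition nsq u : R := \sum_(i < p) u i ^+ 2.

Lemma nsq_ge0 u : 0 <= nsq u.
Proof. by apply: sumr_ge0 => i _; exact: sqr_ge0. Qed.

Lemma vnorm_sqr u : vnorm u ^+ 2 = nsq u.
Proof. by rewrite sqr_sqrtr ?nsq_ge0. Qed.

Lemma bform_mulv S u v : bform S u v = \sum_i u i * mulv S v i.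
Proof.
apply: eq_bigr => i _; rewrite mulr_sumr; apply: eq_bigr => j _; exact: esym (mulrA _ _ _).
Qed.

Lemma bformC S u v : S^T = S -> bform S u v = bform S v u.
Proof.
move=> sS; rewrite /bform exchange_big/=; apply: eq_bigr => i _; apply: eq_bigr => j _.
by rewrite -[S in LHS]sS mxE; ring.
Qed.

Lemma qform_comb S u v a b : S^T = S ->
  qform S (fun i => a * u i + b * v i) =
  a ^+ 2 * qform S u + 2 * (a * b) * bform S u v + b ^+ 2 * qform S v.
Proof.
move=> sS; have -> : 2 * (a * b) * bform S u v = a * b * bform S u v + a * b * bform S v u.
  by rewrite (bformC v u sS); ring.
rewrite /qform /bform !mulr_sumr -!big_split/=; apply: eq_bigr => i _.
rewrite !mulr_sumr -!big_split/=; apply: eq_bigr => j _; ring.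
Qed.

Lemma qform_scale S u a : qform S (fun i => a * u i) = a ^+ 2 * qform S u.
Proof.
rewrite /qform mulr_sumr; apply: eq_bigr => i _; rewrite mulr_sumr.
apply: eq_bigr => j _; ring.
Qed.

Lemma nsq_scale u a : nsq (fun i => a * u i) = a ^+ 2 * nsq u.
Proof. by rewrite /nsq mulr_sumr; apply: eq_bigr => i _; rewrite exprMn. Qed.

Lemma qformB S N u : qform (S - N) u = qform S u - qform N u.
Proof.
rewrite /qform -sumrB; apply: eq_bigr => i _; rewrite -sumrB; apply: eq_bigr => j _.
by rewrite !mxE; ring.
Qed.

Lemma qform_scalar a u : qform (a%:M) u = a * nsq u.
Proof.
rewrite /qform /nsq mulr_sumr; apply: eq_bigr => i _; rewrite (bigD1 i)//= big1 ?addr0.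
  by rewrite mxE eqxx mulr1n; ring.
by move=> j ji; rewrite mxE eq_sym (negbTE ji) mulr0n mulr0 mul0r.
Qed.

Definition frob S : R := \sum_(i < p) \sum_(j < p) S i j ^+ 2.

Lemma frob_ge0 S : 0 <= frob S.
Proof. by apply: sumr_ge0 => i _; apply: sumr_ge0 => j _; exact: sqr_ge0. Qed.

Lemma nsq_mulv S u : nsq (mulv S u) <= frob S * nsq u.
Proof.
rewrite /nsq /frob mulr_suml; apply: ler_sum => i _; exact: cauchy_schwarz.
Qed.

Lemma dot_le u v : \sum_i u i * v i <= (nsq u + nsq v) / 2.
Proof.
rewrite /nsq -big_split/= mulr_suml; apply: ler_sum => i _.
by have := sqr_ge0 (u i - v i); rewrite sqrrB; lra.
Qed.

Lemma qform_bound S u : qform S u <= (1 + frob S) / 2 * nsq u.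
Proof.
have -> : qform S u = \sum_i u i * mulv S u i by rewrite -bform_mulv.
apply: le_trans (dot_le _ _) _; have := nsq_mulv S u; lra.
Qed.

Lemma bform_cauchy_schwarz N u v : N^T = N -> (forall w, 0 <= qform N w) ->
  bform N u v ^+ 2 <= qform N u * qform N v.
Proof.
move=> sN pN; set a := qform N u; set b := bform N u v; set c := qform N v.
have h s t : 0 <= s ^+ 2 * a + 2 * (s * t) * b + t ^+ 2 * c.
  by rewrite -qform_comb.
have c0 : 0 <= c := pN v; have a0 : 0 <= a := pN u.
have [cz|cnz] := eqVneq c 0.
  (* In this degenerate case the chosen coefficients give [- (a + 2) * b ^+ 2 >= 0], which forces
     [b = 0]. *)
  have := h b (- (a + 1)); rewrite cz mulr0 mulr0 addr0.
  have -> : b ^+ 2 * a + 2 * (b * - (a + 1)) * b = - (a + 2) * b ^+ 2 by ring.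
  by have := sqr_ge0 b; nra.
have cp : 0 < c by rewrite lt_neqAle eq_sym cnz.
have := h c (- b).
have -> : c ^+ 2 * a + 2 * (c * - b) * b + (- b) ^+ 2 * c = c * (a * c - b ^+ 2) by ring.
by rewrite pmulr_rge0// subr_ge0.
Qed.

(* If the supremum [mu] of the Rayleigh quotient were not an eigenvalue, then
   [mu - S] would be positive semidefinite and invertible, hence coercive. *)
Lemma qform_le_eigenvalue S M : S^T = S -> 0 <= M ->
  (forall a : R, eigenvalue S a -> a <= M) -> forall u, qform S u <= M * nsq u.
Proof.
move=> sS M0 hM.
pose E := [set qform S u | u in [set u | nsq u <= 1]].
have zE : E 0.
  exists (fun=> 0); first by rewrite /= /nsq big1// => i _; rewrite expr0n.
  by rewrite /qform big1// => i _; rewrite big1// => j _; rewrite mulr0.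
have bE : has_sup E.
  split; first by exists 0.
  exists ((1 + frob S) / 2) => _ [u u1 <-]; apply: le_trans (qform_bound _ _) _.
  by rewrite ler_piMr// divr_ge0// addr_ge0// frob_ge0.
set mu := sup E.
have mu_ge0 : 0 <= mu by apply: ub_le_sup zE; case: bE.
have hmu u : qform S u <= mu * nsq u.
  have [uz|unz] := eqVneq (nsq u) 0.
    by rewrite uz mulr0; have := qform_bound S u; rewrite uz mulr0.
  have up : 0 < nsq u by rewrite lt_neqAle eq_sym unz nsq_ge0.
  have s0 : 0 < Num.sqrt (nsq u) by rewrite sqrtr_gt0.
  have := @ub_le_sup _ E bE.2 (qform S (fun i => (Num.sqrt (nsq u))^-1 * u i)).
  rewrite qform_scale exprVn sqr_sqrtr ?nsq_ge0// => h.
  rewrite -ler_pdivrMr// mulrC; apply: h.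
  exists (fun i => (Num.sqrt (nsq u))^-1 * u i); last first.
    by rewrite qform_scale exprVn sqr_sqrtr ?nsq_ge0.
  by rewrite /= nsq_scale exprVn sqr_sqrtr ?nsq_ge0// mulVf.
have [muM|Mmu] := leP mu M.
  by move=> u; apply: le_trans (hmu u) _; rewrite ler_wpM2r ?nsq_ge0.
exfalso.
have neig : ~~ eigenvalue S mu by apply/negP => /hM; rewrite leNgt Mmu.
pose N := mu%:M - S.
have sN : N^T = N by rewrite /N linearB/= tr_scalar_mx sS.
have qN u : qform N u = mu * nsq u - qform S u by rewrite qformB qform_scalar.
have pN u : 0 <= qform N u by rewrite qN subr_ge0.
have uN : N \in unitmx.
  rewrite -row_free_unit -kermx_eq0 -submx0.
  move: neig; rewrite /eigenvalue /eigenspace negbK => /eqP <-.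
  apply/sub_kermxP; have -> : S - mu%:M = - N by rewrite /N opprB.
  by rewrite mulmxN mulmx_ker oppr0.
(* With [v = N u], Cauchy-Schwarz for the form of [N] bounds [nsq v ^+ 2] by
   [qform N u * qform N v], hence [nsq v] by a multiple of [qform N u]; then [u] is recovered from
   [v] by the inverse. *)
have coer : exists2 k, 0 < k & forall u, nsq u <= k * qform N u.
  exists (frob (invmx N) * ((1 + frob N) / 2) + 1).
    by rewrite ltr_wpDl// mulr_ge0 ?frob_ge0// divr_ge0// addr_ge0// frob_ge0.
  move=> u; pose v := mulv N u.
  have uv : u = mulv (invmx N) v.
    apply/funext => i; rewrite /mulv.
    have := mulVmx uN; move=> /(congr1 (fun A => A *m (\col_j u j))).
    rewrite mul1mx -mulmxA => /(congr1 (fun A : 'cV_p => A i ord0)).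
    rewrite [RHS]mxE => <-; rewrite mxE; apply: eq_bigr => j _; congr (_ * _).
    by rewrite mxE /v /mulv; apply: eq_bigr => k _; congr (_ * _); rewrite mxE.
  have h1 : nsq u <= frob (invmx N) * nsq v by rewrite {1}uv; exact: nsq_mulv.
  have bv : bform N u v = nsq v.
    by rewrite bformC// bform_mulv; apply: eq_bigr => i _; rewrite expr2.
  have h2 := bform_cauchy_schwarz u v sN pN; rewrite bv in h2.
  have h3 := qform_bound N v.
  have h4 : nsq v <= (1 + frob N) / 2 * qform N u.
    have [vz|vnz] := eqVneq (nsq v) 0.
      by rewrite vz mulr_ge0// divr_ge0// addr_ge0// frob_ge0.
    have vp : 0 < nsq v by rewrite lt_neqAle eq_sym vnz nsq_ge0.
    rewrite -(ler_pM2r vp) -expr2; apply: le_trans h2 _.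
    by have := ler_wpM2l (pN u) h3; lra.
  have h5 : frob (invmx N) * nsq v <= frob (invmx N) * ((1 + frob N) / 2 * qform N u).
    by rewrite ler_wpM2l// frob_ge0.
  have := pN u; rewrite mulrDl mul1r -[X in _ <= X + _]mulrA; lra.
have [k k0 hk] := coer.
have mup : 0 < mu := le_lt_trans M0 Mmu.
(* Coercivity lowers the Rayleigh quotient by [k^-1], against the choice of [mu]; the maximum covers
   a negative [mu - k^-1]. *)
have hE : mu <= Num.max 0 (mu - k^-1).
  apply: ge_sup; first by exists 0.
  move=> _ [u u1 <-]; have h1 : qform S u <= (mu - k^-1) * nsq u.
    have := hk u; rewrite mulrC -ler_pdivrMr// qN mulrBl; lra.
  have [h2|h2] := leP 0 (mu - k^-1).
    by apply: le_trans h1 _; rewrite ler_piMr.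
  by apply: le_trans h1 _; rewrite nmulr_rle0// nsq_ge0.
have k'0 : 0 < k^-1 by rewrite invr_gt0.
by move: hE; rewrite le_max => /orP[]; lra.
Qed.

(** Polarization with [y = S v]: the forms at [v + y/|y|] and [v - y/|y|] differ by [4 |y|], while
    the squared norms of these vectors sum to at most 4. *)
Lemma spec_norm_le S K : S^T = S -> 0 <= K ->
  (forall u, `|qform S u| <= K * nsq u) -> spec_norm S <= K.
Proof.
move=> sS K0 hK; apply: ge_sup.
  exists (vnorm (fun i => \sum_(j < p) S i j * (fun=> 0) j)), (fun=> 0) => //=.
  by rewrite /vnorm big1 ?sqrtr0// => i _; rewrite expr0n.
move=> _ [v v1 <-]; rewrite -/(mulv S v); set y := mulv S v.
have nv : nsq v <= 1.
  by rewrite -vnorm_sqr expr_le1// sqrtr_ge0.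
have [yz|ynz] := eqVneq (vnorm y) 0; first by rewrite yz.
have yp : 0 < vnorm y by rewrite lt_neqAle eq_sym ynz sqrtr_ge0.
pose a := (vnorm y)^-1.
have h1 := qform_comb v y 1 a sS; have h2 := qform_comb v y 1 (- a) sS.
have e : bform S v y = vnorm y ^+ 2.
  by rewrite bformC// bform_mulv vnorm_sqr; apply: eq_bigr => i _; rewrite expr2.
have nc b : nsq (fun i => 1 * v i + b * y i) = qform 1%:M (fun i => 1 * v i + b * y i).
  by rewrite qform_scalar mul1r.
have s1 : (1%:M : 'M[R]_p)^T = 1%:M by rewrite tr_scalar_mx.
have n1 := qform_comb v y 1 a s1; have n2 := qform_comb v y 1 (- a) s1.
have k1 := hK (fun i => 1 * v i + a * y i); have k2 := hK (fun i => 1 * v i + - a * y i).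
rewrite nc n1 !qform_scalar !mul1r in k1; rewrite nc n2 !qform_scalar !mul1r in k2.
rewrite h1 ler_norml in k1; rewrite h2 ler_norml in k2.
have ay : a ^+ 2 * nsq y = 1 by rewrite -vnorm_sqr -exprMn mulVf ?expr1n.
have ae : a * vnorm y ^+ 2 = vnorm y by rewrite expr2 mulrA mulVf// mul1r.
rewrite e in k1 k2; case/andP: k1 => _ k1; case/andP: k2 => k2 _.
rewrite !sqrrN !expr1n !mul1r ay in k1 k2.
rewrite !mulrN !mulNr in k2; rewrite -!mulrA ae in k1 k2.
have : K * nsq v <= K * 1 by rewrite ler_wpM2l.
lra.
Qed.

End QuadraticForms.

(** * Gaussian laws *)

Section GaussianLaws.
Context {R : realType}.

Lemma measurable_dotv p (u : 'I_p -> R) : measurable_fun setT (dotv u).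
Proof.
apply: measurable_sum => i; apply: measurable_funM; first exact: measurable_cst.
exact: measurable_tnth.
Qed.

Lemma dotv_scale p a (u : 'I_p -> R) x : dotv (fun i => a * u i) x = a * dotv u x.
Proof. by rewrite /dotv mulr_sumr; apply: eq_bigr => i _; rewrite mulrA. Qed.

Lemma gaussian_same_law p (mu mu' : probability (p.-tuple R) R) S S' u u' (h : R -> R) :
  is_gaussian mu S -> is_gaussian mu' S' -> qform S u = qform S' u' -> bmeas h ->
  Ex mu (fun x => h (dotv u x)) = Ex mu' (fun x => h (dotv u' x)).
Proof.
move=> g g' q bh.
rewrite -(Ex_image mu (measurable_dotv u) bh) -(Ex_image mu' (measurable_dotv u') bh).
rewrite /Ex /Rintegral; congr fine; apply: eq_measure_integral => A mA _.
by transitivity (mu (dotv u @^-1` A)) => //; rewrite g// q -g'.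
Qed.

Let shell12 : set R := `[1, 2]%classic.

(** When the standardised projection lies in [1, 2], its square is bounded and away from 0, which
    yields a definite gap; elsewhere only the sign of the integrand is used. *)
Definition unit_shell_mass : R := fine (normal_prob 0%R 1%R shell12).

Lemma unit_shell_mass_gt0 : 0 < unit_shell_mass.
Proof.
pose m : R := normal_peak 1 * expR (- 2).
have m0 : 0 < m by rewrite mulr_gt0 ?expR_gt0// normal_peak_gt0// oner_neq0.
have l1 : lebesgue_measure shell12 = 1%E.
  rewrite lebesgue_measure_itv/= lte_fin ltr1n/= -EFinB; congr (_%:E); ring.
have h : (m%:E <= normal_prob 0%R 1%R shell12)%E.
  rewrite /normal_prob.
  have -> : m%:E = (\int[lebesgue_measure]_(x in shell12) m%:E)%E.
    rewrite integral_cst//; last exact: measurable_itv.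
    by rewrite [X in (_ * X)%E](_ : _ = 1%E) ?mule1.
  apply: ge0_le_integral => //.
  - exact: measurable_itv.
  - by move=> x _; rewrite lee_fin ltW.
  - by apply/measurable_EFinP/measurable_funTS; exact: measurable_normal_pdf.
  - move=> x; rewrite /shell12 /= in_itv/= => /andP[x1 x2].
    rewrite lee_fin normal_pdfE ?oner_neq0// ler_pM2l ?normal_peak_gt0 ?oner_neq0//.
    rewrite /normal_fun ler_expR subr0 expr1n.
    rewrite mulNr lerN2 ler_pdivrMr//.
    by rewrite -mulr_natr expr2; nra.
have fin : normal_prob 0%R 1%R shell12 \is a fin_num.
  by apply: fin_num_measure; exact: measurable_itv.
by rewrite -lte_fin /unit_shell_mass fineK//; apply: lt_le_trans h; rewrite lte_fin.
Qed.

(** Twice the even part of the shifted sigmoid, the only part that matters under a symmetric law. *)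
Definition even_sigmoid (y : R) := sigmoid (y + 1) + sigmoid (- y + 1).

Lemma even_sigmoidE y : even_sigmoid y =
  1 + (1 - expR (-1) ^+ 2) / (1 + expR (-1) ^+ 2 + expR (-1) * (expR y + expR (- y))).
Proof.
rewrite /even_sigmoid /sigmoid !opprD opprK !expRD.
set a := expR (-1); rewrite (expRN y); set t := expR y.
have a0 : 0 < a := expR_gt0 _; have t0 : 0 < t := expR_gt0 _.
by field; rewrite !gt_eqF ?addr_gt0 ?mulr_gt0 ?addr_gt0 ?exprn_gt0 ?mulr_gt0//.
Qed.

Lemma sinh_ge (A : R) : 0 <= A -> A <= expR A - expR (- A).
Proof.
move=> A0; have h1 := expR_ge1Dx A.
have p : 0 < 1 + A by lra.
have h2 : expR (- A) <= (1 + A)^-1 by rewrite expRN lef_pV2 ?posrE ?expR_gt0.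
have : (1 + A)^-1 <= 1 by rewrite invf_le1//; lra.
lra.
Qed.

(** The identity [cosh y - cosh (r y) = 2 sinh A sinh D], with [A] and [D] half the sum and half the
    difference of [y] and [r y]. *)
Lemma cosh_diff (r y : R) : 0 <= r <= 1 ->
  (1 - r ^+ 2) * y ^+ 2 / 4 <= expR y + expR (- y) - (expR (r * y) + expR (- (r * y))).
Proof.
wlog y0 : y / 0 <= y.
  move=> h hr; have [y0|/ltW y0] := leP 0 y; first exact: h.
  have := h (- y); rewrite oppr_ge0 => /(_ y0 hr).
  by rewrite sqrrN mulrN !opprK [expR (- y) + _]addrC [expR (- (r * y)) + _]addrC.
move=> /andP[r0 r1]; pose A := (y + r * y) / 2; pose D := (y - r * y) / 2.
have ry : r * y <= y by rewrite ler_piMl.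
have ry0 : 0 <= r * y by rewrite mulr_ge0.
have A0 : 0 <= A by rewrite divr_ge0 ?addr_ge0.
have D0 : 0 <= D by rewrite divr_ge0 ?subr_ge0.
have eA := sinh_ge A0; have eD := sinh_ge D0.
have -> : expR y = expR A * expR D by rewrite -expRD; congr expR; rewrite /A /D; field.
have -> : expR (- y) = expR (- A) * expR (- D).
  by rewrite -expRD; congr expR; rewrite /A /D; field.
have -> : expR (r * y) = expR A * expR (- D).
  by rewrite -expRD; congr expR; rewrite /A /D; field.
have -> : expR (- (r * y)) = expR (- A) * expR D.
  by rewrite -expRD; congr expR; rewrite /A /D; field.
have -> : (1 - r ^+ 2) * y ^+ 2 / 4 = A * D by rewrite /A /D; field.
have : A * D <= (expR A - expR (- A)) * (expR D - expR (- D)) by rewrite ler_pM.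
lra.
Qed.

(** The numerator collects the coefficients of [even_sigmoidE] and [cosh_diff]; the square bounds
    the two denominators, since [y ^+ 2 <= V] gives [|y| <= 1 + V]. *)
Definition gap_const (V : R) : R :=
  (1 - expR (-1) ^+ 2) * expR (-1) / 4 / (2 + 2 * expR (1 + V)) ^+ 2.

Lemma expRN1_bounds : 0 < (expR (-1) : R) < 1.
Proof. by rewrite expR_gt0 -[ltRHS]expR0 ltr_expR; lra. Qed.

Lemma gap_const_gt0 V : 0 < gap_const V.
Proof.
have /andP[a0 a1] := expRN1_bounds.
have a2 : 0 < 1 - (expR (-1) : R) ^+ 2 by rewrite subr_gt0 exprn_ilt1// ltW.
rewrite /gap_const divr_gt0 ?divr_gt0 ?mulr_gt0// exprn_gt0// addr_gt0// mulr_gt0//.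
Qed.

Lemma even_sigmoid_diff (r y V : R) : 0 <= r <= 1 ->
  0 <= even_sigmoid (r * y) - even_sigmoid y /\
  (y ^+ 2 <= V -> gap_const V * ((1 - r ^+ 2) * y ^+ 2) <=
     even_sigmoid (r * y) - even_sigmoid y).
Proof.
move=> hr; have hc := cosh_diff y hr; have /andP[r0 r1] := hr.
have /andP[a0 a1] := expRN1_bounds; rewrite !even_sigmoidE.
have a2 : 0 < 1 - (expR (-1) : R) ^+ 2 by rewrite subr_gt0 exprn_ilt1// ltW.
rewrite /gap_const.
set a : R := expR (-1) in a0 a1 a2 *.
set P := expR y + expR (- y) in hc *; set Pr := expR (r * y) + expR (- (r * y)) in hc *.
have P0 : 0 < P by rewrite addr_gt0 ?expR_gt0.
have Pr0 : 0 < Pr by rewrite addr_gt0 ?expR_gt0.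
have r2 : 0 <= (1 - r ^+ 2) * y ^+ 2.
  by rewrite mulr_ge0 ?sqr_ge0// subr_ge0 expr_le1.
have d1 : 0 < 1 + a ^+ 2 + a * P by rewrite !addr_gt0 ?mulr_gt0 ?exprn_gt0.
have d2 : 0 < 1 + a ^+ 2 + a * Pr by rewrite !addr_gt0 ?mulr_gt0 ?exprn_gt0.
have -> : 1 + (1 - a ^+ 2) / (1 + a ^+ 2 + a * Pr) - (1 + (1 - a ^+ 2) / (1 + a ^+ 2 + a * P))
  = (1 - a ^+ 2) * a * (P - Pr) / ((1 + a ^+ 2 + a * Pr) * (1 + a ^+ 2 + a * P)).
  by field; rewrite !gt_eqF.
have PPr : 0 <= P - Pr by lra.
split; first by rewrite divr_ge0 ?mulr_ge0// ltW.
move=> yV.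
have Pb : P <= 2 * expR (1 + V).
  have yb : `|y| <= 1 + V.
    have := sqr_ge0 (`|y| - 1); rewrite sqrrB real_normK ?num_real// expr1n mulr1.
    by have := normr_ge0 y; lra.
  have l1 : expR y <= expR (1 + V) by rewrite ler_expR (le_trans (ler_norm _) yb).
  have l2 : expR (- y) <= expR (1 + V).
    by rewrite ler_expR; apply: le_trans yb; rewrite -normrN ler_norm.
  by rewrite /P; lra.
set W := 2 + 2 * expR (1 + V).
have W0 : 0 < W by rewrite addr_gt0// mulr_gt0// expR_gt0.
have aP X : 0 < X -> X <= 2 * expR (1 + V) -> 1 + a ^+ 2 + a * X <= W.
  move=> X0 XW; have : a * X <= X by apply: ler_piMl; exact: ltW.
  have : a ^+ 2 <= 1 by rewrite expr_le1// ltW.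
  by rewrite /W; lra.
have h1 := aP _ P0 Pb; have h2 : 1 + a ^+ 2 + a * Pr <= W by apply: aP => //; lra.
apply: (@le_trans _ _ ((1 - a ^+ 2) * a * (P - Pr) / W ^+ 2)).
  have -> : (1 - a ^+ 2) * a / 4 / W ^+ 2 * ((1 - r ^+ 2) * y ^+ 2) =
     (1 - a ^+ 2) * a * ((1 - r ^+ 2) * y ^+ 2 / 4) / W ^+ 2 by field; rewrite gt_eqF.
  by rewrite ler_pM2r ?invr_gt0 ?exprn_gt0// ler_pM2l ?mulr_gt0.
rewrite ler_wpM2l//; first by rewrite !mulr_ge0// ltW.
by rewrite lef_pV2 ?posrE ?exprn_gt0 ?mulr_gt0// expr2 ler_pM// ltW.
Qed.

Lemma sigmoid_shift_bmeas : bmeas (fun y : R => sigmoid (y + 1)).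
Proof.
split; last by exists 1 => y _; rewrite ger0_norm ?sigmoid_ge0// sigmoid_le1.
have ml (f : R -> R) : (forall u v, `|f u - f v| <= `|u - v|) -> measurable_fun setT f.
  move=> hf; apply: continuous_measurable_fun => x; apply/cvgrPdist_lt => e e0.
  by near=> z; apply: le_lt_trans (hf _ _) _; near: z; apply: cvgr_dist_lt => //; exact: cvg_id.
apply: ml => u v; apply: le_trans (sigmoid_lip _ _) _.
by rewrite opprD addrACA subrr addr0.
Unshelve. all: by end_near. Qed.

Lemma gaussian_gap p (mu1 mu2 : probability (p.-tuple R) R) S1 S2 (w : 'I_p -> R) V :
  is_gaussian mu1 S1 -> is_gaussian mu2 S2 ->
  0 <= qform S1 w -> qform S1 w <= qform S2 w -> qform S2 w <= V ->
  gap_const (4 * V) * unit_shell_mass / 2 * (qform S2 w - qform S1 w) <=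
  Ex mu1 (fun x => sigmoid (dotv w x + 1)) - Ex mu2 (fun x => sigmoid (dotv w x + 1)).
Proof.
move=> g1 g2 q10 q12 q2V; set q1 := qform S1 w in q10 q12 *; set q2 := qform S2 w in q12 q2V *.
have bs := sigmoid_shift_bmeas.
have [q2z|q2nz] := eqVneq q2 0.
  have q1z : q1 = 0 by apply/eqP; rewrite eq_le q10 andbT -q2z.
  have e : qform S1 w = qform S2 w by rewrite -/q1 -/q2 q1z q2z.
  by rewrite q1z q2z subrr mulr0 (gaussian_same_law g1 g2 e bs) subrr.
have q2p : 0 < q2 by rewrite lt_neqAle eq_sym q2nz (le_trans q10).
pose r := Num.sqrt (q1 / q2).
have r2 : r ^+ 2 = q1 / q2 by rewrite sqr_sqrtr// divr_ge0// ltW.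
have r01 : 0 <= r <= 1.
  rewrite sqrtr_ge0/= -(expr_le1 (n := 2))// ?sqrtr_ge0// r2 ler_pdivrMr// mul1r//.
have bd e : bmeas (fun x : p.-tuple R => sigmoid (e * dotv w x + 1)).
  apply: (bmeas_comp (h := fun x => e * dotv w x)) bs.
  by apply: measurable_funM; [exact: measurable_cst|exact: measurable_dotv].
(* Only the square of [e'] matters; using both signs produces [even_sigmoid]. *)
have key e e' : e ^+ 2 * q2 = qform S1 w -> e' ^+ 2 = e ^+ 2 ->
    Ex mu1 (fun x => sigmoid (dotv w x + 1)) = Ex mu2 (fun x => sigmoid (e' * dotv w x + 1)).
  move=> he ee'.
  have hq : qform S1 w = qform S2 (fun i => e' * w i) by rewrite qform_scale ee'.
  rewrite (gaussian_same_law g1 g2 hq bs).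
  by congr Ex; apply/funext => x; rewrite dotv_scale.
have bk e : bmeas (fun x : p.-tuple R => even_sigmoid (e * dotv w x)).
  have -> : (fun x : p.-tuple R => even_sigmoid (e * dotv w x)) =
      (fun x => sigmoid (e * dotv w x + 1) + sigmoid (- e * dotv w x + 1)).
    by apply/funext => x; rewrite /even_sigmoid mulNr.
  by apply: bmeasD; exact: bd.
have Ek e : Ex mu2 (fun x => even_sigmoid (e * dotv w x)) =
    Ex mu2 (fun x => sigmoid (e * dotv w x + 1)) +
    Ex mu2 (fun x => sigmoid (- e * dotv w x + 1)).
  rewrite -ExD//; congr Ex; apply/funext => x; by rewrite /even_sigmoid mulNr.
have E1 : Ex mu1 (fun x => sigmoid (dotv w x + 1)) =
    Ex mu2 (fun x => even_sigmoid (r * dotv w x)) / 2.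
  have rq : r ^+ 2 * q2 = qform S1 w by rewrite r2 divfK.
  have k1 := key r r rq erefl; have k2 := key r (- r) rq (sqrrN r).
  rewrite Ek -k1 -k2; by field.
have E2 : Ex mu2 (fun x => sigmoid (dotv w x + 1)) =
    Ex mu2 (fun x => even_sigmoid (1 * dotv w x)) / 2.
  have hq : qform S2 w = qform S2 (fun i => -1 * w i) by rewrite qform_scale sqrrN expr1n mul1r.
  have := gaussian_same_law g2 g2 hq bs.
  have -> : (fun x : p.-tuple R => sigmoid (dotv (fun i => -1 * w i) x + 1)) =
     (fun x => sigmoid (-1 * dotv w x + 1)) by apply/funext => x; rewrite dotv_scale.
  rewrite Ek => <-.
  have -> : (fun x : p.-tuple R => sigmoid (1 * dotv w x + 1)) = (fun x => sigmoid (dotv w x + 1)).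
    by apply/funext => x; rewrite mul1r.
  by field.
rewrite E1 E2 -mulrBl -ExB//.
have s0 : 0 < Num.sqrt q2 by rewrite sqrtr_gt0.
pose z (x : p.-tuple R) := dotv (fun i => (Num.sqrt q2)^-1 * w i) x.
pose D := z @^-1` shell12.
have mD : measurable D.
  by rewrite -[X in measurable X]setTI; apply: measurable_dotv => //; exact: measurable_itv.
have qz : qform S2 (fun i => (Num.sqrt q2)^-1 * w i) = 1.
  by rewrite qform_scale exprVn sqr_sqrtr ?(ltW q2p)// mulVf.
have bD : bmeas (\1_D : p.-tuple R -> R).
  split; first exact: measurable_indic.
  by exists 1 => t _; rewrite indicE; case: (_ \in _); rewrite ?normr1 ?normr0.
have ED : Ex mu2 \1_D = unit_shell_mass.
  rewrite /Ex /Rintegral integral_indic// setIT /unit_shell_mass; congr fine.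
  have := g2 (fun i => (Num.sqrt q2)^-1 * w i) shell12 (measurable_itv _).
  by rewrite qz oner_eq0 sqrtr1.
have -> : gap_const (4 * V) * unit_shell_mass / 2 * (q2 - q1) =
   gap_const (4 * V) * (q2 - q1) * unit_shell_mass / 2 by ring.
rewrite ler_pM2r ?invr_gt0// -ED -ExZ//; apply: Ex_le => [||x].
- exact: bmeasZ.
- exact: bmeasB.
have [h0 hV] := even_sigmoid_diff (dotv w x) (4 * V) r01.
rewrite mul1r indicE; case: (boolP (x \in D)) => xD; last by rewrite mulr0.
rewrite mulr1; move: xD; rewrite inE /D /shell12 /= in_itv/= /z dotv_scale => /andP[z1 z2].
have zy : dotv w x = Num.sqrt q2 * ((Num.sqrt q2)^-1 * dotv w x).
  by rewrite mulrA mulfV ?mul1r// gt_eqF.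
set zz := _^-1 * _ in z1 z2 zy.
have y2 : dotv w x ^+ 2 = q2 * zz ^+ 2 by rewrite zy exprMn sqr_sqrtr// ltW.
have zz1 : 1 <= zz ^+ 2 by rewrite expr2; nra.
have zz4 : zz ^+ 2 <= 4 by rewrite expr2; nra.
have yV : dotv w x ^+ 2 <= 4 * V.
  by rewrite y2 mulrC; apply: ler_pM => //; [exact: sqr_ge0|exact: ltW].
apply: le_trans (hV yV); rewrite ler_pM2l ?gap_const_gt0// r2 y2.
have -> : (1 - q1 / q2) * (q2 * zz ^+ 2) = (q2 - q1) * zz ^+ 2 by field.
by rewrite ler_peMr// subr_ge0.
Qed.

End GaussianLaws.

(** * Sixth moments of Gaussian laws *)

Section Moments.
Context {R : realType}.

Definition sextic (z : R) : R := (1 + z ^+ 2) ^+ 3.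

Lemma sextic_ge0 z : 0 <= sextic z.
Proof. by rewrite exprn_ge0// addr_ge0// sqr_ge0. Qed.

Lemma measurable_sextic : measurable_fun setT sextic.
Proof.
apply: measurable_funX; apply: measurable_funD; first exact: measurable_cst.
by apply: measurable_funX; exact: measurable_id.
Qed.

Lemma integral_normal_density (h : R -> R) : (forall x, 0 <= h x) -> measurable_fun setT h ->
  (\int[normal_prob 0%R 1%R]_x (h x)%:E =
   \int[lebesgue_measure]_x ((h x)%:E * (normal_pdf 0 1 x)%:E))%E.
Proof.
move=> h0 mh.
have dom := @normal_prob_dominates R 0 1.
have mE : measurable_fun setT (EFin \o h) by exact/measurable_EFinP.
rewrite -(Radon_Nikodym_SigmaFinite.change_of_variables dom (f := EFin \o h))//.
have iRN := Radon_Nikodym_SigmaFinite.f_integrable dom.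
apply: ae_eq_integral => //.
- by apply: emeasurable_funM => //; exact: measurable_int iRN.
- apply: emeasurable_funM => //; apply/measurable_EFinP; exact: measurable_normal_pdf.
apply: ae_eqe_mul2l; apply: integral_ae_eq => //.
  by apply/measurable_EFinP; exact: measurable_normal_pdf.
by move=> E _ mEE; rewrite -Radon_Nikodym_SigmaFinite.f_integral.
Qed.

(** Domination by the density of N(0, 4): with [y = x ^+ 2], the bound [1 + y <= 8 * expR (y / 8)]
    is cubed, whence 512, and [3 y / 8 - y / 2 = - y / 8]. *)
Lemma sextic_moment : exists2 K0 : R, 0 <= K0 &
  (\int[normal_prob 0%R 1%R]_x (sextic x)%:E <= K0%:E)%E.
Proof.
have two0 : (2 : R) != 0 by rewrite pnatr_eq0.
pose K0 : R := 512 * normal_peak 1 / normal_peak 2.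
have p1 : 0 < normal_peak (1 : R) by rewrite normal_peak_gt0// oner_neq0.
have p2 : 0 < normal_peak (2 : R) by rewrite normal_peak_gt0.
have K00 : 0 <= K0 by rewrite divr_ge0 ?mulr_ge0// ltW.
exists K0 => //; rewrite integral_normal_density; [|exact: sextic_ge0|exact: measurable_sextic].
apply: (@le_trans _ _ (\int[lebesgue_measure]_x (K0%:E * (normal_pdf 0 2 x)%:E))%E).
  apply: ge0_le_integral => //.
  - by move=> x _; rewrite mule_ge0// lee_fin ?sextic_ge0 ?normal_pdf_ge0.
  - apply: emeasurable_funM; apply/measurable_EFinP; first exact: measurable_sextic.
    exact: measurable_normal_pdf.
  - apply: emeasurable_funM; apply/measurable_EFinP; first exact: measurable_cst.
    exact: measurable_normal_pdf.
  move=> x _; rewrite -!EFinM lee_fin !normal_pdfE ?oner_neq0// /normal_fun !subr0.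
  set y := x ^+ 2; have y0 : 0 <= y := sqr_ge0 x.
  have c8 : sextic x <= 512 * expR (3 * y / 8).
    have -> : expR (3 * y / 8) = expR (y / 8) ^+ 3.
      by rewrite -expRM_natr; congr expR; field.
    have -> : (512 : R) = 8 ^+ 3 by rewrite -natrX.
    have l0 : 0 <= 1 + y by lra.
    have l1 : 0 <= 8 * expR (y / 8) by rewrite mulr_ge0 ?expR_ge0.
    rewrite -exprMn /sextic -/y lerXn2r//.
    by have := expR_ge1Dx (y / 8); lra.
  rewrite [leLHS]mulrCA.
  apply: (@le_trans _ _ (normal_peak 1 * (512 * expR (3 * y / 8) * expR (- y / (1 ^+ 2 *+ 2))))).
    by rewrite ler_pM2l// ler_wpM2r// expR_ge0.
  rewrite le_eqVlt; apply/orP; left; apply/eqP.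
  rewrite -mulrA -expRD /K0.
  have -> : 3 * y / 8 + - y / (1 ^+ 2 *+ 2) = - y / (2 ^+ 2 *+ 2).
    have -> : (1 : R) ^+ 2 *+ 2 = 2 by rewrite expr1n.
    have -> : (2 : R) ^+ 2 *+ 2 = 8 by ring.
    by field.
  by field; rewrite gt_eqF.
rewrite ge0_integralZl//.
- by rewrite integral_normal_pdf mule1.
- by apply/measurable_EFinP; exact: measurable_normal_pdf.
- by move=> x _; rewrite lee_fin normal_pdf_ge0.
Qed.

Definition sextic_const : R := sval (cid2 sextic_moment).

Lemma sextic_const_ge0 : 0 <= sextic_const.
Proof. by rewrite /sextic_const; case: cid2. Qed.

Lemma sextic_const_moment : (\int[normal_prob 0%R 1%R]_x (sextic x)%:E <= sextic_const%:E)%E.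
Proof. by rewrite /sextic_const; case: cid2. Qed.

Lemma measurable_sextic_dotv p (u : 'I_p -> R) :
  measurable_fun setT (fun x : p.-tuple R => (sextic (dotv u x))%:E).
Proof.
apply/measurable_EFinP; exact: (measurableT_comp measurable_sextic (measurable_dotv u)).
Qed.

(** After standardising, [1 + V z^2 <= (1 + V) (1 + z^2)]. The summand 1 in the constant covers
    variance 0, where the integral is 1. *)
Lemma gaussian_sextic_moment p (mu : probability (p.-tuple R) R) S (u : 'I_p -> R) V :
  is_gaussian mu S -> 0 <= qform S u <= V ->
  (\int[mu]_x (sextic (dotv u x))%:E <= ((1 + V) ^+ 3 * (sextic_const + 1))%:E)%E.
Proof.
move=> g /andP[q0 qV]; have c0 := sextic_const_ge0.
have V1 : 1 <= (1 + V) ^+ 3 by rewrite exprn_ege1// lerDl (le_trans q0).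
have push (v : 'I_p -> R) (m : {measure set R -> \bar R}) :
    (forall A, measurable A -> mu (dotv v @^-1` A) = m A) ->
    (\int[mu]_x (sextic (dotv v x))%:E = \int[m]_x (sextic x)%:E)%E.
  move=> hm.
  transitivity (\int[image_prob mu (measurable_dotv v)]_x (sextic x)%:E)%E.
    rewrite ge0_integral_distribution//.
      by apply/measurable_EFinP; exact: measurable_sextic.
    by move=> y; rewrite lee_fin sextic_ge0.
  by apply: eq_measure_integral => A mA _; exact: hm.
have [qz|qnz] := eqVneq (qform S u) 0.
  rewrite (push u (\d_(0 : R))).
    rewrite integral_dirac//; last by apply/measurable_EFinP; exact: measurable_sextic.
    rewrite diracT mul1e lee_fin /sextic expr0n/= addr0 expr1n.
    by rewrite -[leLHS]mulr1; apply: ler_pM => //; rewrite lerDr.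
  by move=> A mA; rewrite g// qz eqxx.
have qp : 0 < qform S u by rewrite lt_neqAle eq_sym qnz.
set r := Num.sqrt (qform S u); have r0 : 0 < r by rewrite sqrtr_gt0.
have r2 : r ^+ 2 = qform S u by rewrite sqr_sqrtr.
pose v i := r^-1 * u i.
have qv : qform S v = 1 by rewrite qform_scale exprVn r2 mulVf.
apply: (@le_trans _ _ (\int[mu]_x (((1 + V) ^+ 3)%:E * (sextic (dotv v x))%:E))%E).
  apply: ge0_le_integral => //.
  - by move=> x _; rewrite lee_fin sextic_ge0.
  - exact: measurable_sextic_dotv.
  - by apply: measurable_funeM; exact: measurable_sextic_dotv.
  move=> x _; rewrite -EFinM lee_fin /sextic -exprMn lerXn2r ?nnegrE ?mulr_ge0 ?addr_ge0 ?sqr_ge0//.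
    exact: le_trans qV.
  have -> : dotv u x = r * dotv v x by rewrite dotv_scale mulrA mulfV ?mul1r// gt_eqF.
  rewrite exprMn r2; set z := dotv v x ^+ 2; have z0 : 0 <= z := sqr_ge0 _.
  have : qform S u * z <= V * z by rewrite ler_wpM2r.
  have : 0 <= V by exact: le_trans qV.
  lra.
rewrite ge0_integralZl//; last 3 first.
- exact: measurable_sextic_dotv.
- by move=> x _; rewrite lee_fin sextic_ge0.
- by rewrite lee_fin (le_trans ler01).
(* [normal_prob] lives on [measurableTypeR R], which has the measurable sets of
   [R] but another display. *)
pose idR := fun x : measurableTypeR R => x : R.
have mid : measurable_fun setT idR by move=> _ A mA; rewrite setTI.
rewrite (push v (image_prob (normal_prob 0 1) mid)); last first.
  by move=> A mA; have := g v A mA; rewrite qv oner_eq0 sqrtr1.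
rewrite ge0_integral_distribution; last 2 first.
- by apply/measurable_EFinP; exact: measurable_sextic.
- by move=> y; rewrite lee_fin sextic_ge0.
rewrite [leRHS]EFinM lee_wpmul2l ?lee_fin ?(le_trans ler01)//.
by apply: le_trans sextic_const_moment _; rewrite lee_fin lerDl.
Qed.

Lemma measurable_moment_weight p (q : R) : measurable_fun setT (@moment_weight R p q).
Proof.
apply: measurable_funX; apply: measurable_funD; first exact: measurable_cst.
apply: measurable_funM; last exact: measurable_cst.
by apply: measurable_sum => i; apply: measurable_funX; exact: measurable_tnth.
Qed.

(** Jensen's inequality for the cube over the coordinates; it reduces the moment of the norm to
    one-dimensional marginals. *)
Lemma moment_weight_le_sextic p (q : R) (x : p.-tuple R) : (0 < p)%N -> q ^+ 2 = p%:R ->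
  moment_weight q x <= \sum_(i < p) p%:R^-1 * sextic (tnth x i).
Proof.
move=> p0 qp; have pR : 0 < p%:R :> R by rewrite ltr0n.
rewrite /moment_weight qp; set m := 1 + sqn x / p%:R.
have m0 : 0 <= m by rewrite addr_ge0// divr_ge0 ?sqn_ge0 ?ltW.
(* The tangent of the cube at the mean [m]: its linear terms sum to 0, and [a ^+ 3] exceeds it by
   [(a - m) ^+ 2 * (a + 2 * m)]. *)
apply: (@le_trans _ _ (\sum_(i < p) p%:R^-1 * (m ^+ 3 + 3 * m ^+ 2 * (1 + tnth x i ^+ 2 - m)))).
  rewrite -mulr_sumr big_split/= sumr_const card_ord -mulr_sumr sumrB big_split/=.
  rewrite !sumr_const card_ord -/(sqn x) le_eqVlt; apply/orP; left; apply/eqP.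
  rewrite -[m ^+ 3 *+ p]mulr_natr -[1 *+ p]mulr_natr -[m *+ p]mulr_natr.
  by rewrite /m; field; rewrite gt_eqF.
apply: ler_sum => i _; rewrite ler_pM2l ?invr_gt0// /sextic.
set a := 1 + _ ^+ 2; have a0 : 0 <= a by rewrite addr_ge0// sqr_ge0.
rewrite -subr_ge0 (_ : _ - _ = (a - m) ^+ 2 * (a + 2 * m)); last by ring.
by rewrite mulr_ge0 ?sqr_ge0// addr_ge0// mulr_ge0.
Qed.

Lemma gaussian_moment_weight p (q : R) (mu : probability (p.-tuple R) R) S V :
  (0 < p)%N -> q ^+ 2 = p%:R -> is_gaussian mu S ->
  (forall u, 0 <= qform S u <= V * nsq u) ->
  (\int[mu]_x (moment_weight q x)%:E <= ((1 + V) ^+ 3 * (sextic_const + 1))%:E)%E.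
Proof.
move=> p0 qp g hS; have pR : 0 < p%:R :> R by rewrite ltr0n.
pose e i : 'I_p -> R := fun j => (j == i)%:R.
have de i (x : p.-tuple R) : dotv (e i) x = tnth x i.
  rewrite /dotv (bigD1 i)//= /e eqxx mul1r big1 ?addr0// => j /negbTE ->.
  by rewrite mul0r.
have ne i : nsq (e i) = 1.
  rewrite /nsq (bigD1 i)//= /e eqxx expr1n big1 ?addr0// => j /negbTE ->.
  by rewrite expr0n.
have mc i : measurable_fun setT (fun x : p.-tuple R => (p%:R^-1 * sextic (tnth x i))%:E).
  apply/measurable_EFinP; apply: measurable_funM; first exact: measurable_cst.
  exact: (measurableT_comp measurable_sextic (measurable_tnth i)).
apply: (@le_trans _ _ (\int[mu]_x \sum_(i < p) (p%:R^-1 * sextic (tnth x i))%:E)%E).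
  apply: ge0_le_integral => //.
  - by move=> x _; rewrite lee_fin exprn_ge0// addr_ge0// divr_ge0 ?sqn_ge0// sqr_ge0.
  - by apply/measurable_EFinP; exact: measurable_moment_weight.
  - by apply: emeasurable_sum => i.
  - by move=> x _; rewrite sumEFin lee_fin; exact: moment_weight_le_sextic.
rewrite ge0_integral_sum//; last first.
  by move=> i x _; rewrite lee_fin mulr_ge0 ?sextic_ge0// invr_ge0 ltW.
have c i : (\int[mu]_x (p%:R^-1 * sextic (tnth x i))%:E <=
    (p%:R^-1 * ((1 + V) ^+ 3 * (sextic_const + 1)))%:E)%E.
  under eq_integral do rewrite EFinM -de.
  rewrite ge0_integralZl//; last 2 first.
  - exact: (measurable_sextic_dotv (e i)).
  - by move=> x _; rewrite lee_fin sextic_ge0.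
  rewrite [leRHS]EFinM lee_wpmul2l ?lee_fin ?invr_ge0 ?(ltW pR)//.
  by apply: (gaussian_sextic_moment g); have := hS (e i); rewrite ne mulr1.
apply: le_trans (lee_sum _ (fun i _ => c i)) _.
rewrite sumEFin lee_fin sumr_const card_ord -[leLHS]mulr_natr.
by rewrite mulrAC mulVf ?mul1r// gt_eqF.
Qed.

End Moments.

Section WeightSums.
Context {R : realType} {d} {T : measurableType d}.
Variable Q : probability T R.

Lemma Ex_sum_tuple (h : T -> R) n : bmeas h ->
  bmeas (fun t : n.-tuple T => \sum_(i < n) h (tnth t i)) /\
  Ex (power_prob Q n) (fun t => \sum_(i < n) h (tnth t i)) = n%:R * Ex Q h.
Proof.
move=> bh.
have bs m : bmeas (fun t : m.-tuple T => \sum_(i < m) h (tnth t i)).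
  split; first by apply: measurable_sum => i; exact: (measurableT_comp bh.1 (measurable_tnth i)).
  have [M hM] := bh.2; exists (\sum_(i < m) M) => t _.
  by apply: le_trans (ler_norm_sum _ _ _) _; apply: ler_sum => i _; exact: hM.
split; first exact: bs.
elim: n => [|n IH]; first by rewrite Ex_power_prob0 big_ord0 mul0r.
rewrite Ex_power_probS//.
rewrite (_ : (fun x => _) = (fun x => h x + n%:R * Ex Q h)); last first.
  apply/funext => x; rewrite -IH -[X in X + _](Ex_cst (power_prob Q n)) -(ExD _ (bmeas_cst _) (bs n)).
  congr Ex; apply/funext => s; rewrite big_ord_recl tnth0; congr (_ + _).
  by apply: eq_bigr => i _; rewrite tnthS.
by rewrite ExD//; [rewrite Ex_cst -natr1; ring|exact: bmeas_cst].
Qed.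

Lemma Ex_le_weight_sum (g : T -> R) n (Phi : n.-tuple T -> R) K al be :
  measurable_fun setT g -> (forall x, 0 <= g x) -> (\int[Q]_x (g x)%:E <= K%:E)%E ->
  bmeas Phi -> 0 < al ->
  (forall t, Phi t <= al * \sum_(i < n) g (tnth t i) + be) ->
  Ex (power_prob Q n) Phi <= al * (n%:R * K) + be.
Proof.
move=> mg g0 gK bPhi al0 hPhi; have [M hM] := bPhi.2.
(* Truncate [g] at a level [W] beyond which the assumed bound is trivial. *)
pose W := (`|M| + `|be|) / al.
have W0 : 0 <= W by rewrite divr_ge0 ?addr_ge0// ltW.
pose h x := Num.min (g x) W.
have h0 x : 0 <= h x by rewrite le_min g0.
have bh : bmeas h.
  split; first by apply: measurable_minr => //; exact: measurable_cst.
  by exists W => x _; rewrite ger0_norm// ge_min lexx orbT.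
have EhK : Ex Q h <= K.
  rewrite -lee_fin Ex_EFin//; apply: le_trans gK; apply: ge0_le_integral => //.
  - by move=> x _; rewrite lee_fin.
  - by apply/measurable_EFinP; case: bh.
  - exact/measurable_EFinP.
  - by move=> x _; rewrite lee_fin ge_min lexx.
have [bS ES] := @Ex_sum_tuple h n bh.
apply: (@le_trans _ _ (Ex (power_prob Q n) (fun t => al * \sum_(i < n) h (tnth t i) + be))).
  apply: Ex_le => //; first by apply: bmeasD; [exact: bmeasZ|exact: bmeas_cst].
  move=> t; case: (pselect (exists i, W <= g (tnth t i))) => [[i Wg]|ng].
    apply: (@le_trans _ _ `|M|).
      by apply: le_trans (ler_norm _) _; apply: le_trans (hM t I) _; exact: ler_norm.
    have : al * W <= al * \sum_(i < n) h (tnth t i).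
      rewrite ler_pM2l// (bigD1 i)//= {1}/h min_r// lerDl sumr_ge0//.
    rewrite /W mulrC divfK ?gt_eqF//.
    by have := ler_norm (- be); rewrite normrN; lra.
  rewrite (eq_bigr (fun i => g (tnth t i)))// => i _.
  by rewrite /h min_l// leNgt; apply/negP => /ltW Wg; apply: ng; exists i.
rewrite ExD; [|exact: bmeasZ|exact: bmeas_cst].
by rewrite Ex_cst ExZ// ES lerD2r ler_pM2l// ler_wpM2l.
Qed.

End WeightSums.

(** * Networks *)

Section NetworkClass.
Context {R : realType} {p : nat}.
Local Notation T := (p.-tuple R).
Variable B : R.
Hypothesis B0 : 0 < B.

Lemma dotv_lip (w : 'I_p -> R) (x y : T) :
  `|dotv w x - dotv w y| <= vnorm w * edist x y.
Proof.
have -> : dotv w x - dotv w y = \sum_i w i * (tnth x i - tnth y i).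
  by rewrite /dotv -sumrB; apply: eq_bigr => i _; rewrite mulrBr.
rewrite -sqrtr_sqr -sqrtrM ?nsq_ge0// ler_wsqrtr//.
exact: cauchy_schwarz.
Qed.

Definition lipschitz_class (F : set (T -> R)) := forall f, F f ->
  forall x y, `|f x - f y| <= B * edist x y.

Lemma hull_lipschitz (F : set (T -> R)) : lipschitz_class F -> lipschitz_class (hull F).
Proof.
move=> LF _ [m [w [g [Fg [w1 ->]]]]] x y; rewrite -sumrB.
apply: (@le_trans _ _ (\sum_(i < m) `|w i| * (B * edist x y))).
  apply: le_trans (ler_norm_sum _ _ _) _; apply: ler_sum => i _.
  by rewrite -mulrBr normrM ler_wpM2l// LF.
by rewrite -mulr_suml ler_piMl// mulr_ge0 ?euclid_ge0// ltW.
Qed.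

Lemma nodes_lipschitz k : lipschitz_class (@nodes R p B k).
Proof.
elim: k => [|k IH] f.
  move=> [w [b [wB ->]]] x y; apply: le_trans (sigmoid_lip _ _) _.
  rewrite opprD addrACA subrr addr0; apply: le_trans (dotv_lip _ _ _) _.
  by apply: ler_wpM2r => //; exact: euclid_ge0.
move=> [m [w [g [Ng [w1 ->]]]]] x y; apply: le_trans (max0_contract _ _) _.
have Hh : hull (nodes B k) (fun x => \sum_(i < m) w i * g i x) by exists m, w, g.
exact: (hull_lipschitz IH Hh x y).
Qed.

Lemma netD_ne0 L : @netD R p B L !=set0.
Proof. by exists (fun=> 0); exact: hull0. Qed.

Lemma netD_unit_bounded L : unit_bounded (@netD R p B L).
Proof. by apply: hull_unit_bounded; exact: nodes_unit_bounded. Qed.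

Lemma netD_lipschitz L : lipschitz_class (@netD R p B L).
Proof. by apply: hull_lipschitz; exact: nodes_lipschitz. Qed.

Lemma netD_bmeas L (f : T -> R) : netD B L f -> bmeas f.
Proof. exact: (bmeas_class (ltW B0) (@netD_unit_bounded L) (@netD_lipschitz L)). Qed.

Lemma netD_opp L (f : T -> R) : netD B L f -> netD B L (fun x => - f x).
Proof.
move=> [m [w [g [Ng [w1 ->]]]]]; exists m, (fun i => - w i), g; split=> //; split.
  by rewrite (eq_bigr (fun i => `|w i|))// => i _; rewrite normrN.
by apply/funext => x; rewrite -sumrN; apply: eq_bigr => i _; rewrite mulNr.
Qed.

(* Sigmoids are nonnegative, so the ReLU layers leave them unchanged. *)
Lemma nodes_sigmoid k (w : 'I_p -> R) b : vnorm w <= B ->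
  nodes B k (fun x => sigmoid (dotv w x + b)).
Proof.
move=> wB; elim: k => [|k IH]; first by exists w, b.
exists 1%N, (fun=> 1), (fun _ x => sigmoid (dotv w x + b)); split=> //; split.
  by rewrite big_ord1 normr1.
by apply/funext => x; rewrite big_ord1 mul1r max_l// sigmoid_ge0.
Qed.

Lemma netD_sigmoid L (w : 'I_p -> R) b : vnorm w <= B ->
  netD B L (fun x => sigmoid (dotv w x + b)).
Proof.
move=> wB; exists 1%N, (fun=> 1), (fun _ x => sigmoid (dotv w x + b)).
split; first by move=> _; exact: nodes_sigmoid.
by split; [rewrite big_ord1 normr1|apply/funext => x; rewrite big_ord1 mul1r].
Qed.

Variables (L : nat) (Q : probability T R).

(** Kept unnormalised, so that one observation changes it by at most 2 and its Lipschitz constant is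
    [B], whatever [n]. *)
Definition deviation n (t : n.-tuple T) : R :=
  supo (netD B L) (fun f => \sum_(i < n) (f (tnth t i) - Ex Q f)).

Let cent_le (f : T -> R) x : netD B L f -> `|f x - Ex Q f| <= 2.
Proof.
move=> Df; apply: le_trans (ler_normB _ _) _.
have -> : (2 : R) = 1 + 1 by ring.
rewrite lerD ?(netD_unit_bounded Df)//.
by apply: Ex_norm_le; [exact: netD_bmeas Df|exact: netD_unit_bounded Df].
Qed.

Lemma deviation_bdd n (t : n.-tuple T) :
  bdd (netD B L) (fun f => \sum_(i < n) (f (tnth t i) - Ex Q f)).
Proof.
exists (\sum_(i < n) 2) => f Df; apply: le_trans (ler_norm_sum _ _ _) _.
by apply: ler_sum => i _; exact: cent_le.
Qed.

Lemma deviation_ub n (t : n.-tuple T) f : netD B L f ->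
  \sum_(i < n) (f (tnth t i) - Ex Q f) <= deviation t.
Proof. exact: (supo_ub (deviation_bdd t)). Qed.

Lemma deviation_lipschitz n (t t' : n.-tuple T) :
  `|deviation t - deviation t'| <= B * tdist t t'.
Proof.
apply: (supo_dist (netD_ne0 L)); [exact: deviation_bdd|exact: deviation_bdd|].
move=> f Df; rewrite -sumrB /tdist mulr_sumr; apply: le_trans (ler_norm_sum _ _ _) _.
apply: ler_sum => i _; rewrite [X in `|X|](_ : _ = f (tnth t i) - f (tnth t' i)); last by ring.
exact: netD_lipschitz Df _ _.
Qed.

Lemma deviation_bmeas n : bmeas (@deviation n).
Proof.
split; first exact: lipschitz_measurable_tuple (ltW B0) (@deviation_lipschitz n).
exists (\sum_(i < n) 2) => t _; apply: (supo_norm_le (netD_ne0 L)) => f Df.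
apply: le_trans (ler_norm_sum _ _ _) _.
by apply: ler_sum => i _; exact: cent_le.
Qed.

Lemma deviation_bounded_differences n (t t' : n.-tuple T) i :
  (forall j, j != i -> tnth t j = tnth t' j) -> deviation t - deviation t' <= 2.
Proof.
move=> tt'; apply: le_trans (ler_norm _) _.
apply: (supo_dist (netD_ne0 L)); [exact: deviation_bdd|exact: deviation_bdd|].
move=> f Df; rewrite -sumrB (bigD1 i)//= big1 ?addr0; last first.
  by move=> j ji; rewrite tt'// subrr.
rewrite [X in `|X|](_ : _ = f (tnth t i) - f (tnth t' i)); last by ring.
apply: le_trans (ler_normB _ _) _; have -> : (2 : R) = 1 + 1 by ring.
by rewrite lerD ?(netD_unit_bounded Df).
Qed.

Lemma expected_deviation n S V : (0 < p)%N -> (0 < n)%N -> (2 <= L)%N ->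
  is_gaussian Q S -> (forall u, 0 <= qform S u <= V * nsq u) ->
  Ex (power_prob Q n) (@deviation n) <=
  2 ^+ L.-1 * rad_const B * ((1 + V) ^+ 3 * (sextic_const + 1) + 1)
    * Num.sqrt p%:R * Num.sqrt n%:R.
Proof.
move=> p0 n0 L2 g hS; set q := Num.sqrt p%:R; set N := Num.sqrt n%:R.
set K := (1 + V) ^+ 3 * _.
have q2 : q ^+ 2 = p%:R by rewrite sqr_sqrtr.
have N2 : N ^+ 2 = n%:R by rewrite sqr_sqrtr.
have q1 : 1 <= q by rewrite -[leLHS]sqrtr1 ler_sqrt// ler1n.
have N1 : 1 <= N by rewrite -[leLHS]sqrtr1 ler_sqrt// ler1n.
have q0 : 0 < q := lt_le_trans ltr01 q1.
have N0 : 0 < N := lt_le_trans ltr01 N1.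
have rc0 : 0 < rad_const B.
  rewrite /rad_const; have := sqr_ge0 B; have := sqr_ge0 (16 + 4 * B ^+ 2).
  by move=> h1 h2; have := mulr_ge0 h2 h1; nra.
have uD := @netD_unit_bounded L.
have sym := symmetrization (netD_ne0 L) (ltW B0) uD (@netD_lipschitz L) Q n (bdd0 _).
have -> : @deviation n = (fun t : n.-tuple T => supo (netD B L) (fun f =>
    0 + \sum_(i < n) (f (tnth t i) - Ex Q f))).
  by apply/funext => t; congr supo; apply/funext => f; rewrite add0r.
apply: le_trans sym _.
set M := 2 ^+ L.-1 * (q * rad_const B).
have M0 : 0 < M by rewrite mulr_gt0 ?exprn_gt0// mulr_gt0.
have [w0 iw] : (forall x : T, 0 <= moment_weight q x) /\
    (\int[Q]_x (moment_weight q x)%:E <= K%:E)%E.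
  split; last exact: gaussian_moment_weight p0 q2 g hS.
  by move=> x; exact: le_trans ler01 (moment_weight_ge1 q1 x).
have bR := bmeas_rademacher (netD_ne0 L) (ltW B0) uD (@netD_lipschitz L) n (bdd0 (netD B L)).
have := @Ex_le_weight_sum _ _ _ Q _ n _ K (M / N) (M * N)
  (measurable_moment_weight (p := p) q) w0 iw bR (divr_gt0 M0 N0).
move=> /(_ _) h; apply: le_trans (h _) _ => {h}.
  move=> t; apply: le_trans (ravg_netD B0 q1 N1 _ L2) _; first by rewrite size_tuple.
  rewrite big_tuple -/(M * _); rewrite le_eqVlt; apply/orP; left; apply/eqP.
  by rewrite /M; field; rewrite gt_eqF.
rewrite le_eqVlt; apply/orP; left; apply/eqP.
by rewrite -N2 /M; field; rewrite gt_eqF.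
Qed.

End NetworkClass.

(** * From minimality to the spectral norm *)

Section Estimator.
Context {R : realType} {p : nat}.
Local Notation T := (p.-tuple R).

Lemma inTheta_qform (M1 M2 : R) (S : 'M[R]_p) : 0 <= M2 -> inTheta M1 M2 S ->
  forall u, 0 <= qform S u <= M2 * nsq u.
Proof.
move=> M20 [sS [pS hS]] u; rewrite pS/=.
by apply: qform_le_eigenvalue => // a /hS[].
Qed.

(** Minimality with [f] compares the sample with [G S'], and [- f] compares [G S] with the sample;
    each costs one deviation, whence the 2. *)
Lemma wgan_obj_deviation B n L (G : 'M[R]_p -> probability T R) (Xs : 'I_n -> T)
    (S S' : 'M[R]_p) (f : T -> R) : 0 < B -> (0 < n)%N ->
  (wgan_obj B L G Xs S' <= wgan_obj B L G Xs S)%E -> netD B L f ->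
  Ex (G S) f - Ex (G S') f <= 2 / n%:R * deviation B L (G S) [tuple Xs i | i < n].
Proof.
move=> B0 n0 hobj Df; have nR : 0 < n%:R :> R by rewrite ltr0n.
set D := deviation _ _ _ _.
have term h S0 : netD B L h -> (((n%:R)^-1 * \sum_(i < n) h (Xs i))%:E
      - \int[G S0]_x (h x)%:E)%E =
    (n%:R^-1 * \sum_(i < n) h (Xs i) - Ex (G S0) h)%:E.
  by move=> Dh; rewrite -Ex_EFin// ; exact: netD_bmeas B0 _ _ Dh.
have dev h : netD B L h ->
    n%:R^-1 * \sum_(i < n) h (Xs i) - Ex (G S) h <= n%:R^-1 * D.
  move=> Dh; have := deviation_ub B0 (G S) [tuple Xs i | i < n] Dh.
  rewrite sumrB sumr_const card_ord -[_ *+ n]mulr_natl.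
  rewrite (eq_bigr (fun i => h (Xs i))); last by move=> i _; rewrite tnth_mktuple.
  rewrite -(ler_pM2l (x := n%:R^-1)) ?invr_gt0// mulrBr mulrA mulVf ?gt_eqF// mul1r.
  exact.
have h1 : (wgan_obj B L G Xs S <= (n%:R^-1 * D)%:E)%E.
  apply: ge_ereal_sup => _ [h Dh <-]; rewrite (term h S Dh) lee_fin; exact: dev.
have h2 : ((n%:R^-1 * \sum_(i < n) f (Xs i) - Ex (G S') f)%:E <= wgan_obj B L G Xs S')%E.
  by rewrite -(term f S' Df); apply: ereal_sup_ubound; exists f.
have := le_trans h2 (le_trans hobj h1); rewrite lee_fin => h3.
have := dev _ (netD_opp Df).
have -> : Ex (G S) (fun x => - f x) = - Ex (G S) f.
  have -> : (fun x => - f x) = (fun x => -1 * f x) by apply/funext => x; rewrite mulN1r.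
  by rewrite ExZ ?mulN1r//; exact: netD_bmeas B0 _ _ Df.
rewrite sumrN mulrN opprK => h4.
rewrite -(mulrA 2); lra.
Qed.

(** Directions are scaled to the full radius [B], whence the factor [M1 ^+ 2] and variances at most
    [B ^+ 2 * M2]. The gap is applied in the order of the two variances along the direction. *)
Lemma spec_norm_deviation (M1 M2 D : R) L (mu mu' : probability T R) (S S' : 'M[R]_p) :
  0 < M1 -> M1 <= M2 -> inTheta M1 M2 S -> inTheta M1 M2 S' ->
  is_gaussian mu S -> is_gaussian mu' S' ->
  (forall f, netD M1^-1 L f -> Ex mu f - Ex mu' f <= D) ->
  spec_norm (S' - S) <=
    D * M1 ^+ 2 / (gap_const (4 * (M1^-1 ^+ 2 * M2)) * unit_shell_mass / 2).
Proof.
move=> M10 M12 tS tS' g g' hD.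
have M20 : 0 < M2 := lt_le_trans M10 M12.
have qS := inTheta_qform (ltW M20) tS; have qS' := inTheta_qform (ltW M20) tS'.
set B := M1^-1 in hD *; have B0 : 0 < B by rewrite invr_gt0.
set c := gap_const _ * _ / 2.
have c0 : 0 < c by rewrite divr_gt0// mulr_gt0 ?gap_const_gt0 ?unit_shell_mass_gt0.
have hD' f : netD B L f -> `|Ex mu f - Ex mu' f| <= D.
  move=> Df; have h1 := hD _ Df; have h2 := hD _ (netD_opp Df).
  have bf := netD_bmeas B0 Df.
  have e m : Ex m (fun x : T => - f x) = - Ex m f.
    have -> : (fun x => - f x) = (fun x => -1 * f x) by apply/funext => x; rewrite mulN1r.
    by rewrite ExZ ?mulN1r.
  by rewrite !e in h2; rewrite ler_norml; apply/andP; split; lra.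
have D0 : 0 <= D by apply: le_trans (hD' _ (hull0 _)).
apply: spec_norm_le.
- by rewrite linearB/= tS.1 tS'.1.
- by rewrite !mulr_ge0 ?invr_ge0 ?sqr_ge0// ltW.
move=> u; rewrite qformB.
have [uz|unz] := eqVneq (nsq u) 0.
  have := qS u; have := qS' u; rewrite uz !mulr0 => /le_anti <- /le_anti <-.
  by rewrite subrr normr0.
have up : 0 < nsq u by rewrite lt_neqAle eq_sym unz nsq_ge0.
pose a := B / Num.sqrt (nsq u); pose w i := a * u i.
have a2 : a ^+ 2 = B ^+ 2 / nsq u by rewrite expr_div_n sqr_sqrtr// ltW.
have a0 : 0 < a ^+ 2 by rewrite a2 divr_gt0// exprn_gt0.
have nw : nsq w = B ^+ 2 by rewrite nsq_scale a2 divfK// gt_eqF.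
have vw : vnorm w <= B by rewrite /vnorm -/(nsq w) nw sqrtr_sqr ger0_norm// ltW.
have := hD' _ (netD_sigmoid L 1 vw) => hf.
have gap : c * `|qform S' w - qform S w| <= D.
  have /andP[s0 s1] := qS w; have /andP[s0' s1'] := qS' w.
  rewrite nw mulrC in s1 s1'.
  have [h|/ltW h] := leP (qform S w) (qform S' w).
    rewrite ger0_norm ?subr_ge0//.
    apply: le_trans (gaussian_gap g g' s0 h s1') _.
    exact: le_trans (ler_norm _) hf.
  rewrite ler0_norm ?subr_le0// opprB.
  apply: le_trans (gaussian_gap g' g s0' h s1) _.
  by apply: le_trans (ler_norm _) _; rewrite distrC.
rewrite !qform_scale -mulrBr normrM (ger0_norm (ltW a0)) a2 in gap.
rewrite [leRHS](_ : _ = (D / c) * (nsq u / B ^+ 2)); last first.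
  by rewrite /B exprVn invrK; ring.
rewrite -ler_pdivrMr ?divr_gt0 ?exprn_gt0// ler_pdivlMr// invf_div.
apply: le_trans gap; rewrite le_eqVlt; apply/orP; left; apply/eqP; ring.
Qed.

End Estimator.

Unset Implicit Arguments. Set Strict Implicit. Set Printing Implicit Defensive.

Theorem theorem9 (R : realType) :
  exists c : R, 0 < c /\
  forall M1 M2 : R, 0 < M1 -> M1 <= M2 ->
  exists C' : R, 0 < C' /\
  forall (p n L : nat) (eps : R) (Sstar : 'M[R]_p)
    (P : probability (p.-tuple R) R)
    (G : 'M[R]_p -> probability (p.-tuple R) R)
    (d : measure_display) (Omega : measurableType d)
    (P0 : probability Omega R)
    (X : 'I_n -> Omega -> p.-tuple R)
    (Shat : Omega -> 'M[R]_p),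
    (0 < n)%N -> (2 <= L)%N ->
    inTheta M1 M2 Sstar ->
    (forall S : 'M[R]_p, inTheta M1 M2 S -> is_gaussian (G S) S) ->
    (W1 P (G Sstar) <= eps%:E)%E ->
    (forall i, measurable_fun setT (X i)) ->
    (forall i (A : set (p.-tuple R)), measurable A ->
       P0 (X i @^-1` A) = P A) ->
    (forall A : 'I_n -> set (p.-tuple R), (forall i, measurable (A i)) ->
       P0 (\bigcap_(i in [set: 'I_n]) (X i @^-1` A i)) =
       (\prod_(i < n) P0 (X i @^-1` A i))%E) ->
    (forall w : Omega, inTheta M1 M2 (Shat w) /\
       forall S : 'M[R]_p, inTheta M1 M2 S ->
         (wgan_obj M1^-1 L G (fun i => X i w) (Shat w)
            <= wgan_obj M1^-1 L G (fun i => X i w) S)%E) ->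
    2 ^+ L * (p%:R / n%:R) + eps ^+ 2 <= c ->
    exists E : set Omega, measurable E /\
      ((1 - expR (- (p%:R + n%:R * eps ^+ 2)))%:E <= P0 E)%E /\
      forall w, E w ->
        spec_norm (Shat w - Sstar)
          <= C' * Num.max (2 ^+ L * Num.sqrt (p%:R / n%:R)) eps.
Proof.
(* Concentration with parameter [r], [r ^+ 2 = p / n + eps ^+ 2], and differences 2 requires
   [r * 2 <= 1 / 3], that is [r ^+ 2 <= 1 / 36]. *)
exists (1 / 36); split; first by rewrite divr_gt0.
move=> M1 M2 M10 M12; have M20 : 0 < M2 := lt_le_trans M10 M12.
set B := M1^-1; have B0 : 0 < B by rewrite invr_gt0.
pose c0 := gap_const (4 * (B ^+ 2 * M2)) * unit_shell_mass / 2.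
have c00 : 0 < c0 by rewrite divr_gt0// mulr_gt0 ?gap_const_gt0 ?unit_shell_mass_gt0.
pose Kd := rad_const B * ((1 + M2) ^+ 3 * (sextic_const + 1) + 1).
have Kd0 : 0 <= Kd.
  have h1 : 0 <= rad_const B.
    have := sqr_ge0 B; have := sqr_ge0 (16 + 4 * B ^+ 2) => h1 h2.
    by rewrite /rad_const; have := mulr_ge0 h2 h1; lra.
  have h2 : 0 <= (1 + M2) ^+ 3 by rewrite exprn_ge0// addr_ge0// ltW.
  have h3 := @sextic_const_ge0 R.
  by rewrite mulr_ge0// addr_ge0// mulr_ge0// addr_ge0.
(* 2 comes from minimality, [Kd] from the expected deviation, [B] from transport, and 10 from the
   fluctuation [5 * r] with [r <= 2 * m]. *)
pose C' := 2 * (Kd + B + 10) * M1 ^+ 2 / c0.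
have KB0 : 0 < Kd + B + 10 by lra.
have C'0 : 0 < C' by rewrite divr_gt0// mulr_gt0 ?exprn_gt0// mulr_gt0.
exists C'; split=> //.
move=> p n L eps Sstar P G d Omega P0 X Shat n0 L2 tS hG hW mX lawX indX hat hc.
have nR : 0 < n%:R :> R by rewrite ltr0n.
have eps0 : 0 <= eps.
  rewrite -lee_fin; apply: le_trans hW; apply: le_ereal_inf_tmp => _ [pi _ <-].
  by apply: integral_ge0 => z _; rewrite lee_fin sqrtr_ge0.
set m := Num.max _ eps.
have eps_m : eps <= m by rewrite le_max lexx orbT.
have m0 : 0 <= m by exact: le_trans eps_m.
(* In dimension 0 all quadratic forms vanish; otherwise the square root of [p] is at least 1, as the
   sigmoid bounds require. *)
have [pz|p0] := posnP p.
  exists setT; split; first exact: measurableT; split.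
    rewrite probability_setT lee_fin gerBl expR_ge0//.
  move=> w _; have [tw _] := hat w; apply: spec_norm_le.
  - by rewrite linearB/= tw.1 tS.1.
  - by rewrite mulr_ge0// ltW.
  - move=> u; rewrite (_ : qform _ u = 0).
      by rewrite normr0; apply: mulr_ge0; [exact: mulr_ge0 (ltW C'0) m0|exact: nsq_ge0].
    by rewrite /qform big1// => -[i ip]; exfalso; move: (ip); rewrite pz.
pose r := Num.sqrt (p%:R / n%:R + eps ^+ 2).
have pn0 : 0 <= p%:R / n%:R :> R by rewrite divr_ge0.
have r2 : r ^+ 2 = p%:R / n%:R + eps ^+ 2 by rewrite sqr_sqrtr// addr_ge0// sqr_ge0.
have r0 : 0 <= r := sqrtr_ge0 _.
have L1 : 1 <= 2 ^+ L :> R by rewrite exprn_ege1// ler1n.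
have r6 : r <= 1 / 6.
  rewrite -(ler_pXn2r (n := 2))// ?nnegrE// r2.
  have : p%:R / n%:R <= 2 ^+ L * (p%:R / n%:R) :> R by rewrite ler_peMl.
  have -> : (1 / 6 : R) ^+ 2 = 1 / 36 by field.
  lra.
pose Q := G Sstar; have gQ : is_gaussian Q Sstar := hG _ tS.
pose Psi := @deviation R p B L Q n.
have bPsi : bmeas Psi := deviation_bmeas B0 L Q n.
pose Xt w := [tuple X i w | i < n].
have mXt : measurable_fun setT Xt.
  apply/measurable_fun_tnthP => i; have -> : (fun t => tnth t i) \o Xt = X i.
    by apply/funext => w; rewrite /= tnth_mktuple.
  exact: mX.
pose good := [set t : n.-tuple (p.-tuple R) |
  Psi t <= Ex (power_prob P n) Psi + 5 * n%:R * r].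
have mgood : measurable good.
  have -> : good = Psi @^-1` `]-oo, Ex (power_prob P n) Psi + 5 * n%:R * r].
    by apply/seteqP; split=> t /=; rewrite in_itv.
  by rewrite -[X in measurable X]setTI; apply: bPsi.1 => //; exact: measurable_itv.
exists (Xt @^-1` good); split.
  by rewrite -[X in measurable X]setTI; exact: mXt.
split.
  have -> : P0 (Xt @^-1` good) = power_prob P n good.
    apply: (@power_prob_unique _ _ _ P n (image_prob P0 mXt)) => // A mA.
    transitivity (P0 (\bigcap_(i in [set: 'I_n]) (X i @^-1` A i))).
      congr (P0 _); apply/seteqP; split=> w /=.
        by move=> h i _; have := h i; rewrite tnth_mktuple.
      by move=> h i; rewrite tnth_mktuple; exact: h.
    by rewrite indX//; apply: eq_bigr => i _; exact: lawX.
  have rd : r * 2 <= 1 / 3 by lra.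
  have := bounded_differences_tail P (5 * n%:R * r) bPsi r0 rd
    (@deviation_bounded_differences _ _ _ B0 L Q n).
  apply: le_trans; rewrite lee_fin lerD2l lerN2 ler_expR.
  (* The factor 5 in the fluctuation leaves [4 n r^2 - 5 n r^2], exactly minus [p + n eps^2]. *)
  have -> : n%:R * (r * 2) ^+ 2 - r * (5 * n%:R * r) = - (n%:R * r ^+ 2) by ring.
  rewrite r2 mulrDr [n%:R * (_ / _)]mulrCA mulfV ?gt_eqF// mulr1//.
move=> w gw; have [tw hobj] := hat w.
have hmin := hobj _ tS.
apply: le_trans (spec_norm_deviation M10 M12 tS tw gQ (hG _ tw)
  (fun f Df => wgan_obj_deviation B0 n0 hmin Df)) _.
rewrite -/B -/c0 -/Q -/(Xt w) -/(Psi (Xt w)).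
suff h : n%:R^-1 * Psi (Xt w) <= (Kd + B + 10) * m.
  rewrite /C' [leRHS](_ : _ = 2 * ((Kd + B + 10) * m) * M1 ^+ 2 / c0); last by ring.
  by rewrite ler_pM2r ?invr_gt0// ler_pM2r ?exprn_gt0// -mulrA ler_pM2l.
set q := Num.sqrt (p%:R : R); set N := Num.sqrt (n%:R : R).
have N2 : N ^+ 2 = n%:R by rewrite sqr_sqrtr.
have N0 : 0 < N by rewrite sqrtr_gt0.
have qN : Num.sqrt (p%:R / n%:R) = q / N :> R by rewrite sqrtrM// sqrtrV.
have qN0 : 0 <= q / N by rewrite divr_ge0 ?sqrtr_ge0.
have hm : 2 ^+ L * (q / N) <= m by rewrite -qN le_max lexx.
have h1 : Psi (Xt w) <= Ex (power_prob P n) Psi + 5 * n%:R * r := gw.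
have h2 : Ex (power_prob P n) Psi <= Ex (power_prob Q n) Psi + n%:R * (B * eps).
  exact: (W1_lipschitz_tuple hW (ltW B0) bPsi.2 (@deviation_lipschitz _ _ _ B0 L Q n)).
have h3 := expected_deviation B0 p0 n0 L2 gQ (inTheta_qform (ltW M20) tS).
have h4 : n%:R^-1 * Psi (Xt w) <= 2 ^+ L.-1 * Kd * (q / N) + B * eps + 5 * r.
  rewrite mulrC ler_pdivrMr//; apply: le_trans h1 _.
  rewrite [leRHS](_ : _ = 2 ^+ L.-1 * Kd * q * N + n%:R * (B * eps) + 5 * n%:R * r); last first.
    by rewrite -N2; field; rewrite gt_eqF.
  rewrite lerD2r; apply: le_trans h2 _; rewrite lerD2r; apply: le_trans h3 _.
  by rewrite /Kd -/q -/N le_eqVlt; apply/orP; left; apply/eqP; ring.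
apply: le_trans h4 _.
have rle : r <= q / N + eps.
  rewrite -(ler_pXn2r (n := 2))// ?nnegrE ?addr_ge0// r2 -qN sqrrD sqr_sqrtr//.
  have h5 : 0 <= Num.sqrt (p%:R / n%:R) * eps *+ 2 :> R.
    by rewrite mulrn_wge0// mulr_ge0 ?sqrtr_ge0.
  lra.
have qm : q / N <= m by apply: le_trans hm; rewrite ler_peMl.
have qm2 : 2 ^+ L.-1 * (q / N) <= m.
  apply: le_trans hm; apply: ler_wpM2r => //; apply: ler_weXn2l; last exact: leq_pred.
  by rewrite ler1n.
have f1 : Kd * (2 ^+ L.-1 * (q / N)) <= Kd * m by rewrite ler_wpM2l.
have f2 : B * eps <= B * m by rewrite ler_pM2l.
rewrite -mulrA mulrCA !mulrDl; lra.
Qed.
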